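(* For each of the four balancing schemes (AVL trees, red-black trees, weight-balanced trees, treaps), the algorithms $\mathrm{union}$, $\mathrm{intersect}$ and $\mathrm{difference}$ described in the context, applied to two balanced BSTs of sizes $m$ and $n$ with $n\ge m$, have work $O\left(m\log\left(\frac{n}{m}+1\right)\right)$ and span $O(\log n\log m)$ (the bounds are in expectation for treaps).
   Context: A binary tree is either $\mathrm{Leaf}$ or $\mathrm{Node}(L,k,R)$; $\mathrm{expose}(\mathrm{Node}(L,k,R))=(L,k,R)$; size $|T|$, weight $w(T)=|T|+1$, height $h(T)$ ($0$ for Leaf). $\mathrm{rotateLeft}(\mathrm{Node}(A,x,\mathrm{Node}(B,y,C)))=\mathrm{Node}(\mathrm{Node}(A,x,B),y,C)$, $\mathrm{rotateRight}$ its inverse. A BST has keys from a total order with strictly increasing in-order sequence; a balanced BST is a BST satisfying one of the balancing schemes. Schemes and ranks: AVL (children heights differ by at most one at every node; $r(T)=h(T)-1$); red-black (nodes red/black, leaves black, no red node has a red child, all downward paths to leaves have equal numbers of black nodes, root may be red; $\mathrm{bh}(T)$ = number of black nodes on a downward root-to-leaf path including the root; $r(T)=2(\mathrm{bh}(T)-1)$ if the root is black, $2\mathrm{bh}(T)-1$ if red); $\alpha$ weight-balanced with $\frac{2}{11}<\alpha\le 1-\frac1{\sqrt2}$ (every $T=\mathrm{Node}(L,v,R)$ has $\alpha\le w(L)/w(T)\le1-\alpha$; $T_1,T_2$ have like weights if $\mathrm{Node}(T_1,v,T_2)$ satisfies this at its root; $r(T)=\lceil\log_2w(T)\rceil-1$);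 treaps (every key has an independent uniformly random priority; heap-ordered with the highest priority at the root; $r(T)=\lceil\log_2 w(T)\rceil-1$). Scheme-specific $\mathrm{join}(T_l,k,T_r)$ (all keys of $T_l$ $<k<$ all keys of $T_r$; returns a balanced BST on $T_l\cup\{k\}\cup T_r$). AVL: if $h(T_l)>h(T_r)+1$ use joinRight: with $(l,k',c)=\mathrm{expose}(T_l)$, if $h(c)\le h(T_r)+1$ set $T'=\mathrm{Node}(c,k,T_r)$ and return $\mathrm{Node}(l,k',T')$ if $h(T')\le h(l)+1$, else $\mathrm{rotateLeft}(\mathrm{Node}(l,k',\mathrm{rotateRight}(T')))$; otherwise $T'=\mathrm{joinRight}(c,k,T_r)$, $T''=\mathrm{Node}(l,k',T')$, return $T''$ if $h(T')\le h(l)+1$ else $\mathrm{rotateLeft}(T'')$; mirror case if $h(T_r)>h(T_l)+1$; else $\mathrm{Node}(T_l,k,T_r)$. RB: if $\mathrm{bh}(T_l)=\mathrm{bh}(T_r)$ return $\mathrm{Node}(T_l,k,T_r)$ with $k$ red if both roots are black, black otherwise; if $\mathrm{bh}(T_l)>\mathrm{bh}(T_r)$ walk down the right spine of $T_l$ to the first black node $c$ with $\mathrm{bh}(c)=\mathrm{bh}(T_r)$, replace it by red $\mathrm{Node}(c,k,T_r)$, then going up, whenever a black node $v$ has $R(v),R(R(v))$ both red, color $R(R(v))$ black and rotate left at $v$; finally if the root is red with a red right child recolor it black; mirror otherwise. WB: joinRightWB$(T_l,k,T_r)$: if like weights return $\mathrm{Node}(T_l,k,T_r)$; else $(l,k',c)=\mathrm{expose}(T_l)$,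 $T'=\mathrm{joinRightWB}(c,k,T_r)$, $(l_1,k_1,r_1)=\mathrm{expose}(T')$; if $l,T'$ like return $\mathrm{Node}(l,k',T')$; else if $l,l_1$ like and $\mathrm{Node}(l,k',l_1),r_1$ like return $\mathrm{rotateLeft}(\mathrm{Node}(l,k',T'))$; else $\mathrm{rotateLeft}(\mathrm{Node}(l,k',\mathrm{rotateRight}(T')))$; join uses joinRightWB when not like and $w(T_l)>w(T_r)$, the mirror when not like and $w(T_r)>w(T_l)$, else $\mathrm{Node}(T_l,k,T_r)$. Treap: if $k$'s priority exceeds those of both roots return $\mathrm{Node}(T_l,k,T_r)$; else if the root of $T_l$ has higher priority than the root of $T_r$ (or $T_r$ empty) return $\mathrm{Node}(L(T_l),k(T_l),\mathrm{join}(R(T_l),k,T_r))$, else $\mathrm{Node}(\mathrm{join}(T_l,k,L(T_r)),k(T_r),R(T_r))$. Generic algorithms. $\mathrm{split}(T,k)$: if $T=\mathrm{Leaf}$ return $(\mathrm{Leaf},\mathrm{false},\mathrm{Leaf})$; $(L,m,R)=\mathrm{expose}(T)$; if $k=m$ return $(L,\mathrm{true},R)$; if $k<m$: $(L_L,b,L_R)=\mathrm{split}(L,k)$, return $(L_L,b,\mathrm{join}(L_R,m,R))$; else $(R_L,b,R_R)=\mathrm{split}(R,k)$, return $(\mathrm{join}(L,m,R_L),b,R_R)$. $\mathrm{splitLast}(T)$: $(L,k,R)=\mathrm{expose}(T)$; if $R=\mathrm{Leaf}$ return $(L,k)$; else $(T',k')=\mathrm{splitLast}(R)$, return $(\mathrm{join}(L,k,T'),k')$.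 $\mathrm{join2}(T_l,T_r)$: if $T_l=\mathrm{Leaf}$ return $T_r$; else $(T_l',k)=\mathrm{splitLast}(T_l)$, return $\mathrm{join}(T_l',k,T_r)$. $\mathrm{union}(T_1,T_2)$: if $T_1=\mathrm{Leaf}$ return $T_2$; if $T_2=\mathrm{Leaf}$ return $T_1$; $(L_2,k_2,R_2)=\mathrm{expose}(T_2)$; $(L_1,b,R_1)=\mathrm{split}(T_1,k_2)$; in parallel $T_l=\mathrm{union}(L_1,L_2)$ and $T_r=\mathrm{union}(R_1,R_2)$; return $\mathrm{join}(T_l,k_2,T_r)$. $\mathrm{intersect}(T_1,T_2)$: if either is Leaf return Leaf; same splitting and parallel recursion with intersect; return $\mathrm{join}(T_l,k_2,T_r)$ if $b$ is true, else $\mathrm{join2}(T_l,T_r)$. $\mathrm{difference}(T_1,T_2)$ (keys of $T_1$ not in $T_2$): if $T_1=\mathrm{Leaf}$ return Leaf; if $T_2=\mathrm{Leaf}$ return $T_1$; same splitting and parallel recursion with difference; return $\mathrm{join2}(T_l,T_r)$. Cost model: work $W$ is the total number of operations, span $S$ the length of the critical path; expose, node creation, comparisons, recolorings, rotations and reading stored balance data (heights, colors, black heights, weights, priorities) cost $O(1)$; sequential composition adds work and span; for parallel composition $W(e_1\|e_2)=W(e_1)+W(e_2)+1$ and $S(e_1\|e_2)=\max(S(e_1),S(e_2))+1$. *)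

(* Defs.v *)
From HB Require Import structures.
From mathcomp Require Import all_boot all_order all_algebra.
From mathcomp Require Import all_classical all_reals all_analysis.

Set Implicit Arguments.
Unset Strict Implicit.
Unset Printing Implicit Defensive.

Import Order.TTheory GRing.Theory Num.Theory.

Local Open Scope nat_scope.

Record comp (A : Type) := Comp { cval : A; cwork : nat; cspan : nat }.

Definition ret A (x : A) : comp A := Comp x 0 0.

Definition bind A B (e : comp A) (f : A -> comp B) : comp B :=
  let r := f (cval e) in
  Comp (cval r) (cwork e + cwork r) (cspan e + cspan r).

Definition par A B (e1 : comp A) (e2 : comp B) : comp (A * B) :=
  Comp (cval e1, cval e2)
       (cwork e1 + cwork e2 + 1) (maxn (cspan e1) (cspan e2) + 1).

(* One constant-cost primitive step producing [x]: creating a node, a rotation,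
   a recoloring. *)
Definition op A (x : A) : comp A := Comp x 1 1.

(* One constant-cost primitive step before [e]: an expose (or emptiness test)
   when [e] is a match on a tree; a comparison, together with the reading of the
   stored balance data that it involves, when [e] is a conditional. *)
Definition tick A (e : comp A) : comp A :=
  Comp (cval e) (cwork e).+1 (cspan e).+1.

Definition cmap A B (f : A -> B) (e : comp A) : comp B :=
  Comp (f (cval e)) (cwork e) (cspan e).

Notation "'let*' x ':=' e 'in' f" := (bind e (fun x => f))
  (at level 200, x name, e at level 200, f at level 200, right associativity).
Notation "'let*' ' p ':=' e 'in' f" := (bind e (fun 'p => f))
  (at level 200, p strict pattern, e at level 200, f at level 200,
   right associativity).

(* [B] is the type of the balance data that cannot be recomputed from the shape
   and the keys of the tree: colors for red-black trees, [unit] for the other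
   schemes.  Heights, black heights and weights are functions of the tree, read
   at constant cost (see [tick]). *)
Inductive tree (B K : Type) :=
  | Leaf
  | Node of tree B K & B & K & tree B K.
Arguments Leaf {B K}.

Notation node l k r := (Node l tt k r).

Section Trees.
Context {B K : Type}.
Implicit Types T l r : tree B K.

Fixpoint tree_size T : nat := if T is Node l _ _ r then (tree_size l + tree_size r).+1 else 0.

Definition weight T : nat := (tree_size T).+1.

Fixpoint height T : nat :=
  if T is Node l _ _ r then (maxn (height l) (height r)).+1 else 0.

Fixpoint inorder T : seq K :=
  if T is Node l _ k r then inorder l ++ k :: inorder r else [::].

Definition is_leaf T : bool := if T is Leaf then true else false.

Definition right_child T := if T is Node _ _ _ r then r else Leaf.

(* The argument is returned unchanged when the rotation does not apply. *)
Definition rotate_left T :=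
  if T is Node a bx x (Node b by_ y c) then Node (Node a bx x b) by_ y c else T.

Definition rotate_right T :=
  if T is Node (Node a bx x b) by_ y c then Node a bx x (Node b by_ y c) else T.

Fixpoint mirror T :=
  if T is Node l b k r then Node (mirror r) b k (mirror l) else Leaf.

(* The mirror image of a join algorithm: left and right are exchanged in every
   step, at the same cost. *)
Definition mirrored (join : tree B K -> K -> tree B K -> comp (tree B K)) Tl k Tr :=
  cmap mirror (join (mirror Tr) k (mirror Tl)).

End Trees.

Definition bst (d : Order.disp_t) (K : orderType d) B (T : tree B K) : bool :=
  sorted <%O (inorder T).

Section AVL.
Context {K : Type}.
Implicit Types T Tl Tr : tree unit K.

Fixpoint avl_balanced T : bool :=
  if T is Node l _ _ r then
    [&& height l <= (height r).+1, height r <= (height l).+1,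
        avl_balanced l & avl_balanced r]
  else true.

(* Called with [height Tl > height Tr + 1], so that the [Leaf] branch is not
   reached. *)
Fixpoint avl_join_right Tl (k : K) Tr : comp (tree unit K) :=
  tick match Tl with
  | Leaf => op (node Leaf k Tr)
  | Node l _ k' c =>
    tick (if height c <= (height Tr).+1 then
      let* T' := op (node c k Tr) in
      tick (if height T' <= (height l).+1 then op (node l k' T')
      else
        let* T1 := op (rotate_right T') in
        let* T2 := op (node l k' T1) in
        op (rotate_left T2))
    else
      let* T' := avl_join_right c k Tr in
      let* T'' := op (node l k' T') in
      tick (if height T' <= (height l).+1 then ret T'' else op (rotate_left T'')))
  end.

Definition avl_join Tl (k : K) Tr : comp (tree unit K) :=
  tick (if (height Tr).+1 < height Tl then avl_join_right Tl k Tr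
  else tick (if (height Tl).+1 < height Tr then mirrored avl_join_right Tl k Tr
  else op (node Tl k Tr))).

End AVL.

Definition avl (d : Order.disp_t) (K : orderType d) (T : tree unit K) : bool :=
  bst T && avl_balanced T.

Inductive color := Red | Black.

Definition is_black (c : color) : bool := if c is Black then true else false.

Section RedBlack.
Context {K : Type}.
Implicit Types T Tl Tr : tree color K.

(* Leaves are black. *)
Definition red_root T : bool := if T is Node _ Red _ _ then true else false.

(* The numbers of black nodes on the root-to-leaf paths, leaves included. *)
Fixpoint black_counts T : seq nat :=
  if T is Node l c _ r then
    [seq is_black c + n | n <- black_counts l ++ black_counts r]
  else [:: 1].

(* Computed on the leftmost path. *)
Fixpoint bh T : nat := if T is Node l c _ _ then is_black c + bh l else 1.

Fixpoint no_red_red T : bool :=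
  if T is Node l c _ r then
    [&& is_black c || ~~ (red_root l || red_root r), no_red_red l & no_red_red r]
  else true.

Definition rb_balanced T : bool := no_red_red T && constant (black_counts T).

Definition blacken T := if T is Node l _ k r then Node l Black k r else Leaf.

Definition blacken_right T :=
  if T is Node l c k r then Node l c k (blacken r) else Leaf.

(* Called with [bh Tl > bh Tr], so that the [Leaf] branch of the match is not
   reached. *)
Fixpoint rb_join_right Tl (k : K) Tr : comp (tree color K) :=
  tick (if ~~ red_root Tl && (bh Tl == bh Tr) then op (Node Tl Red k Tr)
  else tick match Tl with
  | Leaf => op (Node Leaf Red k Tr)
  | Node l c k' r =>
    let* T' := rb_join_right r k Tr in
    let* T := op (Node l c k' T') in
    tick (if [&& is_black c, red_root T' & red_root (right_child T')] then
      let* T1 := op (blacken_right T') in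
      let* T2 := op (Node l c k' T1) in
      op (rotate_left T2)
    else ret T)
  end).

Definition rb_join_high Tl (k : K) Tr : comp (tree color K) :=
  let* T := rb_join_right Tl k Tr in
  tick (if red_root T && red_root (right_child T) then op (blacken T) else ret T).

Definition rb_join Tl (k : K) Tr : comp (tree color K) :=
  tick (if bh Tl == bh Tr then
    tick (op (Node Tl (if red_root Tl || red_root Tr then Black else Red) k Tr))
  else tick (if bh Tr < bh Tl then rb_join_high Tl k Tr
  else mirrored rb_join_high Tl k Tr)).

End RedBlack.

Definition rb (d : Order.disp_t) (K : orderType d) (T : tree color K) : bool :=
  bst T && rb_balanced T.

Section WeightBalanced.
Context {R : realType} {K : Type}.
Variable alpha : R.
Implicit Types T Tl Tr : tree unit K.

(* [weight T1 + weight T2] is the weight of a node with children [T1], [T2]. *)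
Definition like T1 T2 : bool :=
  let ratio : R := ((weight T1)%:R / (weight T1 + weight T2)%:R)%R in
  (alpha <= ratio <= 1 - alpha)%R.

Fixpoint wb_balanced T : bool :=
  if T is Node l _ _ r then [&& like l r, wb_balanced l & wb_balanced r] else true.

(* Every [Leaf] branch is an unspecified case of an expose. *)
Fixpoint wb_join_right Tl (k : K) Tr : comp (tree unit K) :=
  tick (if like Tl Tr then op (node Tl k Tr)
  else tick match Tl with
  | Leaf => op (node Leaf k Tr)
  | Node l _ k' c =>
    let* T' := wb_join_right c k Tr in
    let* T := op (node l k' T') in
    tick (if like l T' then ret T
    else tick match T' with
    | Leaf => ret T
    | Node l1 _ k1 r1 =>
      tick (if like l l1 && like (node l k' l1) r1 then op (rotate_left T)
      else
        let* T1 := op (rotate_right T') in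
        let* T2 := op (node l k' T1) in
        op (rotate_left T2))
    end)
  end).

Definition wb_join Tl (k : K) Tr : comp (tree unit K) :=
  tick (if ~~ like Tl Tr && (weight Tr < weight Tl) then wb_join_right Tl k Tr
  else tick (if ~~ like Tl Tr && (weight Tl < weight Tr) then
    mirrored wb_join_right Tl k Tr
  else op (node Tl k Tr))).

End WeightBalanced.

Definition wb (R : realType) (alpha : R) (d : Order.disp_t) (K : orderType d)
    (T : tree unit K) : bool :=
  bst T && wb_balanced alpha T.

Section Treap.
Context {R : realType} {K : Type}.
Variable prio : K -> R.
Implicit Types T Tl Tr : tree unit K.

Definition root_below (x : R) T : bool :=
  if T is Node _ _ k _ then (prio k <= x)%R else true.

Fixpoint heap_ordered T : bool :=
  if T is Node l _ k r then
    [&& root_below (prio k) l, root_below (prio k) r, heap_ordered l & heap_ordered r]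
  else true.

Definition key_above (k : K) T : bool :=
  if T is Node _ _ k' _ then (prio k' < prio k)%R else true.

(* The comparison of the priority of [k] with those of both roots precedes the
   matches on the trees. *)
Fixpoint treap_join Tl (k : K) : tree unit K -> comp (tree unit K) :=
  fix treap_join_Tl Tr :=
    tick (if key_above k Tl && key_above k Tr then op (node Tl k Tr)
    else tick match Tl, Tr with
    | Leaf, Leaf => op (node Leaf k Leaf)
    | Node ll _ kl rl, Leaf =>
      let* T := treap_join rl k Tr in op (node ll kl T)
    | Leaf, Node lr _ kr rr =>
      let* T := treap_join_Tl lr in op (node T kr rr)
    | Node ll _ kl rl, Node lr _ kr rr =>
      tick (if (prio kr < prio kl)%R then
        let* T := treap_join rl k Tr in op (node ll kl T)
      else
        let* T := treap_join_Tl lr in op (node T kr rr))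
    end).

End Treap.

Definition treap (R : realType) (d : Order.disp_t) (K : orderType d)
    (prio : K -> R) (T : tree unit K) : bool :=
  bst T && heap_ordered prio T.

Section SetAlgorithms.
Context {d : Order.disp_t} {K : orderType d} {B : Type}.
Variable join : tree B K -> K -> tree B K -> comp (tree B K).
Implicit Types T L R : tree B K.

Fixpoint tsplit T (k : K) : comp (tree B K * bool * tree B K) :=
  tick match T with
  | Leaf => ret (Leaf, false, Leaf)
  | Node L _ m R =>
    tick (if k == m then ret (L, true, R)
    else tick (if (k < m)%O then
      let* '(LL, b, LR) := tsplit L k in
      let* R' := join LR m R in
      ret (LL, b, R')
    else
      let* '(RL, b, RR) := tsplit R k in
      let* L' := join L m RL in
      ret (L', b, RR)))
  end.

(* [split_last L k R] is splitLast applied to a node with components [L], [k]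
   and [R]. *)
Fixpoint split_last L (k : K) R : comp (tree B K * K) :=
  tick match R with
  | Leaf => ret (L, k)
  | Node L' _ k' R' =>
    let* '(T', k'') := split_last L' k' R' in
    let* T := join L k T' in
    ret (T, k'')
  end.

Definition tjoin2 Tl Tr : comp (tree B K) :=
  tick match Tl with
  | Leaf => ret Tr
  | Node L _ k R => let* '(Tl', k') := split_last L k R in join Tl' k' Tr
  end.

Fixpoint tunion T1 T2 : comp (tree B K) :=
  tick (if is_leaf T1 then ret T2
  else tick match T2 with
  | Leaf => ret T1
  | Node L2 _ k2 R2 =>
    let* '(L1, b, R1) := tsplit T1 k2 in
    let* '(Tl, Tr) := par (tunion L1 L2) (tunion R1 R2) in
    join Tl k2 Tr
  end).

Fixpoint tintersect T1 T2 : comp (tree B K) :=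
  tick (if is_leaf T1 then ret Leaf
  else tick match T2 with
  | Leaf => ret Leaf
  | Node L2 _ k2 R2 =>
    let* '(L1, b, R1) := tsplit T1 k2 in
    let* '(Tl, Tr) := par (tintersect L1 L2) (tintersect R1 R2) in
    tick (if b then join Tl k2 Tr else tjoin2 Tl Tr)
  end).

Fixpoint tdifference T1 T2 : comp (tree B K) :=
  tick (if is_leaf T1 then ret Leaf
  else tick match T2 with
  | Leaf => ret T1
  | Node L2 _ k2 R2 =>
    let* '(L1, b, R1) := tsplit T1 k2 in
    let* '(Tl, Tr) := par (tdifference L1 L2) (tdifference R1 R2) in
    tjoin2 Tl Tr
  end).

End SetAlgorithms.

Inductive set_op := Union | Intersect | Difference.

Definition run_op (o : set_op) (d : Order.disp_t) (K : orderType d) B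
    (join : tree B K -> K -> tree B K -> comp (tree B K)) :
    tree B K -> tree B K -> comp (tree B K) :=
  match o with
  | Union => tunion join
  | Intersect => tintersect join
  | Difference => tdifference join
  end.

Section RandomPriorities.
Local Open Scope ring_scope.
Local Open Scope classical_set_scope.
Context {R : realType} {dW : measure_display} {W : measurableType dW}.
Variable P : probability W R.

(* The product rule for every finite subfamily of [X]. *)
Definition mutually_independent (K : eqType) (X : K -> {RV P >-> R}) : Prop :=
  forall (s : seq K) (A : K -> set R), uniq s -> (forall k, measurable (A k)) ->
    P (\bigcap_(k in [set` s]) (X k @^-1` A k))
      = (\prod_(k <- s) P (X k @^-1` A k))%E.

(* Independent priorities, uniformly distributed in [0, 1], one for each key:
   equal keys of two trees have the same priority. *)
Definition iid_uniform (K : eqType) (prio : K -> {RV P >-> R}) : Prop :=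
  mutually_independent prio /\
  forall (k : K) (A : set R), measurable A ->
    distribution P (prio k) A = uniform_prob (@ltr01 R) A.

(* The key sequence [s] is fixed; only the shape of the treap is random.  For
   distinct priorities the treap is unique; the first condition makes [T] a
   random variable whatever the choice made in case of ties. *)
Definition random_treap (d : Order.disp_t) (K : orderType d)
    (prio : K -> {RV P >-> R}) (s : seq K) (T : W -> tree unit K) : Prop :=
  (forall t, measurable [set w | T w = t]) /\
  forall w, treap (fun k => prio k w) (T w) /\ inorder (T w) = s.

End RandomPriorities.

Definition work_bound (R : realType) (m n : nat) : R :=
  (m%:R * ln (n%:R / m%:R + 1))%R.

Definition span_bound (R : realType) (m n : nat) : R := (ln n%:R * ln m%:R)%R.

(* [m] is the size of the smaller tree, which can be either argument. *)
Definition sizes (m n a b : nat) : Prop :=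
  m <= n /\ ((a = m /\ b = n) \/ (a = n /\ b = m)).

(* Main.v *)
(* For the three deterministic schemes only the abstract properties in [joinable]
   matter.  A split telescopes, so one step of the recursion, at a subtree of the
   second tree and a fragment of size [s] of the first one, costs [O(log (1 + s))]:
   the ranks of the two recursive results differ by that much.  The fragments at
   one level are disjoint; concavity of the logarithm at the large subtrees, and
   the bound [O(s)] at the small ones, give the work by induction on the second
   tree, and the number of levels gives the span.

   For treaps the cost is bounded by the number of pairs (v, x) with [v] a key of
   the second tree, [x] a key on the search path of [v], and [v] of maximal
   priority between them in the second tree.  Such a pair occurs with probability
   at most 2 / (a b), where [a] and [b] count the keys of the two trees from [v] to
   [x].  Summing over the pairs gives the work.  The span is at most a product of
   two path lengths; exponential moments of the height and AM-GM bound its mean.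
   Almost surely there are no ties, and each order of the priorities of [u] keys
   has probability at most 1 / u!, so it suffices to average over permutations. *)
Require Import Defs.
From HB Require Import structures.
From mathcomp Require Import all_boot all_order all_algebra.
From mathcomp Require Import all_classical all_reals all_analysis measurable_realfun.
From mathcomp Require Import ring lra zify.

Set Implicit Arguments.
Unset Strict Implicit.
Unset Printing Implicit Defensive.

Import Order.TTheory GRing.Theory Num.Theory.
Import HBNNSimple.

Local Open Scope ring_scope.

(** * Joinable balancing schemes *)

(** The recursion follows the second tree, whichever tree is the larger one. A rank threshold [t]
    and a tangent point [l] of the logarithm are therefore parameters of one charging scheme, chosen
    at the end from [n / m] for each order of the sizes. The cost of a step rests on comparing the
    ranks of the two recursive results: for a union with the subtrees of the second tree, from above
    by [jn_up] and from below up to a loss logarithmic in the fragment; for the other operations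
    with the fragment alone.

    Treaps admit no such rank, being balanced only on average. Their costs are expressed by search
    paths in key lists fixed before the priorities are drawn, never by intermediate shapes. This
    works because a join in a union passes only keys of priority at least that of the current root
    of the second treap, and these come from the first one; for intersect and difference the results
    consist of keys of [third]. The factor 2 in the probability of a pair is the price of common
    keys, which have one priority and make the two events dependent. *)

Section SetRec.
Context {d : Order.disp_t} {K : orderType d} {B : Type}.
Variable join : tree B K -> K -> tree B K -> Defs.comp (tree B K).
Variables e1 e2 : tree B K -> tree B K.
Variable comb : bool -> tree B K -> K -> tree B K -> Defs.comp (tree B K).

(** The three algorithms share this recursion, so that each induction is done once. They differ in
    the result for an empty second tree ([e1]) or an empty first one ([e2]), and in the final step
    [comb]. *)
Fixpoint set_rec (T1 T2 : tree B K) : Defs.comp (tree B K) :=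
  tick (if is_leaf T1 then ret (e2 T2)
  else tick match T2 with
  | Leaf => ret (e1 T1)
  | Node L2 _ k2 R2 =>
    let* '(L1, b, R1) := tsplit join T1 k2 in
    let* '(Tl, Tr) := par (set_rec L1 L2) (set_rec R1 R2) in
    comb b Tl k2 Tr
  end).

Lemma set_rec_nodeE T1 L2 b2 k2 R2 : ~~ is_leaf T1 ->
  let s := tsplit join T1 k2 in
  let Ul := set_rec (cval s).1.1 L2 in
  let Ur := set_rec (cval s).2 R2 in
  let j := comb (cval s).1.2 (cval Ul) k2 (cval Ur) in
  [/\ cval (set_rec T1 (Node L2 b2 k2 R2)) = cval j,
      cwork (set_rec T1 (Node L2 b2 k2 R2)) =
        (cwork s + (cwork Ul + cwork Ur + 1 + cwork j)).+2 &
      cspan (set_rec T1 (Node L2 b2 k2 R2)) =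
        (cspan s + (maxn (cspan Ul) (cspan Ur) + 1 + cspan j)).+2].
Proof.
move=> /negbTE nl /=; rewrite nl.
by case: (tsplit join T1 k2) => [[[? ?] ?] ? ?].
Qed.

End SetRec.

Definition op_base1 (o : set_op) B K (T : tree B K) : tree B K :=
  if o is Intersect then Leaf else T.

Definition op_base2 (o : set_op) B K (T : tree B K) : tree B K :=
  if o is Union then T else Leaf.

Definition op_comb (o : set_op) (d : Order.disp_t) (K : orderType d) B
    (join : tree B K -> K -> tree B K -> Defs.comp (tree B K)) (b : bool) Tl k Tr :=
  match o with
  | Union => join Tl k Tr
  | Intersect => tick (if b then join Tl k Tr else tjoin2 join Tl Tr)
  | Difference => tjoin2 join Tl Tr
  end.

Lemma run_opE (o : set_op) (d : Order.disp_t) (K : orderType d) B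
    (join : tree B K -> K -> tree B K -> Defs.comp (tree B K)) T1 T2 :
  run_op o join T1 T2 =
  set_rec join (@op_base1 o B K) (@op_base2 o B K) (op_comb o join) T1 T2.
Proof. by case: o. Qed.

Lemma leafP B K (T : tree B K) : is_leaf T -> T = Leaf.
Proof. by case: T. Qed.

(** Turns the absolute rank difference paid by a join into a signed one, so that costs along a
    search path telescope. It applies because a piece returned by the recursion exceeds the sibling
    subtree in rank by at most [c]. *)
Lemma normr_le_telescope (R : realFieldType) (c x : R) :
  0 <= c -> x <= c -> `|x| <= 2 * c - x.
Proof. by move=> c0 xc; rewrite ler_norml; apply/andP; split; lra. Qed.

Section SeqSpan.
Context {d : Order.disp_t} {K : orderType d} {B : Type}.
Variable join : tree B K -> K -> tree B K -> Defs.comp (tree B K).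
Hypothesis jspan : forall l k r, (cspan (join l k r) <= cwork (join l k r))%N.

(** Split, splitLast and join2 contain no parallel composition, so their work also serves as a bound
    on their span. *)
Lemma tsplit_span T k : (cspan (tsplit join T k) <= cwork (tsplit join T k))%N.
Proof.
elim: T => [//|l IHl b m r IHr] /=.
case: ifP => //= _; case: ifP => _ /=.
- case: (tsplit join l k) IHl => [[[A x] Q] w s] /= IH.
  by move: (jspan Q m r) IH; clear; lia.
- case: (tsplit join r k) IHr => [[[A x] Q] w s] /= IH.
  by move: (jspan l m A) IH; clear; lia.
Qed.

Lemma split_last_span l k r :
  (cspan (split_last join l k r) <= cwork (split_last join l k r))%N.
Proof.
elim: r l k => [//|r1 _ br kr r2 IH] l k /=.
move: (IH r1 kr); case: (split_last join r1 kr r2) => [[U x] w s] /= sp.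
by move: (jspan l k U) sp; clear; lia.
Qed.

Lemma tjoin2_span Tl Tr : (cspan (tjoin2 join Tl Tr) <= cwork (tjoin2 join Tl Tr))%N.
Proof.
case: Tl => [//|l b k r] /=; move: (split_last_span l k r).
case: (split_last join l k r) => [[U u] w s] /= sp.
by move: (jspan U u Tr) sp; clear; lia.
Qed.

Lemma op_comb_span o b Tl k Tr :
  (cspan (op_comb o join b Tl k Tr) <= cwork (op_comb o join b Tl k Tr))%N.
Proof.
have := jspan Tl k Tr; have := tjoin2_span Tl Tr.
by case: o => //; rewrite /op_comb; case: b.
Qed.

End SeqSpan.

(* Ranks are normalised so that a child has rank at most one less than its
   parent; [c] bounds both the largest such gap and the cost of a join. *)
Record joinable (R : realType) (c : R) B K (rank : tree B K -> R)
    (bal : tree B K -> bool) (join : tree B K -> K -> tree B K -> Defs.comp (tree B K)) :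
    Prop := Joinable {
  jn_c : 1 <= c;
  jn_rank0 : rank Leaf = 0;
  jn_bal0 : bal Leaf;
  jn_bal : forall l b k r, bal (Node l b k r) -> bal l && bal r;
  jn_rankl : forall l b k r, bal (Node l b k r) ->
    rank (Node l b k r) - c <= rank l <= rank (Node l b k r) - 1;
  jn_rankr : forall l b k r, bal (Node l b k r) ->
    rank (Node l b k r) - c <= rank r <= rank (Node l b k r) - 1;
  jn_joinb : forall l k r, bal l -> bal r -> bal (cval (join l k r));
  jn_size : forall l k r, bal l -> bal r ->
    tree_size (cval (join l k r)) = (tree_size l + tree_size r).+1;
  jn_mono : forall l k r, bal l -> bal r ->
    rank l <= rank (cval (join l k r)) /\ rank r <= rank (cval (join l k r));
  jn_up : forall l b k r l' r' x, 0 <= x -> bal (Node l b k r) -> bal l' -> bal r' ->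
    rank l' <= rank l + x -> rank r' <= rank r + x ->
    rank (cval (join l' k r')) <= rank (Node l b k r) + x;
  jn_cost : forall l k r, bal l -> bal r ->
    (cwork (join l k r))%:R <= c * (1 + `|rank l - rank r|);
  jn_span : forall l k r, (cspan (join l k r) <= cwork (join l k r))%N
}.

Section Joinable.
Context {R : realType} {d : Order.disp_t} {K : orderType d} {B : Type}.
Variables (c : R) (rank : tree B K -> R) (bal : tree B K -> bool).
Variable join : tree B K -> K -> tree B K -> Defs.comp (tree B K).
Hypothesis J : joinable c rank bal join.
Implicit Types T : tree B K.

Let D : R := 3 + c + 2 * (c * c).

Let c_ge0 : 0 <= c. Proof. by have := jn_c J; lra. Qed.

Let D_ge0 : 0 <= D.
Proof. by have := mulr_ge0 c_ge0 c_ge0; have := c_ge0; rewrite /D; lra. Qed.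

Lemma rank_ge0 T : bal T -> 0 <= rank T.
Proof.
elim: T => [|l IHl b k r _] bT; first by rewrite (jn_rank0 J).
have /andP[bl _] := jn_bal J bT; have := IHl bl.
by have /andP[_ +] := jn_rankl J bT; lra.
Qed.

Let join_cost l k r x : bal l -> bal r -> x <= c -> `|rank l - rank r| = `|x| ->
  (cwork (join l k r))%:R <= c + 2 * (c * c) - c * x.
Proof.
move=> bl br xc e; have := jn_cost J k bl br; rewrite e.
by have := ler_wpM2l c_ge0 (normr_le_telescope c_ge0 xc); lra.
Qed.

(** The term [c * (rank L + rank Q)] is a potential. A join costs a constant plus [c] times the rank
    of the sibling minus that of the piece, and its result ranks at least as high as the sibling, so
    the potential absorbs the difference. What remains per level is [D]: three ticks and the
    constant [c + 2 * (c * c)] of the join. *)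
Lemma tsplit_spec T k : bal T ->
  let s := tsplit join T k in
  let L := (cval s).1.1 in
  let Q := (cval s).2 in
  [/\ bal L, bal Q, rank L <= rank T & rank Q <= rank T] /\
  ((cval s).1.2 + (tree_size L + tree_size Q) <= tree_size T)%N /\
  (cwork s)%:R <= D * rank T + c * (rank L + rank Q) + 2.
Proof.
have c1 := jn_c J.
elim: T => [|l IHl b m r IHr] bT /=.
  by rewrite (jn_rank0 J) (jn_bal0 J) /=; split; [split|split] => //; lra.
have /andP[bl br] := jn_bal J bT.
have /andP[l1 l2] := jn_rankl J bT; have /andP[r1 r2] := jn_rankr J bT.
have l0 := rank_ge0 bl; have r0 := rank_ge0 br.
case: ifP => _ /=.
  split; first by split => //; lra.
  split; first by rewrite add1n.
  have := mulr_ge0 D_ge0 (rank_ge0 bT); have := mulr_ge0 c_ge0 (addr_ge0 l0 r0).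
  lra.
case: ifP => _ /=.
- case: (tsplit join l k) (IHl bl) => [[[A x] Q] w s] /= [[bA bQ rA rQ] [sz wk]].
  split; first split => //.
  + exact: (jn_joinb J).
  + lra.
  (* With [x = 0]: replacing a child by a tree of no larger rank does not raise the rank of the
     result. *)
  + have := @jn_up _ _ _ _ _ _ _ J l b m r Q r 0 (lexx _) bT bQ br.
    by rewrite !addr0 => -> //.
  rewrite (jn_size J) //; split; first by move: sz; clear; lia.
  have [_ mr] := jn_mono J m bQ br.
  have := @join_cost Q m r (rank Q - rank r) bQ br ltac:(lra) erefl.
  have := ler_wpM2l c_ge0 mr; have := ler_wpM2l D_ge0 l2.
  rewrite -(addn3 (_ + _)) addn0 !natrD; move: wk; rewrite /D.
  lra.
- case: (tsplit join r k) (IHr br) => [[[A x] Q] w s] /= [[bA bQ rA rQ] [sz wk]].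
  split; first split => //.
  + exact: (jn_joinb J).
  + have := @jn_up _ _ _ _ _ _ _ J l b m r l A 0 (lexx _) bT bl bA.
    by rewrite !addr0 => -> //.
  + lra.
  rewrite (jn_size J) //; split; first by move: sz; clear; lia.
  have [mr _] := jn_mono J m bl bA.
  have := @join_cost l m A (rank A - rank l) bl bA ltac:(lra) (distrC _ _).
  have := ler_wpM2l c_ge0 mr; have := ler_wpM2l D_ge0 r2.
  rewrite -(addn3 (_ + _)) addn0 !natrD; move: wk; rewrite /D.
  lra.
Qed.

Lemma split_last_spec l b k r : bal (Node l b k r) ->
  let s := split_last join l k r in
  let T := Node l b k r in
  let U := (cval s).1 in
  [/\ bal U, rank U <= rank T, (tree_size U <= tree_size T)%N &
   (cwork s)%:R <= D * rank T + c * rank U + 1].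
Proof.
have c1 := jn_c J.
elim: r l b k => [|r1 _ br kr r2 IH] l b k bT.
  have /andP[bl _] := jn_bal J bT; have /andP[l1 l2] := jn_rankl J bT.
  have l0 := rank_ge0 bl; rewrite /=; split => //; [lra|exact: leqW (leq_addr _ _)|].
  have := mulr_ge0 D_ge0 (rank_ge0 bT); have := mulr_ge0 c_ge0 l0.
  lra.
have /andP[bl bR] := jn_bal J bT.
have /andP[l1 l2] := jn_rankl J bT; have /andP[rk1 rk2] := jn_rankr J bT.
have l0 := rank_ge0 bl; have r0 := rank_ge0 bR.
move: (IH _ _ _ bR); rewrite /=.
case: (split_last join r1 kr r2) => [[U x] w s] /= [bU rU szU wk].
split.
- exact: (jn_joinb J).
- have := @jn_up _ _ _ _ _ _ _ J l b k _ l U 0 (lexx _) bT bl bU.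
  by rewrite !addr0 => -> //.
- by rewrite (jn_size J) //=; move: szU; clear => /=; lia.
- have [mr _] := jn_mono J k bl bU.
  have := @join_cost l k U (rank U - rank l) bl bU ltac:(lra) (distrC _ _).
  have := ler_wpM2l c_ge0 mr; have := ler_wpM2l D_ge0 rk2.
  rewrite -(addn1 (_ + _)) addn0 !natrD; move: wk; rewrite /D.
  lra.
Qed.

Lemma join2_spec Tl Tr : bal Tl -> bal Tr ->
  let s := tjoin2 join Tl Tr in
  [/\ bal (cval s), (tree_size (cval s) <= tree_size Tl + tree_size Tr)%N &
   (cwork s)%:R <= (D + 2 * c) * (rank Tl + rank Tr + 1)].
Proof.
have c1 := jn_c J.
case: Tl => [|l b k r] bl br; have r0 := rank_ge0 br.
  split => //=; rewrite (jn_rank0 J).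
  have := mulr_ge0 D_ge0 r0; have := mulr_ge0 c_ge0 r0; have := mulr_ge0 c_ge0 c_ge0.
  rewrite /D; lra.
have l0 := rank_ge0 bl.
move: (split_last_spec bl); rewrite /=.
(* Strictness matters: the removed last key makes up for the key that the final join adds. *)
have szE : forall U u, (cval (split_last join l k r)) = (U, u) ->
    (tree_size U < (tree_size l + tree_size r).+1)%N.
  elim: r l b k bl {l0} => [|r1 _ b2 k2 r2 IH] l b k bl U u.
    by move=> /= [<- _]; rewrite addn0.
  have /andP[bl' bR'] := jn_bal J bl; move: (split_last_spec bR').
  rewrite /=; move: (IH _ _ _ bR').
  case: (split_last join r1 k2 r2) => [[U' u'] w s] /= /(_ _ _ erefl) lt [bU' _ _ _] [<- _].
  by rewrite (jn_size J) //; move: lt; clear; lia.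
case: (split_last join l k r) szE => [[U u] w s] /= /(_ _ _ erefl) lt [bU rU szU wk].
have u0 := rank_ge0 bU; split.
- exact: (jn_joinb J).
- by rewrite (jn_size J) //=; move: lt; clear; lia.
- have jc := jn_cost J u bU br.
  have : `|rank U - rank Tr| <= rank (Node l b k r) + rank Tr.
    by rewrite ler_norml; apply/andP; split; lra.
  move=> /(ler_wpM2l c_ge0); have := ler_wpM2l c_ge0 rU.
  have := mulr_ge0 D_ge0 r0; have := mulr_ge0 c_ge0 r0; have := mulr_ge0 c_ge0 c_ge0.
  have := mulr_ge0 c_ge0 l0.
  rewrite -(addn1 (_ + _)) !natrD; move: wk jc; rewrite /D.
  lra.
Qed.

End Joinable.

(** * Work and span for a joinable scheme *)

Section Ln.
Context {R : realType}.
Implicit Types x y l : R.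

Lemma ln_le x y : 0 < x -> x <= y -> ln x <= ln y.
Proof. by move=> x0 xy; rewrite ler_ln // posrE; lra. Qed.

Lemma ln_le_sub1 x : 0 < x -> ln x <= x - 1.
Proof.
move=> x0; have := @le_ln1Dx R (x - 1).
by rewrite [1 + _]addrC subrK; apply; lra.
Qed.

Lemma ln2_ge_half : 1 / 2 <= ln 2 :> R.
Proof.
have : ln (2^-1) <= 2^-1 - 1 :> R by apply: ln_le_sub1; rewrite invr_gt0.
by rewrite lnV ?posrE //; lra.
Qed.

Lemma ln2_le1 : ln 2 <= 1 :> R.
Proof. by have := @ln_le_sub1 2 (ltr0n _ 2); lra. Qed.

(** Concavity: this is the tangent at [l], without its negative term [- l / (1 + l)]. *)
Lemma ln1D_tangent l x : 0 <= l -> 0 <= x -> ln (1 + x) <= ln (1 + l) + x / (1 + l).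
Proof.
move=> l0 x0; have l1 : 0 < 1 + l by lra.
have := @ln_le_sub1 ((1 + x) / (1 + l)) ltac:(apply: divr_gt0; lra).
rewrite ln_div ?posrE //; last lra.
have -> : (1 + x) / (1 + l) - 1 = x / (1 + l) - l / (1 + l).
  by field; lra.
have : 0 <= l / (1 + l) by apply: divr_ge0; lra.
lra.
Qed.

(* The cost of a node is split into a part that depends only on its height [y]
   above a threshold and a part that decays exponentially in [y]. *)
Lemma ln1D_split l x y : 0 <= l -> 0 <= x -> 0 <= y ->
  ln (1 + x) <= 1 + y + ln (1 + l) + x * expR (- y) / (1 + l).
Proof.
move=> l0 x0 y0; have e0 := expR_gt0 y; have en0 := expR_gt0 (- y).
have xe0 : 0 <= x * expR (- y) by rewrite mulr_ge0 // ltW.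
have eE : expR y * (x * expR (- y)) = x by rewrite expRN; field; lra.
(* A product dominating [1 + x] separates the variables: the first factor depends on [y] only, and
   the tangent at [l] is applied to the second. *)
apply: (@le_trans _ _ (ln ((1 + expR y) * (1 + x * expR (- y))))).
  by apply: ln_le; lra.
rewrite lnM ?posrE; [|lra|lra].
have := ln1D_tangent l0 xe0.
suff : ln (1 + expR y) <= 1 + y by lra.
rewrite -[leRHS]expRK expRD; apply: ln_le; first lra.
have e1 := expR_ge1Dx (1 : R); have e2 := expR_ge1Dx y.
have := @ler_wpM2r _ (expR y) (ltW e0) _ _ e1.
lra.
Qed.

End Ln.

Lemma cwork_tick A (e : Defs.comp A) : cwork (tick e) = (cwork e).+1.
Proof. by []. Qed.

Lemma cval_tick A (e : Defs.comp A) : cval (tick e) = cval e.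
Proof. by []. Qed.

Section JoinableBounds.
Context {R : realType} {d : Order.disp_t} {K : orderType d} {B : Type}.
Variables (c : R) (rank : tree B K -> R) (bal : tree B K -> bool).
Variable join : tree B K -> K -> tree B K -> Defs.comp (tree B K).
Hypothesis J : joinable c rank bal join.
Implicit Types T : tree B K.

Local Notation lnw T := (ln (weight T)%:R).

Let D : R := 3 + c + 2 * (c * c).
(** Chosen with [expR (b * c) = 2]: a child loses at most [c] in rank, so it halves
    [expR (b * rank T)] at worst, and two children together restore it. Hence this exponential is a
    lower bound for the weight. *)
Let b : R := ln 2 / c.
(** One step of the recursion costs at most [G] times [1 + lnw T1]; the division by [b] converts
    ranks into logarithms of weights. *)
Let G : R := (4 * (D + 2 * c) + 10) / b.

Let c_gt0 : 0 < c. Proof. by have := jn_c J; lra. Qed.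

Let b_gt0 : 0 < b.
Proof. by rewrite divr_gt0 //; have := @ln2_ge_half R; lra. Qed.

Let b_le1 : b <= 1.
Proof.
have := @ln2_le1 R; have := jn_c J.
by rewrite ler_pdivrMr // mul1r; lra.
Qed.

Let bc : b * c = ln 2. Proof. by rewrite /b; field; rewrite gt_eqF. Qed.

Let D_gt0 : 0 < D.
Proof. by have := mulr_gt0 c_gt0 c_gt0; have := c_gt0; rewrite /D; lra. Qed.

Lemma weight_ge1 T : 1 <= (weight T)%:R :> R.
Proof. by rewrite ler1n. Qed.

Lemma weightE T : (weight T)%:R = 1 + (tree_size T)%:R :> R.
Proof. by rewrite -natr1 addrC. Qed.

Lemma lnw_ge0 T : 0 <= lnw T :> R.
Proof. exact/ln_ge0/weight_ge1. Qed.

Lemma lnw_le T1 T2 : (tree_size T1 <= tree_size T2)%N -> lnw T1 <= lnw T2 :> R.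
Proof. by move=> h; apply: ln_le; rewrite ?ltr0n // ler_nat. Qed.

Lemma expR_rank_le T : bal T -> expR (b * rank T) <= (weight T)%:R.
Proof.
elim: T => [|l IHl x k r IHr] bT.
  by rewrite (jn_rank0 J) mulr0 expR0.
have /andP[/IHl wl /IHr wr] := jn_bal J bT.
have half : expR (b * (rank (Node l x k r) - c)) = expR (b * rank (Node l x k r)) / 2.
  by rewrite mulrBr bc expRB lnK // posrE.
have /andP[rl _] := jn_rankl J bT; have /andP[rr _] := jn_rankr J bT.
have el : expR (b * (rank (Node l x k r) - c)) <= expR (b * rank l).
  by rewrite ler_expR ler_wpM2l // ltW.
have er : expR (b * (rank (Node l x k r) - c)) <= expR (b * rank r).
  by rewrite ler_expR ler_wpM2l // ltW.
have -> : (weight (Node l x k r))%:R = (weight l)%:R + (weight r)%:R :> R.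
  by rewrite -natrD /weight /= addSn addnS.
move: el er; rewrite half; lra.
Qed.

Lemma rank_le_lnw T : bal T -> rank T <= lnw T / b.
Proof.
move=> bT; rewrite ler_pdivlMr // mulrC.
by rewrite -[leLHS]expRK; apply: ln_le (expR_gt0 _) (expR_rank_le bT).
Qed.

(** Bounds how often [n] keys can be halved until none is left. The value [0] at [0] lets the last
    halving, from one key to none, count as well. *)
Let lam (n : nat) : R := if n is 0%N then 0 else 1 + ln n%:R / ln 2.

Let lam_ge0 n : 0 <= lam n.
Proof.
case: n => [//|n] /=; apply: addr_ge0 => //; rewrite divr_ge0 ?ln_ge0 ?ler1n //.
Qed.

Let lam_half n n' : (0 < n)%N -> (n'.*2 <= n)%N -> lam n' + 1 <= lam n.
Proof.
case: n => [//|n] _; have l2 : 0 < ln 2 :> R by have := @ln2_ge_half R; lra.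
case: n' => [_|n' h].
  by rewrite add0r /= lerDl divr_ge0 ?ln_ge0 ?ler1n // ltW.
suff : ln n'.+1%:R / ln 2 + ln 2 / ln 2 <= ln n.+1%:R / ln 2 :> R.
  by rewrite divff ?gt_eqF // /lam; lra.
rewrite -mulrDl ler_pM2r ?invr_gt0 // -lnM ?posrE ?ltr0n //.
by apply: ln_le; rewrite -natrM ?ltr0n // ler_nat muln2.
Qed.

(* A union can lower the rank: rejoining the two black children of a black node
   yields a red root.  The side with fewer keys of [T1] halves their number. *)
Lemma union_rank_ge T1 T2 : bal T1 -> bal T2 ->
  let U := cval (run_op Union join T1 T2) in
  bal U /\ rank T2 - c * lam (tree_size T1) <= rank U.
Proof.
rewrite run_opE; elim: T2 T1 => [|L2 IHL b2 k2 R2 IHR] T1 b1 bT2.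
  rewrite /= (jn_rank0 J); case: ifP => [/leafP->|_] /=.
    by rewrite (jn_rank0 J) (jn_bal0 J); split=> //; lra.
  split=> //; have := rank_ge0 J b1.
  by have := mulr_ge0 (ltW c_gt0) (lam_ge0 (tree_size T1)); lra.
have [l1|nl1] := boolP (is_leaf T1).
  by rewrite /= l1 /=; split=> //; have := mulr_ge0 (ltW c_gt0) (lam_ge0 (tree_size T1)); lra.
rewrite /=; have [-> _ _] := set_rec_nodeE join (@op_base1 Union B K) (@op_base2 Union B K)
  (op_comb Union join) L2 b2 k2 R2 nl1.
have /andP[bL2 bR2] := jn_bal J bT2.
have [[bL1 bR1 _ _] [sz _]] := tsplit_spec J k2 b1.
move: (tsplit join T1 k2) bL1 bR1 sz => s bL1 bR1 sz.
have [bl rl] := IHL _ bL1 bL2; have [br rr] := IHR _ bR1 bR2.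
rewrite /=; split; first exact: (jn_joinb J).
have /andP[l1 _] := jn_rankl J bT2; have /andP[r1 _] := jn_rankr J bT2.
have [ml mr] := jn_mono J k2 bl br.
have n1 : (0 < tree_size T1)%N by case: (T1) nl1.
have [h|h] := leqP (tree_size (cval s).1.1) (tree_size (cval s).2).
- have := @lam_half _ (tree_size (cval s).1.1) n1 ltac:(move: h sz; clear; lia).
  move=> /(ler_wpM2l (ltW c_gt0)); rewrite /= in ml *; lra.
- have := @lam_half _ (tree_size (cval s).2) n1 ltac:(move: h sz; clear; lia).
  move=> /(ler_wpM2l (ltW c_gt0)); rewrite /= in mr *; lra.
Qed.

(** The increment [X] stays fixed although the fragments shrink, because [jn_up] carries one common
    increment of both children. It is used up where the second tree is empty and a fragment itself
    is returned. *)
Lemma union_rank_le T1 T2 X : bal T1 -> bal T2 -> lnw T1 / b <= X ->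
  rank (cval (run_op Union join T1 T2)) <= rank T2 + X.
Proof.
rewrite run_opE; elim: T2 T1 => [|L2 IHL b2 k2 R2 IHR] T1 b1 bT2 hX;
    have X0 : 0 <= X by apply: le_trans hX; rewrite divr_ge0 ?lnw_ge0 // ltW.
  rewrite /= (jn_rank0 J); case: ifP => _ /=.
    by rewrite (jn_rank0 J); lra.
  by have := rank_le_lnw b1; lra.
have [l1|nl1] := boolP (is_leaf T1).
  by rewrite /= l1 /=; lra.
rewrite /=; have [-> _ _] := set_rec_nodeE join (@op_base1 Union B K) (@op_base2 Union B K)
  (op_comb Union join) L2 b2 k2 R2 nl1.
have /andP[bL2 bR2] := jn_bal J bT2.
have [[bL1 bR1 _ _] [sz _]] := tsplit_spec J k2 b1.
move: (tsplit join T1 k2) bL1 bR1 sz => s bL1 bR1 sz.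
have [bl _] := union_rank_ge bL1 bL2; have [br _] := union_rank_ge bR1 bR2.
rewrite !run_opE in bl br.
apply: (jn_up J X0 bT2) => //.
- apply: IHL => //; apply: le_trans hX; rewrite ler_pM2r ?invr_gt0 //.
  by apply: lnw_le; move: sz; clear; lia.
- apply: IHR => //; apply: le_trans hX; rewrite ler_pM2r ?invr_gt0 //.
  by apply: lnw_le; move: sz; clear; lia.
Qed.

Let lam_le T : c * lam (tree_size T) <= c + lnw T / b.
Proof.
have l2 : 0 < ln 2 :> R by have := @ln2_ge_half R; lra.
have -> : c + lnw T / b = c * (1 + lnw T / ln 2).
  by rewrite /b; field; rewrite !gt_eqF.
rewrite ler_pM2l //.
case sE: (tree_size T) => [|n] /=.
  by rewrite addr_ge0 // divr_ge0 ?lnw_ge0 // ltW.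
rewrite lerD2l ler_pM2r ?invr_gt0 //.
by apply: ln_le; rewrite ?ltr0n // ler_nat /weight sE.
Qed.

(** The size bound makes the rank of the result logarithmic in the fragment, by [rank_le_lnw]. This
    replaces the two-sided comparison with [T2] that a union needs. *)
Lemma intersect_difference_spec o T1 T2 : o <> Union -> bal T1 -> bal T2 ->
  let U := cval (run_op o join T1 T2) in
  bal U && (tree_size U <= tree_size T1)%N.
Proof.
rewrite run_opE => oU; elim: T2 T1 => [|L2 IHL b2 k2 R2 IHR] T1 b1 bT2.
  rewrite /=; case: ifP => [/leafP->|_] /=; case: o oU => //=;
    by rewrite ?(jn_bal0 J) ?b1 /=.
have [/leafP->|nl1] := boolP (is_leaf T1).
  by case: o oU {IHL IHR} => //= _; rewrite (jn_bal0 J).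
rewrite /=; have [-> _ _] := set_rec_nodeE join (@op_base1 o B K) (@op_base2 o B K)
  (op_comb o join) L2 b2 k2 R2 nl1.
have /andP[bL2 bR2] := jn_bal J bT2.
have [[bL1 bR1 _ _] [sz _]] := tsplit_spec J k2 b1.
move: (tsplit join T1 k2) bL1 bR1 sz => s bL1 bR1 sz.
have /andP[bl sl] := IHL _ bL1 bL2; have /andP[br sr] := IHR _ bR1 bR2.
move: (cval (set_rec _ _ _ _ _ L2)) bl sl => Ul bl sl.
move: (cval (set_rec _ _ _ _ _ R2)) br sr => Ur br sr.
case: o oU {IHL IHR} => // _; rewrite /op_comb.
- rewrite (@cval_tick _ (if _ then _ else _)); case: ifP sz => _ sz.
    by rewrite (jn_joinb J) //= (jn_size J) //; move: sz sl sr; clear; lia.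
  have [-> sj _] := join2_spec J bl br.
  by move: sz sl sr sj; clear; lia.
- have [-> sj _] := join2_spec J bl br.
  by move: sz sl sr sj; clear; lia.
Qed.

Lemma run_op_bal o T1 T2 : bal T1 -> bal T2 -> bal (cval (run_op o join T1 T2)).
Proof.
move=> b1 b2; case: o; last 2 first.
- by have /andP[] := @intersect_difference_spec Intersect T1 T2 ltac:(by []) b1 b2.
- by have /andP[] := @intersect_difference_spec Difference T1 T2 ltac:(by []) b1 b2.
- by have [] := union_rank_ge b1 b2.
Qed.

(** The summand [7] consists of the three steps of the node itself and of the constant [2] in the
    bounds for each of the two recursive calls. *)
Lemma local_cost o T1 L2 b2 k2 R2 : bal T1 -> bal (Node L2 b2 k2 R2) ->
  let s := tsplit join T1 k2 in
  let j := op_comb o join (cval s).1.2 (cval (run_op o join (cval s).1.1 L2)) k2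
             (cval (run_op o join (cval s).2 R2)) in
  (cwork s + cwork j + 7)%:R <= G * (1 + lnw T1) /\ (cspan s + cspan j <= cwork s + cwork j)%N.
Proof.
move=> b1 bT2 /=.
have /andP[bL2 bR2] := jn_bal J bT2.
have [[bL1 bR1 rL1 rR1] [sz wk]] := tsplit_spec J k2 b1.
have sp := tsplit_span (jn_span J) T1 k2.
move: (tsplit join T1 k2) bL1 bR1 rL1 rR1 sz wk sp => s bL1 bR1 rL1 rR1 sz wk sp.
have r1 := rank_ge0 J b1; have rl1 := rank_le_lnw b1.
have szL : (tree_size (cval s).1.1 <= tree_size T1)%N by move: sz; clear; lia.
have szR : (tree_size (cval s).2 <= tree_size T1)%N by move: sz; clear; lia.
set X := lnw T1 / b in rl1 *.
have X0 : 0 <= X by lra.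
have bl := run_op_bal o bL1 bL2; have br := run_op_bal o bR1 bR2.
set Ul := cval (run_op o _ _ L2) in bl *; set Ur := cval (run_op o _ _ R2) in br *.
have GE : (4 * (D + 2 * c) + 10) * (1 + X) <= G * (1 + lnw T1).
  have -> : G * (1 + lnw T1) = (4 * (D + 2 * c) + 10) * (1 / b + X).
    by rewrite /G /X; field; rewrite gt_eqF.
  rewrite ler_pM2l; last by have := c_gt0; have := D_gt0; lra.
  by rewrite lerD2r ler_pdivlMr // mul1r b_le1.
have smallr U T0 : bal U -> (tree_size U <= tree_size T0)%N ->
    (tree_size T0 <= tree_size T1)%N -> rank U <= X.
  move=> bU szU szT; apply: le_trans (rank_le_lnw bU) _.
  by rewrite ler_pM2r ?invr_gt0 //; apply/lnw_le/leq_trans/szT.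
have cc := mulr_gt0 c_gt0 c_gt0; have c1 := jn_c J; have D0 := D_gt0.
have DX := mulr_ge0 (ltW D0) X0; have cX := mulr_ge0 (ltW c_gt0) X0.
have DrX := ler_wpM2l (ltW D0) rl1.
have crL := ler_wpM2l (ltW c_gt0) (le_trans rL1 rl1).
have crR := ler_wpM2l (ltW c_gt0) (le_trans rR1 rl1).
have jw : (cwork (op_comb o join (cval s).1.2 Ul k2 Ur))%:R <=
    c * (1 + 2 * c + 2 * X) + 1 + (D + 2 * c) * (2 * X + 1).
  have [oU|oU] := pselect (o = Union).
    move: bl br; rewrite /Ul /Ur oU /= => bl br.
    have lwl : lnw (cval s).1.1 / b <= X by rewrite ler_pM2r ?invr_gt0 //; apply/lnw_le.
    have lwr : lnw (cval s).2 / b <= X by rewrite ler_pM2r ?invr_gt0 //; apply/lnw_le.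
    have [_ uL1] := union_rank_ge bL1 bL2; have uL2 := union_rank_le bL1 bL2 lwl.
    have [_ uR1] := union_rank_ge bR1 bR2; have uR2 := union_rank_le bR1 bR2 lwr.
    have lamL := lam_le (cval s).1.1; have lamR := lam_le (cval s).2.
    have /andP[l1 l2] := jn_rankl J bT2; have /andP[q1 q2] := jn_rankr J bT2.
    apply: le_trans (jn_cost J _ bl br) _.
    (* The ranks of [L2] and [R2] differ by at most [c]; a union shifts them up by at most [X] and
       down by at most [c + X]. *)
    have h : `|rank (cval (run_op Union join (cval s).1.1 L2)) -
        rank (cval (run_op Union join (cval s).2 R2))| <= 2 * c + 2 * X.
      rewrite /= in uL1 uL2 uR1 uR2 *.
      by rewrite ler_norml; apply/andP; split; clear - uL1 uL2 uR1 uR2 lamL lamR lwl lwr l1 l2 q1 q2 c1 X0 b_gt0 D_gt0; lra.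
    by have := ler_wpM2l (ltW c_gt0) h; clear - cX DX D0 c1 b_gt0 D_gt0; lra.
  have /andP[_ szl] := intersect_difference_spec oU bL1 bL2.
  have /andP[_ szr] := intersect_difference_spec oU bR1 bR2.
  have rl := smallr _ _ bl szl szL; have rr := smallr _ _ br szr szR.
  have rl0 := rank_ge0 J bl; have rr0 := rank_ge0 J br.
  have jc : (cwork (join Ul k2 Ur))%:R <= c * (1 + X).
    apply: le_trans (jn_cost J _ bl br) _.
    by rewrite ler_pM2l // lerD2l ler_norml; apply/andP; split; clear - rl rr rl0 rr0 b_gt0 D_gt0; lra.
  have j2 : (cwork (tjoin2 join Ul Ur))%:R <= (D + 2 * c) * (2 * X + 1).
    have [_ _ h] := join2_spec J bl br; apply: le_trans h _.
    by rewrite ler_pM2l ?addr_gt0 ?mulr_gt0 ?D_gt0 ?c_gt0 //; lra.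
  move: Ul Ur jc j2 {bl br szl szr rl rr rl0 rr0} => Ul Ur jc j2.
  clear - oU jc j2 cc cX DX D0 c1 X0 b_gt0 D_gt0.
  case: o oU => // _; rewrite /op_comb; last lra.
  by rewrite (@cwork_tick _ (if _ then _ else _)) -natr1; case: ifP => _; lra.
split; last first.
  exact: leq_add sp (op_comb_span (jn_span J) o _ _ _ _).
apply: le_trans GE; rewrite !natrD; rewrite /D in D0 DX DrX jw *.
lra.
Qed.

(** * Charging the work above and below a rank threshold *)

Section Threshold.
Variables (o : set_op) (l t : R).
Hypotheses (l_ge0 : 0 <= l) (t_ge0 : 0 <= t).

(** The sum of [expR (- (b * j))] over the integers [j >= 1]. *)
Let Y : R := (expR b - 1)^-1.
Let E : R := 1 + 2 * c.

(* [path_cost r] bounds the total cost charged to one key of the first tree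
   along a path of the second one that starts at rank [r]: a constant for every
   node of rank at most [t], a geometrically decaying amount above. *)
Let path_cost (r : R) : R :=
  if r <= t then 2 * G * r
  else 2 * G * t + G / (1 + l) * (Y + 1 - Y * expR (- (b * (r - t)))).

(** The last factor is made for [node_cost_node]: the weights of the children add up to that of the
    node, their ranks are lower by at most [c], and [E = 1 + 2 * c] is the value for which the
    subtracted terms of two children leave room for the charge [1 + (rank T - t)]. The exponential
    scales weights by the weight that rank [t] guarantees. *)
Let node_cost (T : tree B K) : R :=
  if rank T <= t then 0
  else G * (2 + ln (1 + l)) *
       (2 * E * ((weight T)%:R * expR (- (b * t))) - (rank T - t) - E).

Let G_gt0 : 0 < G.
Proof. by rewrite /G divr_gt0 //; have := c_gt0; have := D_gt0; lra. Qed.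

Let eb_gt1 : 0 < expR b - 1.
Proof. by have := expR_ge1Dx b; have := b_gt0; lra. Qed.

Let Y_gt0 : 0 < Y. Proof. by rewrite invr_gt0. Qed.

Let Gl_gt0 : 0 < G / (1 + l).
Proof. by rewrite divr_gt0 //; have := l_ge0; lra. Qed.

Let Ll_ge0 : 0 <= ln (1 + l).
Proof. by apply: ln_ge0; have := l_ge0; lra. Qed.

Lemma path_cost_low r r' : r <= t -> r' <= r - 1 -> path_cost r' + 2 * G <= path_cost r.
Proof.
move=> rt r'r; rewrite /path_cost rt ifT; last by lra.
by have := ler_wpM2l (ltW G_gt0) r'r; lra.
Qed.

(** Between ranks above the threshold this is a step of the geometric series of sum [Y]. When [r']
    is at or below the threshold, the additional [1] in [Y + 1] pays for the node. *)
Lemma path_cost_high r r' : t < r -> r' <= r - 1 ->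
  path_cost r' + G / (1 + l) * expR (- (b * (r - t))) <= path_cost r.
Proof.
move=> rt r'r; rewrite /path_cost [in leRHS]ifF; last by apply/negbTE; rewrite -ltNge.
set e := expR (- (b * (r - t))).
have e1 : e <= 1.
  by rewrite expR_le1 oppr_le0 mulr_ge0 ?(ltW b_gt0) //; lra.
case: ifPn => [r't|].
  have := ler_wpM2l (ltW G_gt0) r't.
  have : 0 <= G / (1 + l) * ((Y + 1) * (1 - e)).
    by rewrite mulr_ge0 ?(ltW Gl_gt0) // mulr_ge0 //; have := Y_gt0; lra.
  lra.
rewrite -ltNge => tr'; rewrite -addrA lerD2l -mulrDr ler_pM2l //.
have eE : e * expR b = expR (- (b * (r - 1 - t))).
  by rewrite -expRD; congr expR; ring.
have : e * expR b <= expR (- (b * (r' - t))).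
  by rewrite eE ler_expR lerN2 ler_wpM2l ?(ltW b_gt0) //; lra.
move=> /(ler_wpM2l (ltW Y_gt0)).
have : Y * (expR b - 1) = 1 by rewrite mulVf // gt_eqF.
move=> /(congr1 (fun x => e * x)); rewrite mulr1.
lra.
Qed.

Lemma path_cost_ge0 r : 0 <= r -> 0 <= path_cost r.
Proof.
move=> r0; rewrite /path_cost; case: ifPn => [_|].
  by rewrite mulr_ge0 // mulr_ge0 ?(ltW G_gt0).
rewrite -ltNge => tr; apply: addr_ge0; first by rewrite mulr_ge0 // mulr_ge0 ?(ltW G_gt0).
rewrite mulr_ge0 ?(ltW Gl_gt0) //.
have e1 : expR (- (b * (r - t))) <= 1.
  by rewrite expR_le1 oppr_le0 mulr_ge0 ?(ltW b_gt0) //; lra.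
by have := ler_wpM2l (ltW Y_gt0) e1; lra.
Qed.

Lemma path_cost_le r : path_cost r <= 2 * G * t + G / (1 + l) * (Y + 1).
Proof.
have h : 0 <= G / (1 + l) * (Y + 1).
  by rewrite mulr_ge0 ?(ltW Gl_gt0) //; have := Y_gt0; lra.
rewrite /path_cost; case: ifPn => [rt|_].
  by have := ler_wpM2l (ltW G_gt0) rt; lra.
rewrite lerD2l ler_pM2l // gerBl mulr_ge0 ?expR_ge0 //.
exact: ltW.
Qed.

(** A child of a node above the threshold has rank at least [t - c], hence at least half the weight
    that rank [t] guarantees. So the last factor of [node_cost] is nonnegative even where the child
    falls to the threshold or below and is charged [0]. *)
Let node_bound T : bal T -> t - c <= rank T ->
  E <= 2 * E * ((weight T)%:R * expR (- (b * t))).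
Proof.
move=> bT tr; have E0 : 0 < E by have := c_gt0; rewrite /E; lra.
suff : 1 / 2 <= (weight T)%:R * expR (- (b * t)).
  by move=> /(ler_wpM2l (ltW E0)); lra.
have -> : 1 / 2 = expR (b * (t - c)) * expR (- (b * t)) :> R.
  rewrite -expRD (_ : _ + _ = - (b * c)); last by ring.
  by rewrite bc expRN lnK ?posrE // mul1r.
rewrite ler_wpM2r ?expR_ge0 //; apply: le_trans (expR_rank_le bT).
by rewrite ler_expR ler_wpM2l // ltW.
Qed.

Lemma node_cost_le T : bal T -> t - c <= rank T ->
  node_cost T <= G * (2 + ln (1 + l)) *
    (2 * E * ((weight T)%:R * expR (- (b * t))) - (rank T - t) - E).
Proof.
move=> bT tr; rewrite /node_cost; case: ifP => // rt.
rewrite mulr_ge0 //; last by have := node_bound bT tr; lra.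
by rewrite mulr_ge0 ?(ltW G_gt0) //; have := Ll_ge0; lra.
Qed.

Lemma node_cost_ge0 T : bal T -> 0 <= node_cost T.
Proof.
move=> bT; rewrite /node_cost; case: ifPn => //; rewrite -ltNge => tr.
rewrite mulr_ge0 //; first by rewrite mulr_ge0 ?(ltW G_gt0) //; have := Ll_ge0; lra.
have E0 : 1 <= E by have := c_gt0; rewrite /E; lra.
have ebt : 1 + b * (rank T - t) <= (weight T)%:R * expR (- (b * t)).
  apply: le_trans (expR_ge1Dx _) _.
  rewrite mulrBr expRD ler_wpM2r ?expR_ge0 //.
  exact: expR_rank_le.
(* By [b * c = ln 2], [2 * E * b] equals [2 * b + 4 * ln 2]; the growth of the weight thus outweighs
   the subtracted [rank T - t]. *)
have bE : 1 <= 2 * E * b.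
  have := @ln2_ge_half R; rewrite -bc /E; have := b_gt0.
  lra.
have := ler_wpM2l (ltW (lt_le_trans ltr01 E0)) ebt.
have : 0 <= rank T - t by lra.
by move=> /(ler_wpM2r) /(_ _ _ bE); lra.
Qed.

Lemma node_cost_total T : bal T ->
  node_cost T <= G * (2 + ln (1 + l)) * (2 * E * ((weight T)%:R * expR (- (b * t)))).
Proof.
move=> bT; have E0 : 0 <= E by have := c_gt0; rewrite /E; lra.
have G2 : 0 <= G * (2 + ln (1 + l)).
  by rewrite mulr_ge0 ?(ltW G_gt0) //; have := Ll_ge0; lra.
rewrite /node_cost; case: ifPn => [_|].
  apply: mulr_ge0 => //; apply: mulr_ge0; first lra.
  by rewrite mulr_ge0 ?expR_ge0.
rewrite -ltNge => tr; apply: ler_wpM2l => //; lra.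
Qed.

Lemma node_cost_node L x k Q : bal (Node L x k Q) -> t < rank (Node L x k Q) ->
  node_cost L + node_cost Q + G * (2 + ln (1 + l)) * (1 + (rank (Node L x k Q) - t))
  <= node_cost (Node L x k Q).
Proof.
move=> bT tr; have /andP[bL bQ] := jn_bal J bT.
have /andP[l1 l2] := jn_rankl J bT; have /andP[r1 r2] := jn_rankr J bT.
have nL := node_cost_le bL ltac:(lra); have nQ := node_cost_le bQ ltac:(lra).
rewrite [leRHS]/node_cost ifF; last by apply/negbTE; rewrite -ltNge.
have G2 : 0 <= G * (2 + ln (1 + l)).
  by rewrite mulr_ge0 ?(ltW G_gt0) //; have := Ll_ge0; lra.
apply: le_trans (lerD (lerD nL nQ) (lexx _)) _.
rewrite -!mulrDr; apply: ler_wpM2l => //.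
have -> : (weight (Node L x k Q))%:R = (weight L)%:R + (weight Q)%:R :> R.
  by rewrite -natrD /weight /= addSn addnS.
rewrite /E; lra.
Qed.

Lemma set_op_work T1 T2 : bal T1 -> bal T2 ->
  (cwork (run_op o join T1 T2))%:R <=
    2 + (tree_size T1)%:R * path_cost (rank T2) + node_cost T2.
Proof.
elim: T2 T1 => [|L2 IHL b2 k2 R2 IHR] T1 b1 bT2;
    have pos : 0 <= (tree_size T1)%:R * path_cost (rank _) + node_cost _ :=
      addr_ge0 (mulr_ge0 (ler0n R _) (path_cost_ge0 (rank_ge0 J bT2))) (node_cost_ge0 bT2).
  have : (cwork (run_op o join T1 Leaf) <= 2)%N.
    by rewrite run_opE /=; case: ifP.
  by rewrite -(ler_nat R); lra.
have [l1|nl1] := boolP (is_leaf T1).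
  have : (cwork (run_op o join T1 (Node L2 b2 k2 R2)) <= 2)%N.
    by rewrite run_opE /= l1.
  by rewrite -(ler_nat R); lra.
have [_ wkE _] := set_rec_nodeE join (@op_base1 o B K) (@op_base2 o B K)
  (op_comb o join) L2 b2 k2 R2 nl1.
have /andP[bL2 bR2] := jn_bal J bT2.
have [[bL1 bR1 _ _] [sz _]] := tsplit_spec J k2 b1.
have [loc _] := local_cost o b1 bT2.
move: wkE loc; rewrite -!run_opE => ->.
move: (tsplit join T1 k2) bL1 bR1 sz => s bL1 bR1 sz.
move: (op_comb _ _ _ _ _ _) => j loc.
have WL := IHL _ bL1 bL2; have WR := IHR _ bR1 bR2.
have -> : ((cwork s + (cwork (run_op o join (cval s).1.1 L2) +
      cwork (run_op o join (cval s).2 R2) + 1 + cwork j)).+2)%:R =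
    (cwork s + cwork j + 7)%:R + ((cwork (run_op o join (cval s).1.1 L2))%:R - 2) +
    ((cwork (run_op o join (cval s).2 R2))%:R - 2) :> R.
  by rewrite -(addn2 (_ + _)) !natrD; ring.
have /andP[l1 l2] := jn_rankl J bT2; have /andP[r1 r2] := jn_rankr J bT2.
set T2 := Node _ _ _ _ in bT2 pos loc l1 l2 r1 r2 *.
have n1 : 1 <= (tree_size T1)%:R :> R by rewrite ler1n; case: (T1) nl1.
have szR : (tree_size (cval s).1.1)%:R + (tree_size (cval s).2)%:R <= (tree_size T1)%:R :> R.
  by rewrite -natrD ler_nat; move: sz; clear; lia.
have pL0 := path_cost_ge0 (rank_ge0 J bL2).
(* The fragments of [T1] are disjoint, so a charge [q] per key at this node, added to the path costs
   of the children, is again a path cost per key of [T1]. *)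
have comb p q : path_cost (rank L2) + q <= p -> path_cost (rank R2) + q <= p ->
  (tree_size (cval s).1.1)%:R * path_cost (rank L2) +
  (tree_size (cval s).2)%:R * path_cost (rank R2) + (tree_size T1)%:R * q <=
  (tree_size T1)%:R * p.
  move=> pL pR.
  have hL : path_cost (rank L2) <= p - q by rewrite lerBrDr.
  have hR : path_cost (rank R2) <= p - q by rewrite lerBrDr.
  have := ler_wpM2l (ler0n R (tree_size (cval s).1.1)) hL.
  have := ler_wpM2l (ler0n R (tree_size (cval s).2)) hR.
  have := ler_wpM2r (le_trans pL0 hL) szR.
  by lra.
have [rt|tr] := leP (rank T2) t.
- have cL := path_cost_low rt l2; have cR := path_cost_low rt r2.
  have := comb _ _ cL cR.
  have nL : node_cost L2 = 0 by rewrite /node_cost ifT // (le_trans l2) // lerBlDr ler_wpDr.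
  have nR : node_cost R2 = 0 by rewrite /node_cost ifT // (le_trans r2) // lerBlDr ler_wpDr.
  have := node_cost_ge0 bT2.
  (* For a fragment of size [s >= 1] the local cost [G * (1 + ln (1 + s))] is at most
     [2 * G * s]. *)
  have : lnw T1 <= (tree_size T1)%:R :> R.
    have := @ln_le_sub1 R (weight T1)%:R ltac:(by rewrite ltr0n).
    by rewrite weightE; lra.
  move=> /(ler_wpM2l (ltW G_gt0)).
  have := ler_wpM2l (ltW G_gt0) n1.
  lra.
- have cL := path_cost_high tr l2; have cR := path_cost_high tr r2.
  have := comb _ _ cL cR.
  have := node_cost_node bT2 tr.
  have y0 : 0 <= b * (rank T2 - t) by rewrite mulr_ge0 ?(ltW b_gt0) // subr_ge0 ltW.
  have := ln1D_split l_ge0 (ler0n R (tree_size T1)) y0; rewrite -weightE.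
  move=> /(ler_wpM2l (ltW G_gt0)).
  have by1 : b * (rank T2 - t) <= rank T2 - t by rewrite ger_pMl // subr_gt0.
  have : G * (2 + ln (1 + l) + b * (rank T2 - t)) <= G * (2 + ln (1 + l)) * (1 + (rank T2 - t)).
    rewrite -mulrA ler_pM2l //.
    have : 0 <= (1 + ln (1 + l)) * (rank T2 - t).
      by rewrite mulr_ge0 ?subr_ge0 ?(ltW tr) //; have := Ll_ge0; lra.
    by lra.
  lra.
Qed.

Lemma set_op_work_le T1 T2 : bal T1 -> bal T2 ->
  (cwork (run_op o join T1 T2))%:R <=
    2 + (tree_size T1)%:R * (2 * G * t + G / (1 + l) * (Y + 1)) +
    G * (2 + ln (1 + l)) * (2 * E * ((weight T2)%:R * expR (- (b * t)))).
Proof.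
move=> b1 b2; apply: le_trans (set_op_work b1 b2) _.
apply: lerD (node_cost_total b2); rewrite lerD2l.
by apply: ler_wpM2l (path_cost_le _); rewrite ler0n.
Qed.

End Threshold.

Lemma set_op_span o T1 T2 : bal T1 -> bal T2 ->
  (cspan (run_op o join T1 T2))%:R <= 2 + rank T2 * (G * (1 + lnw T1)).
Proof.
elim: T2 T1 => [|L2 IHL b2 k2 R2 IHR] T1 b1 bT2;
    have G0 : 0 <= G by rewrite divr_ge0 ?(ltW b_gt0) //; have := c_gt0; have := D_gt0; lra.
  have : (cspan (run_op o join T1 Leaf) <= 2)%N.
    by rewrite run_opE /=; case: ifP.
  by rewrite -(ler_nat R) (jn_rank0 J); lra.
have gl T : 0 <= G * (1 + lnw T) by rewrite mulr_ge0 //; have := lnw_ge0 T; lra.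
have r0 := rank_ge0 J bT2.
have [l1|nl1] := boolP (is_leaf T1).
  have : (cspan (run_op o join T1 (Node L2 b2 k2 R2)) <= 2)%N.
    by rewrite run_opE /= l1.
  by rewrite -(ler_nat R); have := mulr_ge0 r0 (gl T1); lra.
have [_ _ spE] := set_rec_nodeE join (@op_base1 o B K) (@op_base2 o B K)
  (op_comb o join) L2 b2 k2 R2 nl1.
have /andP[bL2 bR2] := jn_bal J bT2.
have [[bL1 bR1 _ _] [sz _]] := tsplit_spec J k2 b1.
have [loc sp] := local_cost o b1 bT2.
move: spE loc sp; rewrite -!run_opE => ->.
move: (tsplit join T1 k2) bL1 bR1 sz => s bL1 bR1 sz.
move: (op_comb _ _ _ _ _ _) => j loc sp.
have step T U r : bal T -> bal U -> (tree_size T <= tree_size T1)%N ->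
    0 <= rank U <= r -> (cspan (run_op o join T U))%:R <= 2 + rank U * (G * (1 + lnw T)) ->
    (cspan (run_op o join T U))%:R <= 2 + r * (G * (1 + lnw T1)).
  move=> bT bU szT /andP[u0 ur] /le_trans; apply; rewrite lerD2l.
  apply: (ler_pM u0 (gl T) ur).
  by apply: ler_wpM2l => //; rewrite lerD2l; apply: lnw_le.
have /andP[l1 l2] := jn_rankl J bT2; have /andP[r1 r2] := jn_rankr J bT2.
have SL := step _ _ (rank (Node L2 b2 k2 R2) - 1) bL1 bL2 ltac:(move: sz; clear; lia)
  ltac:(rewrite (rank_ge0 J) //) (IHL _ bL1 bL2).
have SR := step _ _ (rank (Node L2 b2 k2 R2) - 1) bR1 bR2 ltac:(move: sz; clear; lia)
  ltac:(rewrite (rank_ge0 J) //) (IHR _ bR1 bR2).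
move: (cspan (run_op _ _ _ L2)) (cspan (run_op _ _ _ R2)) SL SR => a a' SL SR.
have mx : (maxn a a')%:R <= 2 + (rank (Node L2 b2 k2 R2) - 1) * (G * (1 + lnw T1)).
  by case: (leqP a a').
have : (cspan s + (maxn a a' + 1 + cspan j)).+2%:R <=
    (cwork s + cwork j + 7)%:R + (maxn a a')%:R :> R.
  by rewrite -natrD ler_nat; move: sp; clear; lia.
lra.
Qed.

End JoinableBounds.

(** The work bound is thus at least [m / 2] and absorbs constant and linear terms. *)
Lemma ln_ratio_ge (R : realType) (m n : nat) : (0 < m <= n)%N ->
  1 / 2 <= ln (n%:R / m%:R + 1) :> R.
Proof.
move=> /andP[m0 mn]; apply: le_trans (@ln2_ge_half R) _; apply: ln_le => //.
suff : 1 <= n%:R / m%:R :> R by lra.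
by rewrite ler_pdivlMr ?ltr0n // mul1r ler_nat.
Qed.

(** With two keys or more, the logarithm absorbs both the shift from size to weight and additive
    constants; for a single key the span bound would vanish. *)
Lemma ln1Dn_le (R : realType) (n : nat) : (1 < n)%N ->
  ln (1 + n%:R) <= 2 * ln n%:R :> R /\ 1 / 2 <= ln n%:R :> R.
Proof.
move=> n1; have n2 : 2 <= n%:R :> R by rewrite ler_nat.
split; last by apply: le_trans (@ln2_ge_half R) (ln_le _ n2).
have -> : 2 * ln n%:R = ln (n%:R * n%:R) :> R by rewrite lnM ?posrE; lra.
apply: ln_le; first lra.
have := @ler_wpM2r _ (n%:R : R) ltac:(lra) _ _ n2; lra.
Qed.

Theorem joinable_set_ops (R : realType) (c : R) : 1 <= c ->
  exists C : R, forall (o : set_op) (d : Order.disp_t) (K : orderType d) (B : Type)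
    (rank : tree B K -> R) (bal : tree B K -> bool) join (T1 T2 : tree B K) (m n : nat),
    joinable c rank bal join -> bal T1 -> bal T2 ->
    sizes m n (tree_size T1) (tree_size T2) ->
    let r := run_op o join T1 T2 in
    ((0 < m)%N -> (cwork r)%:R <= C * work_bound R m n) /\
    ((1 < m)%N -> (cspan r)%:R <= C * span_bound R m n).
Proof.
move=> c1.
pose b := ln 2 / c; pose G := (4 * (3 + c + 2 * (c * c) + 2 * c) + 10) / b.
pose Y := (expR b - 1)^-1; pose E := 1 + 2 * c.
have b0 : 0 < b by rewrite divr_gt0 //; have := @ln2_ge_half R; lra.
have G0 : 0 < G.
  by rewrite divr_gt0 //; have := @mulr_ge0 _ c c ltac:(lra) ltac:(lra); lra.
have Y0 : 0 < Y by rewrite invr_gt0; have := expR_ge1Dx b; lra.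
have E0 : 0 < E by rewrite /E; lra.
have GY : 0 < G * (Y + 1) by rewrite mulr_gt0 //; lra.
have GE : 0 < G * E by rewrite mulr_gt0.
have Gb : 0 < G / b by rewrite divr_gt0.
(* The constant [2] in both costs needs [8], since the product of logarithms is only known to be at
   least [1 / 4]. The summand with [G / b] comes from the span, and [20 = 16 + 4] from
   [(2 + L) * 2 * (1 + m)] when the first tree is the larger one. *)
exists (8 + 8 * (G / b) + 2 * (G * (Y + 1)) + 20 * (G * E)).
move=> o d K B rank bal join T1 T2 m n J b1 b2 [mn szs] /=; split=> [m0|m1].
- rewrite /work_bound; set L := ln _.
  have L2 : 1 / 2 <= L by apply: ln_ratio_ge; rewrite m0.
  have mR : 1 <= m%:R :> R by rewrite ler1n.
  have mnR : m%:R <= n%:R :> R by rewrite ler_nat.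
  have L0 : 0 <= L by clear - L2; lra.
  have m0' : 0 < m%:R :> R by rewrite ltr0n.
  have n0 : 0 < n%:R :> R by exact: lt_le_trans mnR.
  have mL0 : 0 <= m%:R * L by rewrite mulr_ge0.
  have mL : 1 / 2 <= m%:R * L by have := ler_wpM2r L0 mR; clear - L2; lra.
  have mL2 : m%:R <= 2 * (m%:R * L) by have := ler_wpM2l (ltW m0') L2; clear; lra.
  have nm0 : 0 < n%:R / m%:R :> R by rewrite divr_gt0.
  case: szs => -[s1 s2].
  (* The second tree is the larger one. The threshold is the rank that guarantees weight [n / m]:
     the charges above it are of order [m], and below it each of the [m] keys pays in proportion to
     [t]. *)
  + have t0 : 0 <= ln (n%:R / m%:R) / b.
      rewrite divr_ge0 ?(ltW b0) // ln_ge0 // ler_pdivlMr ?mul1r //; lra.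
    have := set_op_work_le J o (lexx 0) t0 b1 b2.
    rewrite -/b -/G -/Y -/E addr0 ln1 addr0 divr1 weightE s1 s2.
    have -> : expR (- (b * (ln (n%:R / m%:R) / b))) = m%:R / n%:R.
      rewrite mulrCA divff ?gt_eqF // mulr1 expRN lnK ?posrE // invf_div.
      by [].
    have -> : 2 * G * (ln (n%:R / m%:R) / b) = 2 * (G / b) * ln (n%:R / m%:R) by field; rewrite gt_eqF.
    have tL : ln (n%:R / m%:R) <= L by apply: ln_le => //; rewrite lerDl.
    have wm : (1 + n%:R) * (m%:R / n%:R) <= 2 * m%:R :> R.
      rewrite mulrA ler_pdivrMr //.
      have := ler_wpM2l (ltW m0') (le_trans mR mnR); clear; lra.
    have h1 := ler_wpM2l (ltW Gb) (ler_wpM2l (le_trans ler01 mR) tL).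
    have h2 := ler_wpM2l (ltW GE) wm.
    have h3 := ler_wpM2l (ltW GY) mL2.
    have h4 := ler_wpM2l (ltW GE) mL2.
    have h5 : 0 <= (G / b) * (m%:R * L) by rewrite mulr_ge0 ?(ltW Gb).
    have h6 : 0 <= (G * E) * (m%:R * L) by rewrite mulr_ge0 ?(ltW GE).
    lra.
  (* The first tree is the larger one. With the threshold at [0] and [l = n / m], the ratio of the
     sizes, [n / (1 + l)] is at most [m]. *)
  + have l0 : 0 <= n%:R / m%:R :> R by exact: ltW.
    have := set_op_work_le J o l0 (lexx 0) b1 b2.
    rewrite -/b -/G -/Y -/E !mulr0 oppr0 expR0 mulr1 add0r weightE s1 s2.
    rewrite [1 + n%:R / m%:R]addrC -/L.
    have nm : n%:R * (G / (n%:R / m%:R + 1) * (Y + 1)) <= m%:R * (G * (Y + 1)).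
      have -> : n%:R * (G / (n%:R / m%:R + 1) * (Y + 1)) =
          (n%:R / (n%:R / m%:R + 1)) * (G * (Y + 1)) by field; clear - m0' n0; lra.
      rewrite ler_pM2r // ler_pdivrMr; last lra.
      have -> : m%:R * (n%:R / m%:R + 1) = n%:R + m%:R :> R by field; lra.
      lra.
    have h3 := ler_wpM2l (ltW GY) mL2.
    have h4 := ler_wpM2l (ltW GE) mL2.
    have h5 : 0 <= (G / b) * (m%:R * L) by rewrite mulr_ge0 ?(ltW Gb).
    have h6 : 0 <= (G * E) * (m%:R * L) by rewrite mulr_ge0 ?(ltW GE).
    have h7 : (G * E) * (1 + m%:R) <= (G * E) * (2 * m%:R) by rewrite ler_pM2l //; lra.
    have h8 : (G * E) * L * (1 + m%:R) <= (G * E) * L * (2 * m%:R).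
      apply: ler_wpM2l; last lra.
      by apply: mulr_ge0; [exact: ltW|lra].
    lra.
- rewrite /span_bound.
  have [n2 m2] : (1 < tree_size T1)%N /\ (1 < tree_size T2)%N.
    by case: szs => -[-> ->]; split=> //; apply: leq_trans mn.
  have -> : ln n%:R * ln m%:R = ln (tree_size T1)%:R * ln (tree_size T2)%:R :> R.
    by case: szs => -[-> ->] //; rewrite mulrC.
  have := set_op_span J o b1 b2; rewrite -/b -/G.
  have := rank_le_lnw J b2; rewrite -/b.
  rewrite !weightE.
  have [u1 u2] := ln1Dn_le R n2; have [v1 v2] := ln1Dn_le R m2.
  set u := ln (tree_size T1)%:R in u1 u2 *; set v := ln (tree_size T2)%:R in v1 v2 *.
  set u' := ln (1 + (tree_size T1)%:R) in u1 *.
  set v' := ln (1 + (tree_size T2)%:R) in v1 *.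
  move=> rk sp; apply: le_trans sp _.
  have uv : 1 / 4 <= u * v.
    have h0 : (0 : R) <= 1 / 2 by lra.
    by have := ler_pM h0 h0 u2 v2; lra.
  have h1 : G * (1 + u') <= G * (4 * u) by rewrite ler_pM2l //; lra.
  have h2 : rank T2 * (G * (1 + u')) <= (2 * v / b) * (G * (4 * u)).
    have u0 : 0 <= u' by apply: ln_ge0; rewrite lerDl ler0n.
    have g0 : 0 <= G * (1 + u') by rewrite mulr_ge0 ?(ltW G0) //; lra.
    apply: (ler_pM (rank_ge0 J b2) g0 _ h1).
    by apply: le_trans rk _; rewrite ler_pM2r ?invr_gt0.
  apply: le_trans (lerD (lexx _) h2) _.
  have -> : 2 * v / b * (G * (4 * u)) = 8 * (G / b) * (u * v) by field; rewrite gt_eqF.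
  have := mulr_ge0 (ltW GY) (le_trans (ltac:(lra) : (0 : R) <= 1 / 4) uv).
  have := mulr_ge0 (ltW GE) (le_trans (ltac:(lra) : (0 : R) <= 1 / 4) uv).
  lra.
Qed.

(** * AVL trees *)

Section Mirror.
Context {B K : Type}.
Implicit Types T : tree B K.

Lemma size_mirror T : tree_size (mirror T) = tree_size T.
Proof. by elim: T => [//|l IHl b k r IHr] /=; rewrite IHl IHr addnC. Qed.

Lemma height_mirror T : height (mirror T) = height T.
Proof. by elim: T => [//|l IHl b k r IHr] /=; rewrite IHl IHr maxnC. Qed.

End Mirror.

Section AVLJoin.
Context {K : Type}.
Implicit Types (T Tl Tr : tree unit K) (k : K).

Lemma avl_mirror T : avl_balanced (mirror T) = avl_balanced T.
Proof.
elim: T => [//|l IHl b k r IHr] /=; rewrite IHl IHr !height_mirror.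
by rewrite andbCA; congr (_ && (_ && _)); rewrite andbC.
Qed.

(* When the height grows, the right subtree of the result is the higher one, so
   that a single left rotation at the parent restores the balance. *)
Lemma avl_join_right_spec Tl k Tr : avl_balanced Tl -> avl_balanced Tr ->
  ((height Tr).+1 < height Tl)%N ->
  let e := avl_join_right Tl k Tr in
  let T := cval e in
  [/\ avl_balanced T, (height Tl <= height T <= (height Tl).+1)%N,
      if T is Node l _ _ r then height T = (height Tl).+1 -> height r = (height l).+1 else True,
      tree_size T = (tree_size Tl + tree_size Tr).+1 &
      (cwork e <= 6 * (height Tl - height Tr))%N].
Proof.
elim: Tl => [//|l _ [] k' c IH] /= /and4P[h1 h2 bl bc] bTr hT.
have [hc|hc] := leqP (height c) (height Tr).+1.
  rewrite /=; have [h3|h3] := leqP _ (height l).+1; rewrite /=.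
    by rewrite bl bc bTr /= ?andbT; split; lia.
  case: c {IH} h1 h2 bc hc hT h3 => [|c1 [] kc c2] /=; first lia.
  move=> h1 h2 /and4P[h3 h4 bc1 bc2] hc hT h5; rewrite bl bc1 bc2 bTr /= ?andbT.
  by split; lia.
case: (avl_join_right c k Tr) (IH bc bTr hc) => [T' w s] /= [bT' hT' gr sz cost].
case: ifP => h3 /=.
  by rewrite bl bT' /= ?andbT; split; lia.
case: T' bT' hT' gr sz h3 => [|B [] y C] /=; first lia.
move=> /and4P[h3 h4 bB bC] hT' gr sz h5; rewrite bl bB bC /= ?andbT.
have := gr ltac:(lia) => hC.
by split; lia.
Qed.

Lemma avl_join_spec Tl k Tr : avl_balanced Tl -> avl_balanced Tr ->
  let e := avl_join Tl k Tr in
  let T := cval e in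
  [/\ avl_balanced T,
      (maxn (height Tl) (height Tr) <= height T <= (maxn (height Tl) (height Tr)).+1)%N,
      tree_size T = (tree_size Tl + tree_size Tr).+1 &
      (cwork e <= 6 + 6 * ((height Tl - height Tr) + (height Tr - height Tl)))%N].
Proof.
move=> bl br; rewrite /avl_join /=.
have [h1|h1] := ltnP (height Tr).+1 (height Tl).
  have [bT hT _ sz c2] := avl_join_right_spec k bl br h1.
  by rewrite /= bT sz; split => //; lia.
have [h2|h2] := ltnP (height Tl).+1 (height Tr).
  have h2' : ((height (mirror Tl)).+1 < height (mirror Tr))%N by rewrite !height_mirror.
  have := avl_join_right_spec k _ _ h2'; rewrite !avl_mirror !height_mirror !size_mirror.
  move=> /(_ br bl) [bT hT _ sz c2].
  by rewrite /mirrored /= bT sz; split => //; lia.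
by rewrite /= bl br; split=> //; lia.
Qed.

Lemma avl_join_right_span Tl k Tr :
  (cspan (avl_join_right Tl k Tr) <= cwork (avl_join_right Tl k Tr))%N.
Proof.
elim: Tl => [//|l _ b k' c IH] /=; case: ifP => _ /=; first by case: ifP.
by case: ifP => _ /=; lia.
Qed.

Lemma avl_join_span Tl k Tr : (cspan (avl_join Tl k Tr) <= cwork (avl_join Tl k Tr))%N.
Proof.
rewrite /avl_join /=; case: ifP => _ /=; first exact: avl_join_right_span.
by case: ifP => _ //=; exact: avl_join_right_span.
Qed.

End AVLJoin.

Lemma avl_joinable (R : realType) (K : Type) :
  @joinable R 12 unit K (fun T => (height T)%:R) avl_balanced avl_join.
Proof.
split; cbn beta; rewrite ?ler1n //.
- by move=> l b k r /= /and4P[_ _ -> ->].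
- move=> l b k r /= /and4P[h1 h2 _ _].
  by rewrite lerBlDr lerBrDr natr1 -natrD !ler_nat; lia.
- move=> l b k r /= /and4P[h1 h2 _ _].
  by rewrite lerBlDr lerBrDr natr1 -natrD !ler_nat; lia.
- by move=> l k r bl br; have [] := avl_join_spec k bl br.
- by move=> l k r bl br; have [] := avl_join_spec k bl br.
- by move=> l k r bl br; have [_ + _ _] := avl_join_spec k bl br; rewrite !ler_nat; lia.
- move=> l b k r l' r' x x0; rewrite [avl_balanced _]/= [height (Node _ _ _ _)]/= => /and4P[h1 h2 _ _] bl br hl hr.
  have [_ /andP[_ h] _ _] := avl_join_spec k bl br.
  have : (height (cval (avl_join l' k r')))%:R <= (maxn (height l') (height r')).+1%:R :> R.
    by rewrite ler_nat.
  move=> /le_trans; apply; rewrite -!natr1.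
  suff : (maxn (height l') (height r'))%:R <= (maxn (height l) (height r))%:R + x by lra.
  have m1 : (height l)%:R <= (maxn (height l) (height r))%:R :> R by rewrite ler_nat leq_maxl.
  have m2 : (height r)%:R <= (maxn (height l) (height r))%:R :> R by rewrite ler_nat leq_maxr.
  by case: (leqP (height l') (height r')) => _; lra.
- move=> l k r bl br; have [_ _ _ h] := avl_join_spec k bl br.
  have : (cwork (avl_join l k r))%:R <=
      (6 + 6 * ((height l - height r) + (height r - height l)))%:R :> R by rewrite ler_nat.
  move=> /le_trans; apply; rewrite natrD natrM.
  case: (leqP (height l) (height r)) => hlr.
    rewrite (eqP hlr) add0n (natrB _ hlr).
    by rewrite distrC ger0_norm ?subr_ge0 ?ler_nat //; have := ler_nat R (height l) (height r); rewrite hlr; lra.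
  rewrite (eqP (ltnW hlr)) addn0 (natrB _ (ltnW hlr)).
  by rewrite ger0_norm ?subr_ge0 ?ler_nat ?(ltnW hlr) //; have := ler_nat R (height r) (height l); rewrite (ltnW hlr); lra.
- exact: avl_join_span.
Qed.

(** * Red-black trees *)

Section RBJoin.
Context {K : Type}.
Implicit Types (T Tl Tr l r : tree color K) (k : K).

(** The recursive form of the condition on [black_counts]; it lets [bh] be read off either child. *)
Fixpoint bh_ok T : bool :=
  if T is Node l _ _ r then [&& bh l == bh r, bh_ok l & bh_ok r] else true.

Definition rb_ok T : bool := no_red_red T && bh_ok T.

Definition rb_rank T : nat := ((bh T).*2 - (if red_root T then 1 else 2))%N.

Lemma bh_gt0 T : (0 < bh T)%N.
Proof. by elim: T => [//|l IHl [] k r _] /=. Qed.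

Lemma bh_in_black_counts T : bh T \in black_counts T.
Proof.
elim: T => [|l IHl c k r _]; first exact: mem_head.
rewrite [black_counts _]/= [bh _]/=; apply: (map_f (fun n => is_black c + n)%N).
by rewrite mem_cat IHl.
Qed.

Lemma black_counts_bh_ok T n : all (pred1 n) (black_counts T) -> bh_ok T /\ bh T = n.
Proof.
elim: T n => [|l IHl c k r IHr] n; first by move=> /= /andP[/eqP].
move=> h; have /eqP bhn := allP h _ (bh_in_black_counts (Node l c k r)).
split=> //; move: h bhn; rewrite [black_counts _]/= [bh _]/= all_map all_cat => /andP[hl hr] bhn.
have sub T : all (preim (fun m => is_black c + m)%N (pred1 n)) (black_counts T) ->
    all (pred1 (bh l)) (black_counts T).
  by apply: sub_all => m /= /eqP; rewrite -bhn => /addnI ->.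
have [okl _] := IHl _ (sub _ hl); have [okr br] := IHr _ (sub _ hr).
by rewrite /= okl okr br eqxx.
Qed.

Lemma rb_balanced_ok T : rb_balanced T -> rb_ok T.
Proof.
case/andP => nrr; rewrite /rb_ok nrr /=.
case sE: (black_counts T) (bh_in_black_counts T) => [//|n s] _ /= h.
by have [] := @black_counts_bh_ok T n; rewrite // sE /= eqxx.
Qed.

Lemma red_root_mirror T : red_root (mirror T) = red_root T.
Proof. by case: T. Qed.

Lemma bh_mirror T : bh_ok T -> bh (mirror T) = bh T.
Proof.
by elim: T => [//|l IHl c k r IHr] /= /and3P[/eqP e okl okr]; rewrite IHr // e.
Qed.

Lemma bh_ok_mirror T : bh_ok T -> bh_ok (mirror T).
Proof.
elim: T => [//|l IHl c k r IHr] /= /and3P[/eqP e okl okr].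
by rewrite !bh_mirror // e eqxx IHl // IHr.
Qed.

Lemma no_red_red_mirror T : no_red_red T -> no_red_red (mirror T).
Proof.
elim: T => [//|l IHl c k r IHr] /= /and3P[e okl okr].
by rewrite !red_root_mirror [X in ~~ X]orbC e IHl // IHr.
Qed.

Lemma rb_ok_mirror T : rb_ok T -> rb_ok (mirror T).
Proof. by case/andP => h1 h2; rewrite /rb_ok no_red_red_mirror // bh_ok_mirror. Qed.

Lemma rb_rank_mirror T : rb_ok T -> rb_rank (mirror T) = rb_rank T.
Proof. by case/andP => _ h; rewrite /rb_rank red_root_mirror bh_mirror. Qed.

(* The red violations that the result of [rb_join_right] may contain; a black
   node repairs them with one recoloring and one rotation. *)
Definition rb_join_right_shape Tl k Tr T : Prop :=
  if bh Tl == bh Tr then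
    (if Tl is Node l Red k' r then T = Node l Red k' (Node r Red k Tr)
     else T = Node Tl Red k Tr)
  else if Tl is Node l Red k' _ then exists2 T', T = Node l Red k' T' & no_red_red T'
  else no_red_red T.

(** Each level costs at most [7] steps and lowers the rank by at least one. The [+ 2] keeps the
    difference positive at the place of insertion, where [Tr] may have a red root and hence the
    higher rank. *)
Lemma rb_join_right_spec Tl k Tr : rb_ok Tl -> rb_ok Tr -> (bh Tr <= bh Tl)%N ->
  let e := rb_join_right Tl k Tr in
  let T := cval e in
  [/\ bh T = bh Tl, bh_ok T, tree_size T = (tree_size Tl + tree_size Tr).+1,
      rb_join_right_shape Tl k Tr T &
      (cwork e <= 7 * (rb_rank Tl + 2 - rb_rank Tr))%N].
Proof.
have gt0 := bh_gt0.
elim: Tl => [|l _ c k' r IH] okl okr hbh.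
  have b1 : bh Tr = 1%N by move: hbh (gt0 Tr) => /=; lia.
  case/andP: (okr) => nr br.
  by rewrite /rb_join_right_shape /= b1 /= br /rb_rank /= b1; split=> //; case: ifP => _; lia.
case/andP: (okl) => /= /and3P[nc nl nr] /and3P[/eqP elr bl br].
have okR : rb_ok r by rewrite /rb_ok nr br.
have okL : rb_ok l by rewrite /rb_ok nl bl.
case/andP: (okr) => nTr bTr.
case: c nc okl hbh => /= nc okl hbh.
  rewrite elr in hbh.
  have [nrl nrr] : red_root l = false /\ red_root r = false.
    by move: nc; case: (red_root l); case: (red_root r).
  case: (rb_join_right r k Tr) (IH okR okr hbh) => [T' w s] /= [bT okT sz sh cost].
  have shE : rb_join_right_shape (Node l Red k' r) k Tr (Node l Red k' T').
    move: sh; rewrite /rb_join_right_shape /= add0n elr; case: ifP => _.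
      by case: (r) nrr => [|? [] ? ?] //= _ ->.
    by case: (r) nrr => [|? [] ? ?] //= _ nT; exists T'.
  rewrite elr bT eqxx okT bl sz; split=> //; first by clear; lia.
  by move: cost hbh; rewrite /rb_rank /= nrr elr; move: (gt0 r); clear; case: ifP => _; lia.
have [bb|bb] := eqVneq (1 + bh l)%N (bh Tr).
  rewrite /= /rb_join_right_shape /= bb eqxx elr eqxx bl br bTr /= ; split=> //.
  by rewrite /rb_rank /= bb; case: ifP => _; move: (gt0 Tr); clear; lia.
have {}hbh : (bh Tr <= bh r)%N by move: hbh bb; rewrite elr; clear; lia.
rewrite /rb_join_right_shape /= (negbTE bb).
case: (rb_join_right r k Tr) (IH okR okr hbh) => [T' w s] /= [bT okT sz sh cost].
have costE : (w < 7 * (rb_rank (Node l Black k' r) + 2 - rb_rank Tr) - 6)%N.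
  by move: cost hbh; rewrite /rb_rank /= elr; move: (gt0 r); clear; do 2 case: ifP => _; lia.
have good : ~~ (red_root T' && red_root (right_child T')) -> no_red_red T'.
  move: sh; rewrite /rb_join_right_shape; case: ifP => _.
    by case: (r) nr => [|lr [] kr rr] /= nr -> //= nrT; rewrite nrT nTr ?nr.
  case: (r) nr => [|lr [] kr rr] //= /and3P[nrr nlr _] [T0 -> nT0] /= /negbTE r0.
  by rewrite nlr nT0 r0 orbF /= andbT; move: nrr; case: (red_root lr).
(* Three reds in a row occur if [Tr] has a red root too, so nothing is claimed about the roots of
   [l2], [l3] and [r3]; after the repair all three hang below black nodes. *)
have bad : red_root T' && red_root (right_child T') ->
    exists l2 k2 l3 k3 r3, T' = Node l2 Red k2 (Node l3 Red k3 r3) /\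
      [&& no_red_red l2, no_red_red l3 & no_red_red r3].
  move: sh; rewrite /rb_join_right_shape; case: ifP => _.
    case: (r) nr => [|lr [] kr rr] nr -> /= rT.
    - by case: (Tr) rT nTr => [|l3 [] k3 r3] //= _ /and3P[_ n3 n4]; exists Leaf, k, l3, k3, r3; rewrite n3 n4.
    - by move: nr => /= /and3P[_ n1 n2]; exists lr, kr, rr, k, Tr; rewrite n1 n2 nTr.
    - case: (Tr) rT nTr => [|l3 [] k3 r3] //= _ /and3P[_ n3 n4].
      by exists (Node lr Black kr rr), k, l3, k3, r3; rewrite n3 n4 nr.
  case: (r) nr => [|lr [] kr rr] nr.
  - by case: (T') => [|l0 [] k0 r0] //= /and3P[+ _ _] r00; rewrite r00 orbT.
  - case=> T0 -> /=; case: T0 => [|l3 [] k3 r3] //= /and3P[_ n3 n4] _.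
    by move: nr => /= /and3P[_ n1 _]; exists lr, kr, l3, k3, r3; rewrite n1 n3 n4.
  - by case: (T') => [|l0 [] k0 r0] //= /and3P[+ _ _] r00; rewrite r00 orbT.
case: ifPn => [/bad[l2 [k2 [l3 [k3 [r3 [T'E /and3P[n2 n3 n4]]]]]]]|/good nT'] /=.
  subst T'; move: bT okT sz => /= bT /and5P[/eqP b23 ok2 /eqP b33 ok3 ok4] sz.
  rewrite nl n2 n3 n4 bl ok2 ok3 ok4; split=> //.
  - by apply/and5P; split=> //; apply/eqP; move: elr bT b23 b33; clear; lia.
  - by move: sz; clear; lia.
  - by move: costE; clear; lia.
rewrite bl nl nT' okT bT elr eqxx; split=> //.
- by move: sz; clear; lia.
- by move: costE; clear; lia.
Qed.

(** As [bh Tr < bh Tl], a black node above the place of insertion has repaired the violation there.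
    Only a red root with a red right child can remain; blackening the root raises the rank by
    one. *)
Lemma rb_join_high_spec Tl k Tr : rb_ok Tl -> rb_ok Tr -> (bh Tr < bh Tl)%N ->
  let e := rb_join_high Tl k Tr in
  let T := cval e in
  [/\ rb_ok T, tree_size T = (tree_size Tl + tree_size Tr).+1,
      (rb_rank Tl <= rb_rank T <= (rb_rank Tl).+1)%N &
      (cwork e <= 7 * (rb_rank Tl + 2 - rb_rank Tr) + 2)%N].
Proof.
move=> okl okr hbh.
have := rb_join_right_spec k okl okr (ltnW hbh); rewrite /rb_join_high /=.
case: (rb_join_right Tl k Tr) => [T w s] /= [bT okT sz sh cost].
move: sh; rewrite /rb_join_right_shape gtn_eqF //.
have b0 := bh_gt0 Tl.
case: Tl okl hbh bT sz cost b0 => [|l [] k' r] okl hbh bT sz cost b0.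
- by move: hbh (bh_gt0 Tr) => /=; clear; lia.
- case=> T' TE nT'; subst T; move: okl => /andP[/= /and3P[nc nl nr] okT0].
  have nrl : red_root l = false by move: nc; case: (red_root l).
  move: okT => /= /and3P[/eqP eT okl' okT'].
  case: ifPn => [|/negbTE] /= rT; rewrite /rb_ok /= nl nT' eT okl' okT' ?nrl ?rT eqxx /=;
    by split=> //; move: cost bT b0; rewrite /rb_rank /= eT; clear; lia.
- move=> nT; rewrite ifF.
    rewrite /rb_ok /= nT okT; split=> //; last by move: cost; clear; lia.
    by move: bT b0; rewrite /rb_rank /=; clear; case: ifP => _; lia.
  case: (T) nT => [|l0 [] k0 r0] //= /and3P[+ _ _].
  by case: (red_root r0); rewrite ?orbT.
Qed.

Lemma rb_join_spec Tl k Tr : rb_ok Tl -> rb_ok Tr ->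
  let e := rb_join Tl k Tr in
  let T := cval e in
  [/\ rb_ok T, tree_size T = (tree_size Tl + tree_size Tr).+1,
      (maxn (rb_rank Tl) (rb_rank Tr) <= rb_rank T <=
        (maxn (rb_rank Tl) (rb_rank Tr)).+1)%N &
      (cwork e <= 20 + 7 * ((rb_rank Tl - rb_rank Tr) + (rb_rank Tr - rb_rank Tl)))%N].
Proof.
move=> okl okr; rewrite /rb_join /=.
have rankE T1 T2 : (bh T1 < bh T2)%N -> (rb_rank T1 <= rb_rank T2)%N.
  by rewrite /rb_rank; do 2 case: ifP => _; lia.
have [e|ne] := eqVneq (bh Tl) (bh Tr).
  case/andP: (okl) => nl bl; case/andP: (okr) => nr br.
  rewrite /rb_ok /= nl nr bl br e eqxx /= !andbT.
  case rE: (red_root Tl || red_root Tr); rewrite /rb_rank /= e; split=> //; move: (bh_gt0 Tr) rE;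
    by case: (red_root Tl); case: (red_root Tr) => //; clear; lia.
have [h|h] := ltnP (bh Tr) (bh Tl).
  have [okT sz hr cost] := rb_join_high_spec k okl okr h.
  have rk := rankE _ _ h.
  move: (rb_join_high Tl k Tr) okT sz hr cost => [T w s] /= okT sz hr cost.
  by rewrite okT sz; split=> //; move: hr cost rk; clear; lia.
have {}h : (bh Tl < bh Tr)%N by rewrite ltn_neqAle ne.
have h' : (bh (mirror Tl) < bh (mirror Tr))%N.
  by case/andP: okl => _ bl; case/andP: okr => _ br; rewrite !bh_mirror.
have rk := rankE _ _ h.
have [okT sz hr cost] := rb_join_high_spec k (rb_ok_mirror okr) (rb_ok_mirror okl) h'.
rewrite /mirrored.
move: (rb_join_high _ k _) okT sz hr cost => [T w s] /= okT sz hr cost.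
rewrite rb_ok_mirror // rb_rank_mirror // size_mirror sz !size_mirror.
rewrite !rb_rank_mirror // in hr cost.
by split=> //; move: hr cost rk; clear; lia.
Qed.

Lemma rb_join_right_span Tl k Tr :
  (cspan (rb_join_right Tl k Tr) <= cwork (rb_join_right Tl k Tr))%N.
Proof.
elim: Tl => [|l _ c k' r IH] /=; first by case: ifP.
case: ifP => //= _; move: IH; case: (rb_join_right r k Tr) => [T' w s] /= IH.
by case: ifP => _ /=; rewrite ?addn0 ltnS; move: IH; clear; lia.
Qed.

Lemma rb_join_span Tl k Tr : (cspan (rb_join Tl k Tr) <= cwork (rb_join Tl k Tr))%N.
Proof.
have high Tl' Tr' : (cspan (rb_join_high Tl' k Tr') <= cwork (rb_join_high Tl' k Tr'))%N.
  have := rb_join_right_span Tl' k Tr'; rewrite /rb_join_high /=.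
  by case: (rb_join_right Tl' k Tr') => [T w s] /= h; case: ifP => _ /=; move: h; clear; lia.
by rewrite /rb_join /=; case: ifP => //= _; case: ifP => _ /=; rewrite !ltnS high.
Qed.

End RBJoin.

(** This yields [jn_up] for a rank in [nat]: a join adds at most one to the larger rank, and a node
    exceeds both children by at least one. *)
Lemma nat_rank_up (R : realType) (a b a' b' m r : nat) (x : R) :
  (m <= (maxn a' b').+1)%N -> ((maxn a b).+1 <= r)%N ->
  a'%:R <= a%:R + x -> b'%:R <= b%:R + x -> m%:R <= r%:R + x.
Proof.
move=> hm hr ha hb.
have : m%:R <= (maxn a' b').+1%:R :> R by rewrite ler_nat.
have : (maxn a b).+1%:R <= r%:R :> R by rewrite ler_nat.
rewrite -!natr1.
have m1 : a%:R <= (maxn a b)%:R :> R by rewrite ler_nat leq_maxl.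
have m2 : b%:R <= (maxn a b)%:R :> R by rewrite ler_nat leq_maxr.
by case: (leqP a' b') => _; lra.
Qed.

Lemma natr_dist (R : realType) (a b : nat) : ((a - b) + (b - a))%:R = `|a%:R - b%:R| :> R.
Proof.
have [h|/ltnW h] := leqP a b.
  by rewrite (eqP h) add0n natrB // distrC ger0_norm // subr_ge0 ler_nat.
by rewrite (eqP h) addn0 natrB // ger0_norm // subr_ge0 ler_nat.
Qed.

Lemma rb_joinable (R : realType) (K : Type) :
  @joinable R 20 color K (fun T => (rb_rank T)%:R) rb_ok rb_join.
Proof.
have rk l c k r : rb_ok (@Node color K l c k r) ->
   ((rb_rank (Node l c k r) <= rb_rank l + 2) && (rb_rank l < rb_rank (Node l c k r)) &&
   (rb_rank (Node l c k r) <= rb_rank r + 2) && (rb_rank r < rb_rank (Node l c k r)))%N.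
  case/andP => /= /and3P[nc _ _] /and3P[/eqP e _ _].
  have b0 := bh_gt0 r.
  rewrite /rb_rank /= e; move: nc b0; clear.
  by case: c => /=; case: (red_root l); case: (red_root r) => //= _; lia.
split; cbn beta; rewrite ?ler1n //.
- by move=> l b k r; rewrite /rb_ok => /andP[/= /and3P[_ -> ->] /and3P[_ -> ->]].
- move=> l b k r /rk h.
  by rewrite lerBlDr lerBrDr natr1 -natrD !ler_nat; move: h; clear; lia.
- move=> l b k r /rk h.
  by rewrite lerBlDr lerBrDr natr1 -natrD !ler_nat; move: h; clear; lia.
- by move=> l k r bl br; have [] := rb_join_spec k bl br.
- by move=> l k r bl br; have [] := rb_join_spec k bl br.
- by move=> l k r bl br; have [_ _ + _] := rb_join_spec k bl br; rewrite !ler_nat; clear; lia.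
- move=> l b k r l' r' x x0 /rk h bl br; have [_ _ /andP[_ h2] _] := rb_join_spec k bl br.
  by apply: nat_rank_up h2 _; move: h; clear; lia.
- move=> l k r bl br; have [_ _ _ h] := rb_join_spec k bl br.
  have : (cwork (rb_join l k r))%:R <=
    (20 + 7 * ((rb_rank l - rb_rank r) + (rb_rank r - rb_rank l)))%:R :> R by rewrite ler_nat.
  move=> /le_trans; apply; rewrite natrD natrM natr_dist.
  by have := normr_ge0 ((rb_rank l)%:R - (rb_rank r)%:R : R); lra.
- exact: rb_join_span.
Qed.

(** * Weight-balanced trees *)

Section WBArith.
Context {R : realType}.
Implicit Types a A S l r p q : R.

(** The condition [like] without division and for real weights; the fractional weight [1 / 2] occurs
    when the double rotation is excluded at a leaf. *)
Definition likeR a A S : bool := (a * (A + S) <= A) && (a * (A + S) <= S).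

(** The upper limit [1 - 1 / Num.sqrt 2] enters as [1 <= 2 * (1 - a) ^+ 2], and [3 / 10] is a
    rational number just above it. *)
Lemma wb_alpha_lt a : a < 1 -> 1 <= 2 * (1 - a) ^+ 2 -> a < 3 / 10.
Proof.
move=> a1 a2; rewrite ltNge; apply/negP => h.
have h7 : 1 - a <= 7 / 10 by lra.
have h8 : 0 <= 1 - a by lra.
have := ler_pM h8 h8 h7 h7.
by move: a2; rewrite expr2 => g1 g2; lra.
Qed.

Lemma wb_alpha_poly a : 1 <= 2 * (1 - a) ^+ 2 -> 0 <= 1 - 4 * a + 2 * (a * a).
Proof.
have -> : 1 - 4 * a + 2 * (a * a) = 2 * (1 - a) ^+ 2 - 1 by ring.
by rewrite subr_ge0.
Qed.

(** Two of the four conditions after a single rotation always hold when [A] is too light. A failure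
    violates one of the others, and either way [l] is heavy. *)
Lemma wb_rotate_left a A S l r : 0 < a -> a < 1 -> 1 <= 2 * (1 - a) ^+ 2 -> 0 < A -> A < a * (A + S) -> l + r = S ->
  a * S <= l -> a * S <= r -> a * (A + l) <= l /\ a * (A + S) <= A + l.
Proof.
move=> a0 a1 a2 A0 AS lr hl hr; have a3 := wb_alpha_lt a1 a2; have a2' := wb_alpha_poly a2.
have S0 : 0 < S by nra.
have aS : 0 < a * S by rewrite mulr_gt0.
split; last first.
  have := ler_wpM2r (ltW A0) (ltW a1); lra.
have h1 : (1 - a) * A <= a * S by lra.
have h2 : 0 <= a * S * (1 - 3 * a + a * a) by apply: mulr_ge0; nra.
have h3 := @ler_wpM2l _ (1 - a) ltac:(lra) _ _ hl.
have h4 := ler_wpM2l (ltW a0) h1.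
suff : (1 - a) * (a * A) <= (1 - a) * ((1 - a) * l) by rewrite ler_pM2l; lra.
have h5 := @ler_wpM2l _ (1 - a) ltac:(lra) _ _ h3.
lra.
Qed.

(* The weights are [A] for the left subtree, [S] for the right one, [l] and [r] for
   the children of the latter, [p] and [q] for those of [l]; if the single rotation
   does not restore the balance, then the double one does. *)
Lemma wb_double_rotation a A S l r p q : 0 < a -> a < 1 -> 1 <= 2 * (1 - a) ^+ 2 -> 0 < A ->
  a * (1 - a) * (A + S) <= A -> A < a * (A + S) ->
  l + r = S -> a * S <= l -> a * S <= r -> p + q = l -> a * l <= p -> a * l <= q ->
  ~~ (likeR a A l && likeR a (A + l) r) ->
  [&& likeR a A p, likeR a q r & likeR a (A + p) (q + r)] /\ A < l.
Proof.
move=> a0 a1 a2 A0 h1 h2 lr hl hr pq hp hq nl; have a3 := wb_alpha_lt a1 a2; have a2' := wb_alpha_poly a2.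
have [g1 g2] := wb_rotate_left a0 a1 a2 A0 h2 lr hl hr.
have {}nl : A < a * (A + l) \/ r < a * (A + S).
  move: nl; rewrite /likeR g1 andbT -addrA lr g2 /= negb_and -!ltNge.
  by case/orP; auto.
have b0 : 0 <= 1 - a by lra.
have S0 : 0 < S by clear - a0 lr hl hr A0 h2 b0 a3; nra.
have aS : 0 < a * S by rewrite mulr_gt0.
have [W0 A0'] : 0 < A + S /\ 0 <= A by rewrite addr_gt0 // ltW.
have x0 := ler_wpM2l b0 h1.
(* Both ways in which the single rotation fails bound [l] from below: [K1] relative to [A], [K2] to
   the total weight, [KS] to [S]. These bounds make the halves of [l] heavy enough for the double
   rotation. *)
have K1 : (1 - 2 * a) * A < a * l.
  case: nl => nl; first by have := mulr_gt0 a0 A0; clear - nl; lra.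
  have y0 : (1 - a) * A <= a * S by clear - h2; lra.
  have y1 := ler_wpM2l b0 y0.
  have y2 : a * r < a * (a * (A + S)) by rewrite ltr_pM2l.
  have : a * l = a * S - a * r by rewrite -lr; ring.
  have := mulr_gt0 (mulr_gt0 a0 a0) A0.
  by clear - y1 y2 h2; lra.
have K2 : (1 - 2 * a) * (A + S) <= l \/ (1 - a) * (1 - a) * (A + S) <= l.
  case: nl => nl; [right|by left; clear - nl lr h2; lra].
  by rewrite -(ler_pM2l a0); clear - nl x0 h1; lra.
have K3 : a * (A + S) <= l.
  by case: K2 => K2; apply: le_trans K2; rewrite ler_wpM2r ?(ltW W0) //; clear - a3 a2'; lra.
have Al : A < l.
  rewrite -(ltr_pM2l a0); apply: le_lt_trans K1.
  by rewrite ler_wpM2r //; clear - a3; lra.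
have x1 : p <= (1 - a) * l by clear - pq hq; lra.
have x2 : l <= (1 - a) * S by clear - lr hr; lra.
have x3 := ler_wpM2l b0 x2.
have N1 : a * (A + p) <= A.
  have x4 := ler_wpM2l (ltW a0) (le_trans x1 x3).
  have x6 := mulr_ge0 b0 (mulr_ge0 (mulr_ge0 (ltW a0) b0) A0').
  by clear - x0 x4 x6; lra.
have N2 : a * (A + p) <= p.
  have y1 := ler_wpM2l b0 hp; have y2 := ler_wpM2l b0 (ltW K1).
  have y3 := mulr_ge0 a2' A0'.
  by clear - y1 y2 y3 hp b0 K1 a0; lra.
have N4 : a * (q + r) <= r.
  have y1 : q <= (1 - a) * l by clear - pq hp; lra.
  have y2 := ler_wpM2l (ltW a0) y1.
  have lS : l <= S by clear - lr hr aS; lra.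
  have y3 := ler_wpM2l b0 (le_trans (ler_wpM2l (ltW a0) lS) hr).
  by clear - y2 y3; lra.
have KS : S <= (2 - a) * l.
  have c0 : 0 <= 2 - a by clear - a1; lra.
  case: nl => nl.
    have y0 : (1 - a) * (1 - a) * (A + S) <= l.
      by rewrite -(ler_pM2l a0); clear - nl x0 h1; lra.
    have y1 := ler_wpM2l c0 y0.
    have y2 : S <= (1 - a + a * a) * (A + S) by clear - h1; lra.
    have y3 : 0 <= ((2 - a) * ((1 - a) * (1 - a)) - (1 - a + a * a)) * (A + S).
      by apply: mulr_ge0 (ltW W0); clear - a0 a3; nra.
    by clear - y1 y2 y3; lra.
  have y0 : S - a * (A + S) <= l by clear - nl lr; lra.
  have y1 := ler_wpM2l b0 y0.
  have y2 : (1 - a) * (A + S) <= S by clear - h2; lra.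
  have y2' := ler_wpM2l (ltW a0) y2.
  have y3 : (1 - 2 * a) * S <= (1 - a) * l by clear - y1 y2'; lra.
  have y4 := ler_wpM2l c0 y3; have y5 := mulr_ge0 a2' (ltW S0).
  by rewrite -(@ler_pM2l _ (1 - a)); clear - y4 y5 a1; lra.
have N3 : a * (q + r) <= q.
  have y1 : r <= (1 - a) * l by clear - KS lr; lra.
  have y2 := ler_wpM2l (ltW a0) y1; have y3 := ler_wpM2l b0 hq.
  by clear - y2 y3; lra.
have e : A + p + (q + r) = A + S by clear - pq lr; lra.
have N5 : a * (A + p + (q + r)) <= A + p.
  by rewrite e; have := ler_wpM2l (ltW a0) K3; clear - h1 hp; lra.
have N6 : a * (A + p + (q + r)) <= q + r.
  by rewrite e; have := ler_wpM2l (ltW a0) (ltW Al); clear - hq hr; lra.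
by rewrite /likeR N1 N2 N3 N4 N5 N6.
Qed.

End WBArith.

(** * The weight-balanced join *)

Section WBJoin.
Context {R : realType} {K : Type}.
Variable a : R.
Implicit Types (T Tl Tr l r : tree unit K) (k : K).

Local Notation w T := ((weight T)%:R : R).

Lemma weight_gt0 T : 0 < w T. Proof. by rewrite ltr0n. Qed.

Lemma weight_node (T1 T2 : tree unit K) b k : w (Node T1 b k T2) = w T1 + w T2.
Proof. by rewrite -natrD /weight /= addSn addnS. Qed.

Lemma likeE T1 T2 : like a T1 T2 = likeR a (w T1) (w T2).
Proof.
rewrite /like /likeR natrD.
have s0 : 0 < w T1 + w T2 by rewrite addr_gt0 ?weight_gt0.
rewrite ler_pdivlMr // ler_pdivrMr //; congr (_ && _).
by apply/idP/idP; lra.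
Qed.

Lemma likeC T1 T2 : like a T1 T2 = like a T2 T1.
Proof. by rewrite !likeE /likeR andbC [w T1 + _]addrC. Qed.

Lemma weight_mirror T : weight (mirror T) = weight T.
Proof. by rewrite /weight size_mirror. Qed.

Lemma wb_mirror T : wb_balanced a (mirror T) = wb_balanced a T.
Proof.
elim: T => [//|l IHl b k r IHr] /=; rewrite IHl IHr likeC !likeE !weight_mirror.
by congr (_ && _); rewrite andbC.
Qed.

(** The logarithm to the base [1 / (1 - a)]: a child has at most the fraction [1 - a] of the weight,
    so its rank is lower by at least one. *)
Let rk T : R := ln (w T) / - ln (1 - a).

Hypotheses (a0 : 0 < a) (a1 : a < 1) (a2 : 1 <= 2 * (1 - a) ^+ 2).

(** The premise on the weights says that [Tl] is not the light side; it is the invariant of the walk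
    down the right spine. *)
Lemma wb_join_right_spec Tl k Tr : wb_balanced a Tl -> wb_balanced a Tr ->
  a * (w Tl + w Tr) <= w Tl ->
  let T := cval (wb_join_right a Tl k Tr) in
  wb_balanced a T /\ tree_size T = (tree_size Tl + tree_size Tr).+1.
Proof.
have [a0' a1' a2'] : [/\ 0 < a, a < 1 & 1 <= 2 * (1 - a) ^+ 2] by split.
have a3 := wb_alpha_lt a1' a2'; have a4 := wb_alpha_poly a2'.
elim: Tl => [|l _ [] k' c IH] /=.
  move=> _ bTr h; case: ifPn => [lk|].
    by rewrite /= lk bTr.
  rewrite likeE /likeR h /= -ltNge => h'.
  have D1 : 1 <= w Tr by rewrite ler1n.
  have W1 : w (Leaf : tree unit K) = 1 by [].
  by rewrite W1 in h h'; exfalso; lra.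
move=> /and3P[lk bl bc] bTr h; case: ifPn => [lk2|].
  by rewrite /= lk2 lk bl bc bTr.
rewrite likeE /likeR h /= -ltNge; rewrite weight_node in h *.
move: (lk); rewrite likeE /likeR => /andP[lA lC] hD.
have A0 := weight_gt0 l; have C0 := weight_gt0 c; have D0 := weight_gt0 Tr.
(* As [Tr] is too light for [Tl], [(1 - a) * w Tr] is at most [w c]; then [1 - 3 * a + a * a >= 0]
   preserves the invariant. *)
have hc : a * (w c + w Tr) <= w c.
  have x1 : (1 - a) * w Tr <= w c by lra.
  have x2 := ler_wpM2l (ltW a0') x1.
  have x3 : 0 <= (1 - 3 * a + a * a) * w c.
    by apply: mulr_ge0; [have := mulr_gt0 a0' a0'; lra|exact: ltW].
  rewrite -(@ler_pM2l _ (1 - a)); lra.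
have := IH bc bTr hc.
case: (wb_join_right a c k Tr) => [T' wk sp] /= [bT' sz].
have wT' : w T' = w c + w Tr by rewrite -natrD /weight sz addSn addnS.
case: ifPn => [lk2|]; first by rewrite /= lk2 bl bT' sz; split=> //; clear; lia.
rewrite likeE /likeR => nlk.
have hA : w l < a * (w l + w T').
  move: nlk; rewrite negb_and -!ltNge => /orP[//|].
  rewrite wT'; have : 0 <= (1 - 2 * a) * w c by apply: mulr_ge0; lra.
  have : 0 <= (1 - a) * w Tr by apply: mulr_ge0; lra.
  lra.
case: T' bT' sz wT' hA {nlk} => [|l1 [] k1 r1] bT' sz wT' hA.
  by move: sz.
move: bT' => /= /and3P[lk1 bl1 br1]; move: (lk1); rewrite likeE => /andP[hl1 hr1].
rewrite weight_node in wT' hA.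
(* [l] was balanced against [c], and [Tr] makes up at most the fraction [a] of the total. *)
have lowA : a * (1 - a) * (w l + (w l1 + w r1)) <= w l.
  rewrite wT'; have x1 : (1 - a) * (w l + w c + w Tr) <= w l + w c by lra.
  have x2 := ler_wpM2l (ltW a0') x1; lra.
case: ifPn => [/andP[lk2 lk3]|nl] /=.
  by rewrite lk2 lk3 bl bl1 br1; split=> //; move: sz => /=; clear; lia.
have nl' : ~~ (likeR a (w l) (w l1) && likeR a (w l + w l1) (w r1)).
  by move: nl; rewrite !likeE weight_node.
case: l1 bl1 lk1 hl1 hr1 wT' hA lowA nl' sz {nl} => [|p [] kp q].
  (* A leaf [l1] cannot be rotated, but the real inequality still applies to its weight [1], cut
     into two halves; it gives [w l < 1], which is absurd. *)
  move=> _ _ hl1 hr1 wT' hA lowA nl' _; exfalso.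
  have L1 : w (Leaf : tree unit K) = 1 by [].
  rewrite L1 in hl1 hr1 wT' hA lowA nl'.
  have := @wb_double_rotation R a (w l) (1 + w r1) 1 (w r1) (1 / 2) (1 / 2) a0' a1' a2' A0 lowA hA
    erefl hl1 hr1 ltac:(lra) ltac:(lra) ltac:(lra) nl'.
  by case=> _; rewrite ltNge ler1n.
move=> /= /and3P[lkpq bp bq] _ hl1 hr1 wT' hA lowA nl' sz.
move: lkpq; rewrite likeE => /andP[hp hq].
rewrite !weight_node in hl1 hr1 hA lowA nl'.
have [/and3P[d1 d2 d3] _] := wb_double_rotation a0' a1' a2' A0 lowA hA erefl hl1 hr1 erefl hp hq nl'.
rewrite !likeE !weight_node d1 d2 d3 bl bp bq br1; split=> //.
by move: sz => /=; clear; lia.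
Qed.

Let lam_gt0 : 0 < - ln (1 - a).
Proof.
have a0' := a0; have a1' := a1.
by rewrite oppr_gt0 ln_lt0 //; apply/andP; split; lra.
Qed.

(* The left subtree that the recursion leaves behind takes at least the
   fraction [a] of the weight, so that the rank drops by one. *)
Let rk_drop x y : 0 < y -> y <= (1 - a) * x -> ln y / - ln (1 - a) <= ln x / - ln (1 - a) - 1.
Proof.
have a0' := a0; have a1' := a1; move=> y0 yx; have l0 := lam_gt0.
have x0 : 0 < x by rewrite -(@pmulr_rgt0 _ (1 - a)); lra.
have : ln y <= ln (1 - a) + ln x.
  by rewrite -lnM ?posrE //; [exact: ln_le|lra].
move=> h; rewrite ler_pdivrMr // mulrBl divfK ?gt_eqF //; lra.
Qed.

(** The bound [x] on the rank difference shrinks by one at each call: an unlike pair forces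
    [x >= 1], and the right child ranks at least one lower. *)
Lemma wb_join_right_cost Tl k Tr x : wb_balanced a Tl -> 0 <= x ->
  a * (w Tl + w Tr) <= w Tl -> rk Tl <= rk Tr + x ->
  (cwork (wb_join_right a Tl k Tr))%:R <= 12 * (1 + x).
Proof.
have [a0' a1' a2'] : [/\ 0 < a, a < 1 & 1 <= 2 * (1 - a) ^+ 2] by split.
have a3 := wb_alpha_lt a1' a2'; have a4 := wb_alpha_poly a2'.
elim: Tl x => [|l _ [] k' c IH] x bT x0 h hx.
  apply: (@le_trans _ _ 3%:R); last lra.
  by rewrite ler_nat /=; case: ifP.
rewrite /=; case: ifPn => [lk|].
  apply: (@le_trans _ _ 3%:R); last lra.
  by rewrite ler_nat.
rewrite likeE /likeR h /= -ltNge => hD.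
have D0 := weight_gt0 Tr.
have x1 : 1 <= x.
  have : rk Tr <= rk (Node l tt k' c) - 1.
    apply: rk_drop => //; have W0 := weight_gt0 (Node l tt k' c).
    have y1 : 0 <= (1 - 3 * a + a * a) * w (Node l tt k' c).
      by apply: mulr_ge0; [have := mulr_gt0 a0' a0'; lra|exact: ltW].
    rewrite -(@ler_pM2l _ (1 - a)); lra.
  lra.
move: bT => /= /and3P[+ bl bc]; rewrite likeE => /andP[lA lC].
rewrite weight_node in h hD.
have A0 := weight_gt0 l; have C0 := weight_gt0 c.
have hc : a * (w c + w Tr) <= w c.
  have y1 : (1 - a) * w Tr <= w c by lra.
  have y2 := ler_wpM2l (ltW a0') y1.
  have y3 : 0 <= (1 - 3 * a + a * a) * w c.
    by apply: mulr_ge0; [have := mulr_gt0 a0' a0'; lra|exact: ltW].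
  rewrite -(@ler_pM2l _ (1 - a)); lra.
have rkc : rk c <= rk (Node l tt k' c) - 1.
  by apply: rk_drop => //; rewrite weight_node; lra.
have := IH (x - 1) bc ltac:(lra) hc ltac:(lra).
case: (wb_join_right a c k Tr) => [T' wk sp] /= IHw.
set n := (n in n.+2).
have : (n <= wk + 9)%N.
  rewrite /n; case: ifP => _ /=; first by clear; lia.
  by case: (T') => [|l1 ? k1 r1] /=; [clear; lia|case: ifP => _ /=; clear; lia].
rewrite -(leq_add2r 2) addn2 -(ler_nat R) !natrD; lra.
Qed.

Lemma not_like_lt Tl Tr : ~~ like a Tl Tr -> (weight Tr < weight Tl)%N \/ (weight Tl < weight Tr)%N.
Proof.
have [a0' a1' a2'] : [/\ 0 < a, a < 1 & 1 <= 2 * (1 - a) ^+ 2] by split.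
have a3 := wb_alpha_lt a1' a2'.
case: (ltngtP (weight Tr) (weight Tl)) => [|_|e]; [by left|by right|].
rewrite likeE /likeR e; have := weight_gt0 Tl => h.
have : 0 <= (1 - 2 * a) * w Tl by apply: mulr_ge0; lra.
by move=> h2 /negP[]; apply/andP; split; lra.
Qed.

Lemma wb_join_spec Tl k Tr : wb_balanced a Tl -> wb_balanced a Tr ->
  let e := wb_join a Tl k Tr in
  let T := cval e in
  [/\ wb_balanced a T, tree_size T = (tree_size Tl + tree_size Tr).+1 &
      (cwork e)%:R <= 16 + 12 * `|rk Tl - rk Tr| ].
Proof.
move=> bl br; rewrite /wb_join.
have [a0' a1' a2'] : [/\ 0 < a, a < 1 & 1 <= 2 * (1 - a) ^+ 2] by split.
have a3 := wb_alpha_lt a1' a2'.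
have lt_le T1 T2 : (weight T2 < weight T1)%N -> a * (w T1 + w T2) <= w T1.
  rewrite -(ltr_nat R) => h; have h0 := weight_gt0 T2.
  have : 0 <= a * (w T1 - w T2) by apply: mulr_ge0; lra.
  have : 0 <= (1 - 2 * a) * w T1 by apply: mulr_ge0; lra.
  lra.
have n0 := normr_ge0 (rk Tl - rk Tr).
have n1 := ler_norm (rk Tl - rk Tr).
have n2 : - (rk Tl - rk Tr) <= `|rk Tl - rk Tr| by rewrite -normrN ler_norm.
case: ifPn => [/andP[nl h]|c1].
  have [bT sz] := wb_join_right_spec k bl br (lt_le _ _ h).
  have := @wb_join_right_cost Tl k Tr `|rk Tl - rk Tr| bl n0 (lt_le _ _ h) ltac:(lra).
  move: (wb_join_right a Tl k Tr) bT sz => [T wk s] /= bT sz.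
  by rewrite -natr1 => cost; split=> //; lra.
case: ifPn => [/andP[nl h]|c2].
  have h' : a * (w (mirror Tr) + w (mirror Tl)) <= w (mirror Tr).
    by rewrite !weight_mirror; apply: lt_le.
  have blm : wb_balanced a (mirror Tl) by rewrite wb_mirror.
  have brm : wb_balanced a (mirror Tr) by rewrite wb_mirror.
  have rkm : rk (mirror Tr) <= rk (mirror Tl) + `|rk Tl - rk Tr|.
    by rewrite /rk !weight_mirror -!/(rk _); lra.
  have [bT sz] := wb_join_right_spec k brm blm h'.
  have := @wb_join_right_cost _ k _ `|rk Tl - rk Tr| brm n0 h' rkm.
  rewrite /mirrored.
  move: (wb_join_right a (mirror Tr) k (mirror Tl)) bT sz => [T wk s] /= bT sz.
  rewrite wb_mirror bT size_mirror sz !size_mirror -addn2 natrD => cost.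
  by split=> //; [rewrite addnC|lra].
have lk : like a Tl Tr.
  apply/negPn/negP => nl; move: c1 c2; rewrite nl /=.
  by case: (not_like_lt nl) => ->.
rewrite /= bl br lk; split=> //.
apply: (@le_trans _ _ 16%:R); last lra.
by rewrite ler_nat.
Qed.

Lemma wb_join_right_span Tl k Tr :
  (cspan (wb_join_right a Tl k Tr) <= cwork (wb_join_right a Tl k Tr))%N.
Proof.
elim: Tl => [|l _ b k' c IH] /=; first by case: ifP.
case: ifP => //= _; move: IH; case: (wb_join_right a c k Tr) => [T' wk s] /= IH.
case: ifP => _ /=; first by move: IH; clear; lia.
by case: T' => [|l1 ? k1 r1] /=; [move: IH; clear; lia|case: ifP => _ /=; move: IH; clear; lia].
Qed.

Lemma wb_join_span Tl k Tr : (cspan (wb_join a Tl k Tr) <= cwork (wb_join a Tl k Tr))%N.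
Proof.
rewrite /wb_join; case: ifP => _; first exact: wb_join_right_span.
by case: ifP => _ //; rewrite /mirrored; exact: wb_join_right_span.
Qed.

(** A child has at least the fraction [a] of the weight, so [- ln a / - ln (1 - a)] bounds the rank
    gap; [16] comes from the cost of a join. *)
Lemma wb_joinable :
  @joinable R (16 + - ln a / - ln (1 - a)) unit K rk (wb_balanced a) (wb_join a).
Proof.
have [a0' a1' a2'] : [/\ 0 < a, a < 1 & 1 <= 2 * (1 - a) ^+ 2] by split.
have a3 := wb_alpha_lt a1' a2'; have l0 := lam_gt0.
have c0 : 0 <= - ln a / - ln (1 - a).
  by rewrite divr_ge0 ?(ltW l0) // oppr_ge0 ln_le0 // ltW.
have rkgap x y : 0 < x -> 0 < y -> a * (x + y) <= x -> a * (x + y) <= y ->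
    ln (x + y) / - ln (1 - a) - (16 + - ln a / - ln (1 - a)) <= ln x / - ln (1 - a) <=
    ln (x + y) / - ln (1 - a) - 1.
  move=> x0 y0 hx hy; rewrite rk_drop // ?andbT; last lra.
  have : ln a + ln (x + y) <= ln x.
    by rewrite -lnM ?posrE //; [apply: ln_le => //; rewrite mulr_gt0 // addr_gt0|rewrite addr_gt0].
  move=> h; suff : (ln a + ln (x + y)) / - ln (1 - a) <= ln x / - ln (1 - a) by rewrite mulrDl mulNr; lra.
  by rewrite ler_pM2r ?invr_gt0.
have rkle T1 T2 : (tree_size T1 <= tree_size T2)%N -> rk T1 <= rk T2.
  by move=> h; rewrite /rk ler_pM2r ?invr_gt0 //; apply: ln_le; rewrite ?weight_gt0 // ler_nat.
split.
- lra.
- by rewrite /rk ln1 mul0r.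
- by [].
- by move=> l b k r /= /and3P[_ -> ->].
- move=> l b k r /= /and3P[]; rewrite likeE => /andP[h1 h2] _ _.
  by rewrite /rk weight_node; apply: rkgap.
- move=> l b k r /= /and3P[]; rewrite likeC likeE => /andP[h1 h2] _ _.
  by rewrite /rk weight_node [w l + w r]addrC; apply: rkgap.
- by move=> l k r bl br; have [] := wb_join_spec k bl br.
- by move=> l k r bl br; have [] := wb_join_spec k bl br.
- move=> l k r bl br; have [_ sz _] := wb_join_spec k bl br.
  by split; apply: rkle; rewrite sz; clear; lia.
- move=> l b k r l' r' x x0 _ bl br hl hr.
  have [_ sz _] := wb_join_spec k bl br.
  (* Raising a rank by [x] multiplies the weight by [e]. The weight of a join is the sum of the
     weights of its two trees, as for a node, so [jn_up] follows. *)
  pose e := expR (x * - ln (1 - a)).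
  have up T1 T2 : rk T1 <= rk T2 + x -> w T1 <= e * w T2.
    rewrite /rk ler_pdivrMr // mulrDl divfK ?gt_eqF // => h.
    have -> : e * w T2 = expR (ln (w T2) + x * - ln (1 - a)).
      by rewrite expRD lnK ?posrE ?weight_gt0 // mulrC.
    by rewrite -[leLHS]lnK ?posrE ?weight_gt0 // ler_expR.
  rewrite /rk ler_pdivrMr // mulrDl divfK ?gt_eqF //.
  have -> : ln (w (Node l b k r)) + x * - ln (1 - a) = ln (e * w (Node l b k r)).
    by rewrite lnM ?posrE ?expR_gt0 ?weight_gt0 // expRK addrC.
  apply: ln_le; first exact: weight_gt0.
  have -> : w (cval (wb_join a l' k r')) = w l' + w r'.
    by rewrite /weight sz -natrD addSn addnS.
  by rewrite weight_node mulrDr; apply: lerD; apply: up.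
- move=> l k r bl br; have [_ _ h] := wb_join_spec k bl br.
  apply: le_trans h _; have n0 := normr_ge0 (rk l - rk r).
  have : 0 <= - ln a / - ln (1 - a) * (1 + `|rk l - rk r|) by apply: mulr_ge0 => //; lra.
  lra.
- exact: wb_join_span.
Qed.

End WBJoin.

Lemma wb_alpha_range (R : realType) (alpha : R) :
  alpha <= 1 - 1 / Num.sqrt 2 -> alpha < 1 /\ 1 <= 2 * (1 - alpha) ^+ 2.
Proof.
have s0 : 0 < Num.sqrt 2 :> R by rewrite sqrtr_gt0.
have i0 : 0 < 1 / Num.sqrt 2 :> R by rewrite divr_gt0.
move=> h; split; first lra.
have e : 1 = 2 * (1 / Num.sqrt 2) ^+ 2 :> R.
  by rewrite expr_div_n sqr_sqrtr // expr1n mul1r divff.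
by rewrite [leLHS]e ler_pM2l // lerXn2r ?nnegrE; lra.
Qed.

(** * Treaps with given priorities *)

Section TreapRun.
Context {R : realType} {d : Order.disp_t} {K : orderType d}.
Variables (p : K -> R) (S : {pred K}).
Hypothesis pinj : {in S &, injective p}.
Implicit Types (T Tl Tr : tree unit K) (k v x z : K) (s : seq K).
Local Notation tjoin := (treap_join p).

Definition btw x v z : bool := (x <= z <= v)%O || (v <= z <= x)%O.

(* Then [x] is on the search path of [v] in the treap with keys [s]. *)
Definition rec s v x : bool :=
  all (fun z => (z != v) && btw x v z ==> (p z <= p x)) s.

Definition recs s v : nat := count (rec s v) s.

(** Search order and strict heap order of each root against all keys below it. The keys lie in [S],
    where priorities are distinct. *)
Fixpoint good T : bool :=
  if T is Node l _ k r then
    [&& k \in S, all (fun x => (x < k)%O && (p x < p k)) (inorder l),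
        all (fun x => (k < x)%O && (p x < p k)) (inorder r), good l & good r]
  else true.

Lemma good_node l u k r : good (Node l u k r) ->
  [/\ k \in S, all (fun x => (x < k)%O && (p x < p k)) (inorder l),
      all (fun x => (k < x)%O && (p x < p k)) (inorder r), good l & good r].
Proof. by case: u => /and5P. Qed.

Lemma good_sub T : good T -> {subset inorder T <= S}.
Proof.
elim: T => [//|l IHl [] k r IHr] /= /and5P[kS _ _ gl gr] x.
by rewrite mem_cat inE => /or3P[/(IHl gl)|/eqP->|/(IHr gr)].
Qed.

Lemma good_sorted T : good T -> sorted <%O (inorder T).
Proof.
elim: T => [//|l IHl [] k r IHr] /= /and5P[_ al ar gl gr].
have tr : transitive (<%O : rel K) by exact: lt_trans.
rewrite sorted_pairwise // pairwise_cat -!sorted_pairwise // IHl //=.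
rewrite path_sortedE // IHr // andbT.
have ar' : all (<%O k) (inorder r) by apply/allP => x /(allP ar) /andP[].
rewrite ar' andbT; apply/allrelP => x y xl.
have /andP[xk _] := allP al _ xl.
by rewrite inE => /orP[/eqP->//|/(allP ar') ky]; exact: lt_trans ky.
Qed.

Lemma good_uniq T : good T -> uniq (inorder T).
Proof. by move=> /good_sorted; apply: sorted_uniq; [exact: lt_trans|exact: ltxx]. Qed.

Lemma treap_good T : treap p T -> {subset inorder T <= S} -> good T.
Proof.
rewrite /treap /bst; elim: T => [//|l IHl [] k r IHr] /andP[/= srt /and4P[rl rr hl hr]] sub.
have tr : transitive (<%O : rel K) by exact: lt_trans.
move: srt; rewrite sorted_pairwise // pairwise_cat -!sorted_pairwise //=.
rewrite path_sortedE // => /and3P[/allrelP lk sl /andP[kr sr]].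
have heap_le T : heap_ordered p T -> root_below p (p k) T -> {in inorder T, forall x, p x <= p k}.
  elim: T {rl rr hl hr sub IHl IHr lk sl kr sr} => [//|l0 IHl [] k0 r0 IHr] /= /and4P[l1 l2 h1 h2] k0k x.
  have lift T : root_below p (p k0) T -> root_below p (p k) T.
    by case: T => [//|? ? ? ?] /= h; apply: le_trans k0k.
  by rewrite mem_cat inE => /or3P[/(IHl h1 (lift _ l1))|/eqP->|/(IHr h2 (lift _ l2))].
have kS : k \in S by apply: sub; rewrite mem_cat inE eqxx orbT.
have subl : {subset inorder l <= S} by move=> x xl; apply: sub; rewrite mem_cat xl.
have subr : {subset inorder r <= S}.
  by move=> x xr; apply: sub; rewrite mem_cat inE xr !orbT.
rewrite kS IHl ?IHr ?sl ?sr //= !andbT; apply/andP; split; apply/allP => x xT.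
- have xk : (x < k)%O by apply: lk => //; exact: mem_head.
  rewrite xk lt_neqAle (heap_le _ hl rl) // andbT.
  by apply/eqP => /(pinj (subl _ xT) kS) e; rewrite e ltxx in xk.
- have xk : (k < x)%O by exact: (allP kr).
  rewrite xk lt_neqAle (heap_le _ hr rr) // andbT.
  by apply/eqP => /(pinj (subr _ xT) kS) e; rewrite e ltxx in xk.
Qed.

Lemma count_sub (A : eqType) (s s' : seq A) (P Q : pred A) : uniq s ->
  (forall x : A, x \in s -> P x -> (x \in s') && Q x) -> (count P s <= count Q s')%N.
Proof.
move=> us h; rewrite -!size_filter; apply: uniq_leq_size; first exact: filter_uniq.
by move=> x; rewrite !mem_filter => /andP[Px xs]; rewrite andbC h.
Qed.

Lemma count_disjoint (A : eqType) (s1 s2 s : seq A) (P1 P2 Q : pred A) : uniq s1 -> uniq s2 ->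
  (forall x : A, x \in s1 -> x \notin s2) ->
  (forall x : A, x \in s1 -> P1 x -> (x \in s) && Q x) ->
  (forall x : A, x \in s2 -> P2 x -> (x \in s) && Q x) ->
  (count P1 s1 + count P2 s2 <= count Q s)%N.
Proof.
move=> u1 u2 dis h1 h2.
have := @count_sub A ([seq x : A <- s1 | P1 x] ++ [seq x : A <- s2 | P2 x]) s predT Q.
rewrite count_predT size_cat !size_filter; apply.
  rewrite cat_uniq !filter_uniq // andbT /=; apply/hasPn => x.
  by rewrite !mem_filter => /andP[_ x2]; apply/negP => /andP[_ /dis /negP].
by move=> x; rewrite mem_cat !mem_filter => /orP[] /andP[Px xs] _; [exact: h1|exact: h2].
Qed.

Lemma good_root l u k r : good (Node l u k r) -> {in inorder (Node l u k r), forall x, p x <= p k}.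
Proof.
move=> /= /and5P[_ al ar _ _] x; rewrite mem_cat inE.
by case/or3P => [/(allP al)/andP[_ /ltW]|/eqP->|/(allP ar)/andP[_ /ltW]].
Qed.

Lemma btw_lt x v z m : (x < m)%O -> (v < m)%O -> btw x v z -> (z < m)%O.
Proof. by move=> xm vm /orP[] /andP[_ zv]; apply: le_lt_trans zv _. Qed.

Lemma btw_gt x v z m : (m < x)%O -> (m < v)%O -> btw x v z -> (m < z)%O.
Proof. by move=> xm vm /orP[] /andP[zv _]; apply: lt_le_trans zv. Qed.

Lemma rec_sub s s' v x :
  (forall z, z \in s -> z != v -> btw x v z -> z \in s') -> rec s' v x -> rec s v x.
Proof.
move=> h /allP r; apply/allP => z zs; apply/implyP => /andP[zv zb].
by have := r _ (h _ zs zv zb); rewrite zv zb.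
Qed.

Lemma recs_root l u m r v : good (Node l u m r) -> rec (inorder (Node l u m r)) v m.
Proof. by move=> /good_root h; apply/allP => z /h ->; rewrite implybT. Qed.

(** The root is on every search path, and a search path in the subtree on the side of [v] is part of
    one in the whole tree. The predicate [Q] serves [recs] and [high_recs] at once. *)
Lemma count_rec_node_r (Q : pred K) l u m r v : good (Node l u m r) -> (m < v)%O -> Q m ->
  (count (fun x => rec (inorder r) v x && Q x) (inorder r) <
   count (fun x => rec (inorder (Node l u m r)) v x && Q x) (inorder (Node l u m r)))%N.
Proof.
move=> g mv Qm; have ug := good_uniq g; have hm := recs_root v g.
case: u g ug hm => /= /and5P[_ al ar _ gr] ug hm.
set c := count _ (inorder r); have -> : c.+1 = (count predT [:: m] + c)%N by [].
apply: count_disjoint => //; first exact: good_uniq.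
- by move=> x; rewrite inE => /eqP ->; apply/negP => /(allP ar); rewrite ltxx.
- by move=> x; rewrite inE => /eqP -> _; rewrite mem_cat inE eqxx orbT hm.
- move=> x xr /andP[rx Qx]; rewrite mem_cat inE xr !orbT Qx andbT /=; apply: rec_sub rx => z.
  have /andP[mx _] := allP ar _ xr.
  rewrite mem_cat inE => /or3P[/(allP al)/andP[zm _]|/eqP->|//] _ /(btw_gt mx mv).
    by move=> /(lt_trans zm); rewrite ltxx.
  by rewrite ltxx.
Qed.

Lemma count_rec_node_l (Q : pred K) l u m r v : good (Node l u m r) -> (v < m)%O -> Q m ->
  (count (fun x => rec (inorder l) v x && Q x) (inorder l) <
   count (fun x => rec (inorder (Node l u m r)) v x && Q x) (inorder (Node l u m r)))%N.
Proof.
move=> g vm Qm; have ug := good_uniq g; have hm := recs_root v g.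
case: u g ug hm => /= /and5P[_ al ar gl _] ug hm.
set c := count _ (inorder l); have -> : c.+1 = (count predT [:: m] + c)%N by [].
apply: count_disjoint => //; first exact: good_uniq.
- by move=> x; rewrite inE => /eqP ->; apply/negP => /(allP al); rewrite ltxx.
- by move=> x; rewrite inE => /eqP -> _; rewrite mem_cat inE eqxx orbT hm.
- move=> x xl /andP[rx Qx]; rewrite mem_cat xl Qx andbT /=; apply: rec_sub rx => z.
  have /andP[xm _] := allP al _ xl.
  rewrite mem_cat inE => /or3P[//|/eqP->|/(allP ar)/andP[mz _]] _ /(btw_lt xm vm).
    by rewrite ltxx.
  by move=> /(lt_trans mz); rewrite ltxx.
Qed.

Lemma recsE s v : recs s v = count (fun x => rec s v x && predT x) s.
Proof. by apply: eq_count => x; rewrite andbT. Qed.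

Lemma recs_node_gt l u m r v : good (Node l u m r) -> (m < v)%O ->
  (recs (inorder r) v < recs (inorder (Node l u m r)) v)%N.
Proof. by move=> g h; rewrite !recsE; exact: count_rec_node_r. Qed.

Lemma recs_node_lt l u m r v : good (Node l u m r) -> (v < m)%O ->
  (recs (inorder l) v < recs (inorder (Node l u m r)) v)%N.
Proof. by move=> g h; rewrite !recsE; exact: count_rec_node_l. Qed.

(* Counts the nodes of an inner spine that a join at [k] passes. *)
Definition high_recs s k : nat := count (fun x => rec s k x && (p k <= p x)) s.

Lemma key_aboveP k T : good T -> key_above p k T -> {in inorder T, forall x, p x < p k}.
Proof.
case: T => [//|l [] k0 r] /= /and5P[_ al ar _ _] h x.
rewrite mem_cat inE => /or3P[/(allP al)|/eqP-> //|/(allP ar)] /andP[_ h2]; exact: lt_trans h.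
Qed.

Lemma key_above_all k T : {in inorder T, forall x, p x < p k} -> key_above p k T.
Proof. by case: T => [//|l [] k0 r] /= h; apply: h; rewrite mem_cat inE eqxx orbT. Qed.

Lemma treap_joinE Tl k Tr : treap_join p Tl k Tr =
  tick (if key_above p k Tl && key_above p k Tr then op (node Tl k Tr)
    else tick match Tl, Tr with
    | Leaf, Leaf => op (node Leaf k Leaf)
    | Node ll _ kl rl, Leaf => let* T := treap_join p rl k Tr in op (node ll kl T)
    | Leaf, Node lr _ kr rr => let* T := treap_join p Tl k lr in op (node T kr rr)
    | Node ll _ kl rl, Node lr _ kr rr =>
      tick (if p kr < p kl then let* T := treap_join p rl k Tr in op (node ll kl T)
      else let* T := treap_join p Tl k lr in op (node T kr rr))
    end).
Proof. by case: Tl => [|? ? ? ?]; case: Tr. Qed.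

Definition treap_join_post Tl k Tr (e : Defs.comp (tree unit K)) : Prop :=
  [/\ good (cval e), inorder (cval e) = inorder Tl ++ k :: inorder Tr &
      (cwork e <= 4 * (high_recs (inorder Tl) k + high_recs (inorder Tr) k) + 2)%N].

(** Covers all joins inside split and splitLast: these put a former root back above parts of its own
    subtrees, so each of them is a single node. *)
Lemma treap_join_above Tl k Tr : good Tl -> good Tr -> k \in S ->
  all (fun x => x < k)%O (inorder Tl) -> all (fun x => k < x)%O (inorder Tr) ->
  {in inorder Tl, forall x, p x < p k} -> {in inorder Tr, forall x, p x < p k} ->
  treap_join p Tl k Tr = tick (op (node Tl k Tr)) /\ good (node Tl k Tr).
Proof.
move=> gl gr kS al ar pl pr; rewrite treap_joinE !key_above_all //; split=> //=.
rewrite kS gl gr /= andbT; apply/andP; split; apply/allP => x xT.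
- by rewrite (allP al) // pl.
- by rewrite (allP ar) // pr.
Qed.

Lemma treap_join_right ll u kl rl k Tr (e : Defs.comp (tree unit K)) :
  good (Node ll u kl rl) -> p k <= p kl -> k \in S ->
  all (fun x => x < k)%O (inorder (Node ll u kl rl)) -> all (fun x => k < x)%O (inorder Tr) ->
  {in inorder Tr, forall x, p x < p kl} ->
  treap_join_post rl k Tr e ->
  treap_join_post (Node ll u kl rl) k Tr (tick (tick (tick (let* T := e in op (node ll kl T))))).
Proof.
case: u => g pk kS al ar pr [ge ie we].
have klk : (kl < k)%O by move: al; rewrite all_cat /= => /and3P[].
have h := @count_rec_node_r (fun x => p k <= p x) _ _ _ _ _ g klk pk.
case: e ge ie we => [T w s] /= ge ie we.
move: (g) => /= /and5P[klS al' ar' gl gr].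
split=> /=.
- rewrite klS al' gl ge ie /= andbT all_cat ar' /= klk /=; apply/andP; split.
    rewrite lt_neqAle pk andbT; apply/eqP => /(pinj kS klS) e; by rewrite e ltxx in klk.
  by apply/allP => x xr; rewrite (lt_trans klk (allP ar _ xr)) pr.
- by rewrite ie -catA.
- by move: we h; rewrite /high_recs /=; clear; lia.
Qed.

Lemma treap_join_left lr u kr rr Tl k (e : Defs.comp (tree unit K)) :
  good (Node lr u kr rr) -> p k <= p kr -> k \in S ->
  all (fun x => x < k)%O (inorder Tl) -> all (fun x => k < x)%O (inorder (Node lr u kr rr)) ->
  {in inorder Tl, forall x, p x < p kr} ->
  treap_join_post Tl k lr e ->
  treap_join_post Tl k (Node lr u kr rr) (tick (tick (tick (let* T := e in op (node T kr rr))))).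
Proof.
case: u => g pk kS al ar pr [ge ie we].
have klk : (k < kr)%O by move: ar; rewrite all_cat /= => /and3P[].
have h := @count_rec_node_l (fun x => p k <= p x) _ _ _ _ _ g klk pk.
case: e ge ie we => [T w s] /= ge ie we.
move: (g) => /= /and5P[klS al' ar' gl gr].
split=> /=.
- rewrite klS ar' gr ge ie /= all_cat /= al' klk /= !andbT; apply/andP; split.
    by apply/allP => x xr; rewrite (lt_trans (allP al _ xr) klk) pr.
  rewrite lt_neqAle pk andbT; apply/eqP => /(pinj kS klS) e; by rewrite e ltxx in klk.
- by rewrite ie -catA.
- by move: we h; rewrite /high_recs /=; clear; lia.
Qed.

(** Absorbs the comparison of the root priorities that is saved when one tree is empty. *)
Lemma treap_join_post_le Tl k Tr e e' : cval e = cval e' -> (cwork e <= cwork e')%N ->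
  treap_join_post Tl k Tr e' -> treap_join_post Tl k Tr e.
Proof. by move=> ev ew [g i w]; split; rewrite ?ev //; apply: leq_trans w. Qed.

Lemma treap_join_spec Tl k Tr : good Tl -> good Tr -> k \in S ->
  all (fun x => x < k)%O (inorder Tl) -> all (fun x => k < x)%O (inorder Tr) ->
  treap_join_post Tl k Tr (treap_join p Tl k Tr).
Proof.
move=> + + kS; elim: Tl Tr => [|ll IHll ul kl rl IHrl]; elim=> [|lr IHlr ur kr rr IHrr] gl gr al ar.
- by split; rewrite //= kS.
- have [ab|nab] := boolP (key_above p k (Node lr ur kr rr)).
    have [-> g] := @treap_join_above Leaf k _ isT gr kS isT ar (fun _ => ltac:(by [])) (key_aboveP gr ab).
    by split=> //; exact: leq_addl.
  have [_ _ _ gr' _] := good_node gr.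
  have ar' : all (fun x => k < x)%O (inorder lr) by move: ar; rewrite all_cat /= => /and3P[].
  have IH := IHlr isT gr' isT ar'.
  have := @treap_join_left _ _ _ _ Leaf _ _ gr _ kS isT ar (fun _ => ltac:(by [])) IH.
  rewrite [treap_join p _ k (Node _ _ _ _)]treap_joinE [key_above _ _ Leaf]/= (negbTE nab) leNgt => /(_ nab).
  by apply: treap_join_post_le => //=; exact: leqnSn.
- have [ab|nab] := boolP (key_above p k (Node ll ul kl rl)).
    have [-> g] := @treap_join_above _ k Leaf gl isT kS al isT (key_aboveP gl ab) (fun _ => ltac:(by [])).
    by split=> //; exact: leq_addl.
  have [_ _ _ _ gl'] := good_node gl.
  have al' : all (fun x => x < k)%O (inorder rl) by move: al; rewrite all_cat /= => /and3P[].
  have IH := IHrl Leaf gl' isT al' isT.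
  have := @treap_join_right _ _ _ _ _ Leaf _ gl _ kS al isT (fun _ => ltac:(by [])) IH.
  rewrite [treap_join p (Node _ _ _ _) k _]treap_joinE [key_above _ _ Leaf]/= andbT (negbTE nab) leNgt => /(_ nab).
  by apply: treap_join_post_le => //=; exact: leqnSn.
- set Tl := Node ll ul kl rl in gl al IHlr IHrr *; set Tr := Node lr ur kr rr in gr ar *.
  have [/andP[ab1 ab2]|nab] := boolP (key_above p k Tl && key_above p k Tr).
    have [-> g] := treap_join_above gl gr kS al ar (key_aboveP gl ab1) (key_aboveP gr ab2).
    by split=> //; exact: leq_addl.
  rewrite treap_joinE (negbTE nab) {1 2}/Tl {1 2}/Tr.
  have klT : kl \in inorder Tl by rewrite /= mem_cat inE eqxx orbT.
  have krT : kr \in inorder Tr by rewrite /= mem_cat inE eqxx orbT.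
  have klr : kl != kr.
    by apply/eqP => e; move: (allP al _ klT) (allP ar _ krT); rewrite e => /lt_trans h /h; rewrite ltxx.
  case: ifPn => hp.
    have pkl : p k <= p kl.
      move: nab; rewrite /= negb_and -!leNgt => /orP[//|h]; exact: le_trans h (ltW hp).
    have [_ _ _ _ gl'] := good_node gl.
    have al' : all (fun x => x < k)%O (inorder rl) by move: al; rewrite all_cat /= => /and3P[].
    apply: treap_join_right => //; last exact: IHrl.
    by move=> x /(good_root gr) h; exact: le_lt_trans h hp.
  have {}hp : p kl < p kr.
    rewrite lt_neqAle leNgt hp andbT; apply: contra klr => /eqP.
    by move/(pinj (good_sub gl klT) (good_sub gr krT)) => ->.
  have pkr : p k <= p kr.
    move: nab; rewrite /= negb_and -!leNgt => /orP[h|//]; exact: le_trans h (ltW hp).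
  have [_ _ _ gr' _] := good_node gr.
  have ar' : all (fun x => k < x)%O (inorder lr) by move: ar; rewrite all_cat /= => /and3P[].
  apply: treap_join_left => //; last exact: IHlr.
  by move=> x /(good_root gl) h; exact: le_lt_trans h hp.
Qed.

Lemma treap_join_span Tl k Tr : (cspan (treap_join p Tl k Tr) <= cwork (treap_join p Tl k Tr))%N.
Proof.
have seq (e : Defs.comp (tree unit K)) f : (cspan e <= cwork e)%N ->
    (cspan (let* T := e in op (f T : tree unit K)) <= cwork (let* T := e in op (f T)))%N.
  by move=> h; rewrite /= leq_add2r.
elim: Tl Tr => [|ll _ ul kl rl IHl]; elim=> [|lr IHr ur kr rr _]; rewrite treap_joinE;
  case: (key_above p k _ && key_above p k _) => //.
- exact: seq IHr.
- exact: seq (IHl Leaf).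
- case: (p kr < p kl); [exact: seq (IHl _)|exact: seq IHr].
Qed.

(** * Splitting and rejoining treaps *)

Lemma filter_nil (P : pred K) s : {in s, forall x, ~~ P x} -> [seq x <- s | P x] = [::].
Proof. by move=> h; rewrite (eq_in_filter (a2 := pred0)) ?filter_pred0 // => x /h/negbTE. Qed.

Lemma filter_lt_node l u m r v : good (Node l u m r) -> (v < m)%O ->
  [seq x <- inorder (Node l u m r) | (x < v)%O] = [seq x <- inorder l | (x < v)%O] /\
  [seq x <- inorder (Node l u m r) | (v < x)%O] = [seq x <- inorder l | (v < x)%O] ++ m :: inorder r.
Proof.
case: u => /= /and5P[_ _ ar _ _] vm; rewrite !filter_cat /= vm ltNge (ltW vm) /=.
have gtv : all (fun x => v < x)%O (inorder r).
  by apply/allP => x /(allP ar)/andP[mx _]; exact: lt_trans mx.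
rewrite (all_filterP gtv); split=> //.
by rewrite [X in _ ++ X]filter_nil ?cats0 // => x /(allP gtv) vx; rewrite -leNgt ltW.
Qed.

Lemma filter_gt_node l u m r v : good (Node l u m r) -> (m < v)%O ->
  [seq x <- inorder (Node l u m r) | (x < v)%O] = inorder l ++ m :: [seq x <- inorder r | (x < v)%O] /\
  [seq x <- inorder (Node l u m r) | (v < x)%O] = [seq x <- inorder r | (v < x)%O].
Proof.
case: u => /= /and5P[_ al _ _ _] vm; rewrite !filter_cat /= vm ltNge (ltW vm) /=.
have gtv : all (fun x => x < v)%O (inorder l).
  by apply/allP => x /(allP al)/andP[mx _]; exact: lt_trans vm.
rewrite (all_filterP gtv); split=> //.
by rewrite [X in X ++ _]filter_nil // => x /(allP gtv) vx; rewrite -leNgt ltW.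
Qed.

Lemma filter_eq_node l u v r : good (Node l u v r) ->
  [seq x <- inorder (Node l u v r) | (x < v)%O] = inorder l /\
  [seq x <- inorder (Node l u v r) | (v < x)%O] = inorder r.
Proof.
case: u => /= /and5P[_ al ar _ _]; rewrite !filter_cat /= ltxx.
have allt : all (fun x => x < v)%O (inorder l) by apply: sub_all al => x /andP[].
have argt : all (fun x => v < x)%O (inorder r) by apply: sub_all ar => x /andP[].
rewrite (all_filterP allt) (all_filterP argt); split.
- by rewrite [X in _ ++ X]filter_nil ?cats0 // => x /(allP argt) h; rewrite -leNgt ltW.
- by rewrite [X in X ++ _]filter_nil // => x /(allP allt) h; rewrite -leNgt ltW.
Qed.

Lemma recs_gt0 T v : good T -> ~~ is_leaf T -> (0 < recs (inorder T) v)%N.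
Proof.
case: T => [//|l u m r] g _; rewrite -has_count; apply/hasP; exists m; last exact: recs_root.
by rewrite /= mem_cat inE eqxx orbT.
Qed.

(** Each key on the search path costs three steps of the split and two of a join that is a single
    node. *)
Lemma tsplit_good T v : good T ->
  let s := tsplit tjoin T v in
  [/\ good (cval s).1.1, good (cval s).2,
      inorder (cval s).1.1 = [seq x <- inorder T | (x < v)%O] &
      inorder (cval s).2 = [seq x <- inorder T | (v < x)%O]] /\
  (cval s).1.2 = (v \in inorder T) /\
  (cwork s <= 5 * recs (inorder T) v + 1)%N.
Proof.
elim: T => [//|l IHl u m r IHr] g.
have n0 : (0 < recs (inorder (Node l u m r)) v)%N by exact: recs_gt0.
have [mS al ar gl gr] := good_node g.
rewrite [tsplit _ _ _]/=; case: (ltgtP v m) => vm /=.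
- have := IHl gl; case: (tsplit tjoin l v) => [[[A b] Q] w s] /= [[gA gQ iA iQ] [-> wk]].
  have [-> ->] := filter_lt_node g vm.
  have [->] : treap_join p Q m r = tick (op (node Q m r)) /\ good (node Q m r).
    apply: treap_join_above => //; try (by apply/allP => x; rewrite iQ mem_filter => /andP[_ /(allP al)/andP[]]).
    + by apply/allP => x /(allP ar)/andP[].
    + by move=> x; rewrite iQ mem_filter => /andP[_ /(allP al)/andP[]].
    + by move=> x /(allP ar)/andP[].
  move=> gn; split; first by split=> //=; rewrite iQ.
  split; last by have := recs_node_lt g vm; move: wk; clear => /=; lia.
  rewrite mem_cat inE [v == m]lt_eqF //=; case vr: (v \in inorder r); last by rewrite orbF.
  by move: (allP ar _ vr) => /andP[mv _]; move: (lt_trans vm mv); rewrite ltxx.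
- have := IHr gr; case: (tsplit tjoin r v) => [[[A b] Q] w s] /= [[gA gQ iA iQ] [-> wk]].
  have [-> ->] := filter_gt_node g vm.
  have [->] : treap_join p l m A = tick (op (node l m A)) /\ good (node l m A).
    apply: treap_join_above => //.
    + by apply/allP => x /(allP al)/andP[].
    + by apply/allP => x; rewrite iA mem_filter => /andP[_ /(allP ar)/andP[]].
    + by move=> x /(allP al)/andP[].
    + by move=> x; rewrite iA mem_filter => /andP[_ /(allP ar)/andP[]].
  move=> gn; split; first by split=> //=; rewrite iA.
  split; last by have := recs_node_gt g vm; move: wk; clear => /=; lia.
  rewrite mem_cat inE [v == m]gt_eqF //=; case vl: (v \in inorder l) => //.
  by move: (allP al _ vl) => /andP[mv _]; move: (lt_trans vm mv); rewrite ltxx.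
- subst m; have [-> ->] := filter_eq_node g.
  split; first by split.
  by split; [rewrite mem_cat inE eqxx orbT|move: n0; clear => /=; lia].
Qed.

Lemma split_last_good l u k r v : good (Node l u k r) ->
  all (fun x => x < v)%O (inorder (Node l u k r)) ->
  let s := split_last tjoin l k r in
  [/\ good (cval s).1, rcons (inorder (cval s).1) (cval s).2 = inorder (Node l u k r) &
      (cwork s <= 4 * recs (inorder (Node l u k r)) v)%N].
Proof.
elim: r l u k => [|r1 _ ur kr r2 IH] l [] k g av.
  have n0 : (0 < recs (inorder (Node l tt k Leaf)) v)%N by exact: recs_gt0.
  have gl : good l by case/and5P: g.
  by split=> //=; [rewrite cats1|move: n0; clear => /=; lia].
have kv : (k < v)%O by move: av; rewrite all_cat /= => /and3P[].
have avr : all (fun x => x < v)%O (inorder (Node r1 ur kr r2)).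
  by move: av; rewrite all_cat /= => /and3P[].
move: (g) => /= /and5P[kS al ar gl gr].
have := IH r1 ur kr gr avr; have := recs_node_gt g kv.
rewrite /=; case: (split_last tjoin r1 kr r2) => [[T' k'] w s].
move=> /= lt [gT iT wk].
have subr x : x \in inorder T' -> (k < x)%O && (p x < p k).
  by move=> xT; apply: (allP ar); rewrite -iT mem_rcons inE xT orbT.
have [->] : treap_join p l k T' = tick (op (node l k T')) /\ good (node l k T').
  apply: treap_join_above => //.
  + by apply/allP => x /(allP al)/andP[].
  + by apply/allP => x /subr/andP[].
  + by move=> x /(allP al)/andP[].
  + by move=> x /subr/andP[].
move=> gn; split=> //=; first by rewrite rcons_cat rcons_cons iT.
by move: lt wk; clear; lia.
Qed.

(** join2 joins at the last key [k] of the left tree, while its cost is charged to the key [v] that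
    separates the trees. A key passed by the join beats [k] and the keys of [s] beyond it, so it is
    on the search path of [v] as well. *)
Lemma recs_high_left s v k : all (fun x => x < k)%O s -> (k < v)%O -> uniq s ->
  (high_recs s k <= recs (rcons s k) v)%N.
Proof.
move=> sk kv us; apply: count_sub => // x xs /andP[rx px].
rewrite mem_rcons inE xs orbT /=; apply/allP => z.
rewrite mem_rcons inE => /orP[/eqP->|zs]; first by rewrite px implybT.
have xk := allP sk _ xs; have zk := allP sk _ zs.
apply/implyP => /andP[_ bz]; have := allP rx _ zs; rewrite (lt_eqF zk) /= => /implyP; apply.
have /orP[/andP[xz _]|/andP[vz _]] := bz; first by rewrite /btw xz ltW.
by move: (lt_trans (lt_le_trans kv vz) zk); rewrite ltxx.
Qed.

Lemma recs_high_right s v k : all (fun x => v < x)%O s -> (k < v)%O -> uniq s ->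
  (high_recs s k <= recs s v)%N.
Proof.
move=> sk kv us; apply: count_sub => // x xs /andP[rx px].
rewrite xs /=; apply/allP => z zs; have xv := allP sk _ xs; have zv := allP sk _ zs.
have kz := lt_trans kv zv.
apply/implyP => /andP[_ bz]; have := allP rx _ zs; rewrite (gt_eqF kz) /= => /implyP; apply.
have /orP[/andP[_ zv']|/andP[_ zx]] := bz; first by move: (lt_le_trans zv zv'); rewrite ltxx.
by rewrite /btw (ltW kz) zx orbT.
Qed.

Lemma tjoin2_good Tl Tr v : good Tl -> good Tr ->
  all (fun x => x < v)%O (inorder Tl) -> all (fun x => v < x)%O (inorder Tr) ->
  let e := tjoin2 tjoin Tl Tr in
  [/\ good (cval e), inorder (cval e) = inorder Tl ++ inorder Tr &
      (cwork e <= 8 * (recs (inorder Tl) v + recs (inorder Tr) v) + 3)%N].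
Proof.
case: Tl => [|l u k r] gl gr al ar; first by split=> //; apply: leq_trans (leq_addl _ 3).
have := split_last_good gl al; rewrite /tjoin2 /=.
case: (split_last tjoin l k r) => [[T' k'] w s] /= [gT iT wk].
have := good_sorted gl; rewrite /= -iT; have tr : transitive (<%O : rel K) by exact: lt_trans.
rewrite sorted_pairwise // pairwise_rcons -sorted_pairwise // => /andP[ak' sT].
have k'T : k' \in inorder (Node l u k r) by rewrite /= -iT mem_rcons inE eqxx.
have k'S := good_sub gl k'T; have k'v := allP al _ k'T.
have ar' : all (fun x => k' < x)%O (inorder Tr).
  by apply/allP => x /(allP ar); exact: lt_trans.
have [gj ij wj] := treap_join_spec gT gr k'S ak' ar'.
have := recs_high_left ak' k'v (good_uniq gT); have := recs_high_right ar k'v (good_uniq gr).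
move=> h1 h2; split=> //; first by rewrite ij cat_rcons.
by move: wk wj h1 h2; rewrite -iT; clear; lia.
Qed.

(* The keys of the subtrees joined by join2, in terms of which its cost is bounded. *)
Definition third (o : set_op) s1 s2 : seq K :=
  match o with
  | Union => [::]
  | Intersect => [seq x <- s1 | x \in s2]
  | Difference => [seq x <- s1 | x \notin s2]
  end.

Definition op_mem (o : set_op) (b1 b2 : bool) : bool :=
  match o with Union => b1 || b2 | Intersect => b1 && b2 | Difference => b1 && ~~ b2 end.

Lemma filter_third o s1 sL sR k2 :
  all (fun x => x < k2)%O sL -> all (fun x => k2 < x)%O sR ->
  third o [seq x <- s1 | (x < k2)%O] sL = [seq x <- third o s1 (sL ++ k2 :: sR) | (x < k2)%O] /\
  third o [seq x <- s1 | (k2 < x)%O] sR = [seq x <- third o s1 (sL ++ k2 :: sR) | (k2 < x)%O].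
Proof.
move=> aL aR.
have mL x : (x < k2)%O -> (x \in sL ++ k2 :: sR) = (x \in sL).
  move=> xk; rewrite mem_cat inE (lt_eqF xk) /=; case: (x \in sL) => //=.
  by apply/negP => /(allP aR) kx; move: (lt_trans kx xk); rewrite ltxx.
have mR x : (k2 < x)%O -> (x \in sL ++ k2 :: sR) = (x \in sR).
  move=> xk; rewrite mem_cat inE (gt_eqF xk) /=; case xL: (x \in sL) => //=.
  by move: (lt_trans xk (allP aL _ xL)); rewrite ltxx.
case: o => //=; split; rewrite -!filter_predI; apply: eq_filter => x /=.
- by case: ltP => [/mL->|] //=; rewrite ?andbT ?andbF.
- by case: ltP => [/mR->|] //=; rewrite ?andbT ?andbF.
- by case: ltP => [/mL->|] //=; rewrite ?andbT ?andbF.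
- by case: ltP => [/mR->|] //=; rewrite ?andbT ?andbF.
Qed.

Definition op_keeps (o : set_op) (b : bool) : bool :=
  match o with Union => true | Intersect => b | Difference => false end.

Lemma treap_comb_good o b Tl k Tr : good Tl -> good Tr -> k \in S ->
  all (fun x => x < k)%O (inorder Tl) -> all (fun x => k < x)%O (inorder Tr) ->
  let e := op_comb o tjoin b Tl k Tr in
  [/\ good (cval e),
      inorder (cval e) = inorder Tl ++ [seq x <- [:: k] | op_keeps o b] ++ inorder Tr &
      (cwork e <= if o is Union then 4 * (high_recs (inorder Tl) k + high_recs (inorder Tr) k) + 2
                  else 8 * (recs (inorder Tl) k + recs (inorder Tr) k) + 4)%N].
Proof.
move=> gl gr kS al ar.
have [gj ij wj] := treap_join_spec gl gr kS al ar.
have [g2 i2 w2] := tjoin2_good gl gr al ar.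
have high_le s : (high_recs s k <= recs s k)%N by apply: sub_count => x /andP[].
have hl := high_le (inorder Tl); have hr := high_le (inorder Tr).
case: o; rewrite /op_comb; first by split.
- rewrite (@cwork_tick _ (if _ then _ else _)) (@cval_tick _ (if _ then _ else _)).
  case: b; last by split=> //; move: w2; clear; lia.
  by split=> //; move: wj hl hr; clear; lia.
- by split=> //; move: w2; clear; lia.
Qed.

(** In a union, keys of priority at least that of [k2] come from [T1], because [k2] beats the rest
    of its subtree in the second treap; the join is thus charged to the search path of [k2] in [T1].
    For the other operations, [Ul] and [Ur] consist of keys of [third]. The factor [21] is [5] for
    the split, [4] for a join and [12] for the constants, as [recs] is positive. *)
Lemma treap_op_step o T1 L2 u k2 R2 :
  good T1 -> good (Node L2 u k2 R2) -> ~~ is_leaf T1 ->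
  let s := tsplit tjoin T1 k2 in
  let Ul := cval (run_op o tjoin (cval s).1.1 L2) in
  let Ur := cval (run_op o tjoin (cval s).2 R2) in
  let j := op_comb o tjoin (cval s).1.2 Ul k2 Ur in
  good Ul -> (forall x, (x \in inorder Ul) = op_mem o (x \in inorder (cval s).1.1) (x \in inorder L2)) ->
  good Ur -> (forall x, (x \in inorder Ur) = op_mem o (x \in inorder (cval s).2) (x \in inorder R2)) ->
  [/\ good (cval j),
      forall x, (x \in inorder (cval j)) = op_mem o (x \in inorder T1) (x \in inorder (Node L2 u k2 R2)) &
      (cwork s + cwork j + 7 <=
        21 * recs (inorder T1) k2 + 8 * recs (third o (inorder T1) (inorder (Node L2 u k2 R2))) k2)%N].
Proof.
case: u => g1 g2 nl1 s; have [[gs1 gs2 is1 is2] [bs ws]] := tsplit_good k2 g1.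
rewrite -/s in gs1 gs2 is1 is2 bs ws *.
move: (s) gs1 gs2 is1 is2 bs ws => {}s gs1 gs2 is1 is2 bs ws.
set Ul := cval (run_op _ _ _ L2); set Ur := cval (run_op _ _ _ R2).
move=> j; rewrite {}/j => gl ml gr mr.
case/and5P: (g2) => k2S al2 ar2 gl2 gr2.
have memL x : (x \in inorder Ul) = (x < k2)%O && op_mem o (x \in inorder T1) (x \in inorder L2).
  rewrite ml is1 mem_filter; case: ltP => //= xk.
  have -> : (x \in inorder L2) = false.
    by apply/negP => /(allP al2)/andP[+ _]; rewrite ltNge xk.
  by case: (o).
have memR x : (x \in inorder Ur) = (k2 < x)%O && op_mem o (x \in inorder T1) (x \in inorder R2).
  rewrite mr is2 mem_filter; case: ltP => //= xk.
  have -> : (x \in inorder R2) = false.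
    by apply/negP => /(allP ar2)/andP[+ _]; rewrite ltNge xk.
  by case: (o).
have mem2L x : (x < k2)%O -> (x \in inorder (Node L2 tt k2 R2)) = (x \in inorder L2).
  move=> xk; rewrite /= mem_cat inE (lt_eqF xk) /=; case: (x \in inorder L2) => //=.
  by apply/negP => /(allP ar2)/andP[kx _]; move: (lt_trans kx xk); rewrite ltxx.
have mem2R x : (k2 < x)%O -> (x \in inorder (Node L2 tt k2 R2)) = (x \in inorder R2).
  move=> xk; rewrite /= mem_cat inE (gt_eqF xk) /=; case xL: (x \in inorder L2) => //=.
  by move: (allP al2 _ xL) => /andP[h _]; move: (lt_trans xk h); rewrite ltxx.
have mem2k : k2 \in inorder (Node L2 tt k2 R2) by rewrite /= mem_cat inE eqxx orbT.
set T2 := Node L2 tt k2 R2 in g2 mem2L mem2R mem2k *; clearbody T2.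
have aUl : all (fun x => x < k2)%O (inorder Ul) by apply/allP => x; rewrite memL => /andP[].
have aUr : all (fun x => k2 < x)%O (inorder Ur) by apply/allP => x; rewrite memR => /andP[].
have [gj ij wj] := treap_comb_good o (cval s).1.2 gl gr k2S aUl aUr.
split=> //.
  move=> x; rewrite ij !mem_cat mem_filter inE memL memR bs.
  case: (ltgtP x k2) => xk /=.
  - by rewrite mem2L // andbF !orbF.
  - by rewrite mem2R // andbF.
  - by rewrite xk mem2k !andbT orbF; case: (o) => //=; rewrite ?orbT ?andbT ?andbF.
have dis x : x \in inorder Ul -> x \notin inorder Ur.
  by rewrite memL memR => /andP[xk _]; rewrite ltNge (ltW xk).
have uUl := good_uniq gl; have uUr := good_uniq gr.
have r1 := recs_gt0 k2 g1 nl1.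
suff : (cwork (op_comb o tjoin (cval s).1.2 Ul k2 Ur) <=
    4 * recs (inorder T1) k2 + 8 * recs (third o (inorder T1) (inorder T2)) k2 + 4)%N.
  by move: ws r1; clear; lia.
have btwl x z : (x < k2)%O -> z != k2 -> btw x k2 z -> (z < k2)%O.
  move=> xk zk /orP[/andP[_ zk']|/andP[kz zx]]; first by rewrite lt_neqAle zk.
  by move: (le_lt_trans (le_trans kz zx) xk); rewrite ltxx.
have btwr x z : (k2 < x)%O -> z != k2 -> btw x k2 z -> (k2 < z)%O.
  move=> xk zk /orP[/andP[xz zk']|/andP[kz zx]]; last by rewrite lt_neqAle eq_sym zk.
  by move: (lt_le_trans xk (le_trans xz zk')); rewrite ltxx.
apply: leq_trans wj _; case: o @Ul @Ur ml mr memL memR {gl gr gj ij} aUl aUr dis uUl uUr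
  => Ul Ur ml mr memL memR aUl aUr dis uUl uUr.
{ suff : (high_recs (inorder Ul) k2 + high_recs (inorder Ur) k2 <= recs (inorder T1) k2)%N.
    by clear; lia.
  apply: count_disjoint => // x xU /andP[rx px].
  + move: (xU); rewrite memL /= => /andP[xk /orP[x1|x2]]; last first.
      by move: (allP al2 _ x2) => /andP[_]; rewrite ltNge px.
    rewrite x1 /=; apply: rec_sub rx => z z1 zk /(btwl _ _ xk zk) zk'.
    by rewrite memL zk' /= z1.
  + move: (xU); rewrite memR /= => /andP[xk /orP[x1|x2]]; last first.
      by move: (allP ar2 _ x2) => /andP[_]; rewrite ltNge px.
    rewrite x1 /=; apply: rec_sub rx => z z1 zk /(btwr _ _ xk zk) zk'.
    by rewrite memR zk' /= z1.
}
all: rewrite leq_add2r; apply: leq_trans (leq_addl _ _); rewrite leq_mul2l.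
all: apply: count_disjoint => // x xU rx; move: (xU); rewrite ?memL ?memR /= => /andP[xk /andP[x1 x2]].
all: rewrite mem_filter x1 /=; first [rewrite (mem2L _ xk) | rewrite (mem2R _ xk)].
all: rewrite x2; apply: rec_sub rx => z; rewrite mem_filter => /andP[z2 z1] zk bz.
all: first [have zk' := btwl _ _ xk zk bz; by rewrite memL zk' /= z1 -mem2L
          | have zk' := btwr _ _ xk zk bz; by rewrite memR zk' /= z1 -mem2R].
Qed.

Lemma run_op_leaf o T1 T2 : is_leaf T1 || is_leaf T2 ->
  let e := run_op o tjoin T1 T2 in
  [/\ (cwork e <= 2)%N, (cspan e <= 2)%N, good T1 -> good T2 -> good (cval e) &
      forall x, (x \in inorder (cval e)) = op_mem o (x \in inorder T1) (x \in inorder T2)].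
Proof.
rewrite run_opE; case: T2 => [|L2 u k2 R2]; case: T1 => [|l1 u1 k1 r1] //= _; case: o => /=;
  split=> // x; rewrite ?in_nil ?orbF ?andbF ?andbT //.
Qed.

Lemma treap_op_good o T1 T2 : good T1 -> good T2 ->
  let U := cval (run_op o tjoin T1 T2) in
  good U /\ forall x, (x \in inorder U) = op_mem o (x \in inorder T1) (x \in inorder T2).
Proof.
elim: T2 T1 => [|L2 IHL u k2 R2 IHR] T1 g1 g2.
  by have [_ _ g m] := @run_op_leaf o T1 Leaf (orbT _); split; [exact: g|].
have [l1|nl1] := boolP (is_leaf T1).
  by have [_ _ g m] := @run_op_leaf o T1 (Node L2 u k2 R2) ltac:(by rewrite l1); split; [exact: g|].
have [[gs1 gs2 _ _] _] := tsplit_good k2 g1.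
have [_ _ _ gL gR] := good_node g2.
have [gl ml] := IHL _ gs1 gL; have [gr mr] := IHR _ gs2 gR.
have [gj mj _] := treap_op_step g1 g2 nl1 gl ml gr mr.
have [ev _ _] := set_rec_nodeE tjoin (@op_base1 o unit K) (@op_base2 o unit K)
  (op_comb o tjoin) L2 u k2 R2 nl1.
by move: ev; rewrite -!run_opE => ->.
Qed.

(* For the treap with keys [s2] and the tree with keys [s]: the split at [v] meets [x]. *)
Definition ev s2 s v x : bool := all (fun z => btw x v z ==> (p z <= p v)) s2 && rec s v x.

Definition npairs s2 s : nat := (\sum_(v <- s2) count (ev s2 s v) s)%N.

(** The key [k] has the highest priority in its subtree, so every key on its search path forms a
    pair with it. If [v] and its partner lie on one side of [k], so do all keys between them, and
    the pair persists in the whole tree. *)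
Lemma npairs_node sL k sR s :
  all (fun x => (x < k)%O && (p x < p k)) sL -> all (fun x => (k < x)%O && (p x < p k)) sR ->
  (npairs sL [seq x <- s | (x < k)%O] + recs s k + npairs sR [seq x <- s | (k < x)%O]
   <= npairs (sL ++ k :: sR) s)%N.
Proof.
move=> aL aR; rewrite /npairs big_cat big_cons /= addnA.
apply: leq_add; first apply: leq_add.
2: { apply: sub_count => x rx; rewrite /ev rx andbT; apply/allP => z.
  rewrite mem_cat inE => /or3P[/(allP aL)/andP[_ /ltW ->]|/eqP->|/(allP aR)/andP[_ /ltW ->]];
    by rewrite ?lexx implybT. }
all: rewrite big_seq [leqRHS]big_seq; apply: leq_sum => v vS.
all: first [have /andP[vk _] := allP aL _ vS | have /andP[vk _] := allP aR _ vS].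
all: rewrite count_filter; apply: sub_count => x /= /andP[/andP[/allP e1 r1] xk].
all: first [have bk z := @btw_lt x v z k xk vk | have bk z := @btw_gt x v z k xk vk].
all: apply/andP; split; last by apply: rec_sub r1 => z zs _ /bk zk; rewrite mem_filter zk.
all: apply/allP => z; rewrite mem_cat inE => zs; apply/implyP => bz; have zk := bk z bz.
all: case/or3P: zs => [zs|/eqP ze|zs]; try by rewrite ze ltxx in zk.
all: first [by have := e1 _ zs; rewrite bz | have /andP[kz _] := allP aR _ zs
  | have /andP[kz _] := allP aL _ zs]; by move: (lt_trans kz zk); rewrite ltxx.
Qed.

Lemma recs_filter_lt s v k : (v < k)%O -> (recs [seq x <- s | (x < k)%O] v <= recs s v)%N.
Proof.
move=> vk; rewrite /recs count_filter; apply: sub_count => x /= /andP[r xk].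
by apply: rec_sub r => z zs _ /(btw_lt xk vk) zk; rewrite mem_filter zk.
Qed.

Lemma recs_filter_gt s v k : (k < v)%O -> (recs [seq x <- s | (k < x)%O] v <= recs s v)%N.
Proof.
move=> vk; rewrite /recs count_filter; apply: sub_count => x /= /andP[r xk].
by apply: rec_sub r => z zs _ /(btw_gt xk vk) zk; rewrite mem_filter zk.
Qed.

(** All ancestors of a deepest node are on its search path. *)
Lemma height_le_recs T M : good T -> (forall v, v \in inorder T -> (recs (inorder T) v <= M)%N) ->
  (height T <= M)%N.
Proof.
elim: T M => [//|l IHl u k r IHr] M g h.
have [_ al ar gl gr] := good_node g.
case: M h => [|M] h.
  have := recs_gt0 k g isT; have := h k; rewrite /= mem_cat inE eqxx orbT => /(_ isT).
  by rewrite leqn0 => /eqP ->.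
rewrite /= ltnS geq_max IHl ?IHr // => v vT; rewrite -ltnS.
- apply: leq_trans (recs_node_gt g _) (h v _); last by rewrite /= mem_cat inE vT !orbT.
  by have /andP[] := allP ar _ vT.
- apply: leq_trans (recs_node_lt g _) (h v _); last by rewrite /= mem_cat vT.
  by have /andP[] := allP al _ vT.
Qed.

Lemma treap_op_cost o T1 T2 : good T1 -> good T2 ->
  let e := run_op o tjoin T1 T2 in
  let s3 := third o (inorder T1) (inorder T2) in
  (cwork e <= 21 * npairs (inorder T2) (inorder T1) + 8 * npairs (inorder T2) s3 + 2)%N /\
  forall M1 M3, (forall v, v \in inorder T2 -> (recs (inorder T1) v <= M1)%N) ->
    (forall v, v \in inorder T2 -> (recs s3 v <= M3)%N) ->
    (cspan e <= height T2 * (21 * M1 + 8 * M3) + 2)%N.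
Proof.
elim: T2 T1 => [|L2 IHL u k2 R2 IHR] T1 g1 g2.
  have [w s _ _] := @run_op_leaf o T1 Leaf (orbT _).
  by split=> [|M1 M3 _ _]; [exact: leq_trans w (leq_addl _ _)|exact: leq_trans s (leq_addl _ _)].
have [l1|nl1] := boolP (is_leaf T1).
  have [w s _ _] := @run_op_leaf o T1 (Node L2 u k2 R2) ltac:(by rewrite l1).
  by split=> [|M1 M3 _ _]; [exact: leq_trans w (leq_addl _ _)|exact: leq_trans s (leq_addl _ _)].
have [[gs1 gs2 is1 is2] _] := tsplit_good k2 g1.
have [_ al ar gL gR] := good_node g2.
have [gl ml] := treap_op_good o gs1 gL; have [gr mr] := treap_op_good o gs2 gR.
have [_ _ loc] := treap_op_step g1 g2 nl1 gl ml gr mr.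
have [_ ew es] := set_rec_nodeE tjoin (@op_base1 o unit K) (@op_base2 o unit K)
  (op_comb o tjoin) L2 u k2 R2 nl1.
have ss := tsplit_span treap_join_span T1 k2.
have sj := op_comb_span treap_join_span o.
move: ew es; rewrite -!run_opE => ew es.
move: (IHL _ gs1 gL) (IHR _ gs2 gR) => /= [wL sL] [wR sR].
have aL' : all (fun x => x < k2)%O (inorder L2) by apply: sub_all al => x /andP[].
have aR' : all (fun x => k2 < x)%O (inorder R2) by apply: sub_all ar => x /andP[].
have [tL tR] := filter_third o (inorder T1) aL' aR'.
rewrite is1 tL in wL sL; rewrite is2 tR in wR sR.
rewrite /= ew es; set j := op_comb _ _ _ _ _ _ in loc *.
have {}sj : (cspan j <= cwork j)%N by exact: sj.
move: loc; set s := tsplit _ _ _ in ss wL sL wR sR *; rewrite /= => loc.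
split.
  have := npairs_node (inorder T1) al ar.
  have := npairs_node (third o (inorder T1) (inorder L2 ++ k2 :: inorder R2)) al ar.
  by move: wL wR loc; clear; lia.
move=> M1 M3 h1 h3.
have in2 : k2 \in inorder L2 ++ k2 :: inorder R2 by rewrite mem_cat inE eqxx orbT.
have {}sL := sL M1 M3 _ _; have {}sR := sR M1 M3 _ _.
have c1 := h1 _ in2; have c3 := h3 _ in2.
have : (cspan (run_op o tjoin (cval s).1.1 L2) <= height L2 * (21 * M1 + 8 * M3) + 2)%N.
  apply: sL => v vL; have vk := allP aL' _ vL.
  - by apply: leq_trans (recs_filter_lt _ vk) (h1 _ _); rewrite mem_cat vL.
  - by apply: leq_trans (recs_filter_lt _ vk) (h3 _ _); rewrite mem_cat vL.
have : (cspan (run_op o tjoin (cval s).2 R2) <= height R2 * (21 * M1 + 8 * M3) + 2)%N.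
  apply: sR => v vR; have vk := allP aR' _ vR.
  - by apply: leq_trans (recs_filter_gt _ vk) (h1 _ _); rewrite mem_cat inE vR !orbT.
  - by apply: leq_trans (recs_filter_gt _ vk) (h3 _ _); rewrite mem_cat inE vR !orbT.
have hL := leq_mul2r (21 * M1 + 8 * M3) (height L2) (maxn (height L2) (height R2)).
have hR := leq_mul2r (21 * M1 + 8 * M3) (height R2) (maxn (height L2) (height R2)).
rewrite leq_maxl orbT in hL; rewrite leq_maxr orbT in hR.
rewrite (mulSn (maxn _ _)); move: (height L2 * _)%N (height R2 * _)%N (maxn (height L2) (height R2) * _)%N hL hR => a b c hL hR.
by move: hL hR loc c1 c3 ss sj; clear; lia.
Qed.

End TreapRun.

(** * Averages over the orders of the priorities *)

Section PermAverage.
Context {R : realType} {K : eqType}.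
Implicit Types (s l : seq K) (g : seq K -> R) (x y v : K).

Definition perm_avg s g : R := (\sum_(l <- permutations s) g l) / (size s)`!%:R.

Lemma perm_avg_le s g h : {in permutations s, forall l, g l <= h l} ->
  perm_avg s g <= perm_avg s h.
Proof.
move=> gh; rewrite /perm_avg ler_pM2r ?invr_gt0 ?ltr0n ?fact_gt0 //.
by rewrite big_seq [leRHS]big_seq; apply: ler_sum => l /gh.
Qed.

Lemma eq_perm_avg s g h : {in permutations s, g =1 h} -> perm_avg s g = perm_avg s h.
Proof. by move=> gh; apply/eqP; rewrite eq_le !perm_avg_le // => l /gh ->. Qed.

Lemma perm_avgD s g h : perm_avg s (fun l => g l + h l) = perm_avg s g + perm_avg s h.
Proof. by rewrite /perm_avg big_split mulrDl. Qed.

Lemma perm_avgZ s a g : perm_avg s (fun l => a * g l) = a * perm_avg s g.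
Proof. by rewrite /perm_avg -mulr_sumr mulrA. Qed.

Lemma perm_avg_sum (I : Type) (r : seq I) s (F : I -> seq K -> R) :
  perm_avg s (fun l => \sum_(i <- r) F i l) = \sum_(i <- r) perm_avg s (F i).
Proof. by rewrite /perm_avg exchange_big /= mulr_suml. Qed.

Lemma perm_avg_cst s a : uniq s -> perm_avg s (fun=> a) = a.
Proof.
move=> us; rewrite /perm_avg big_const_seq count_predT size_permutations // iter_addr addr0.
by rewrite -[a *+ _]mulr_natr mulfK // pnatr_eq0 -lt0n fact_gt0.
Qed.

Lemma perm_avg_nil g : perm_avg [::] g = g [::].
Proof. by rewrite /perm_avg /permutations /= big_seq1 fact0 divr1. Qed.

(** Conditioning on the first element, on which the inductions for averages rest. *)
Lemma perm_avg_cons s g : uniq s -> (0 < size s)%N ->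
  perm_avg s g = (\sum_(x <- s) perm_avg (rem x s) (fun l => g (x :: l))) / (size s)%:R.
Proof.
move=> us s0; rewrite /perm_avg (perm_big _ (permutationsE s0)) /= big_allpairs_dep /=.
rewrite undup_id //; case sE: (size s) s0 => [//|n] _.
rewrite factS natrM invfM mulrA mulrAC; congr (_ / _).
rewrite mulr_suml; apply: eq_big_seq => x xs.
by rewrite size_rem // sE.
Qed.

Lemma count_rem x s (A : pred K) : x \in s -> count A s = (A x + count A (rem x s))%N.
Proof. by move=> xs; have /permP -> := perm_to_rem xs. Qed.

Lemma rem_filter_in x s (A : pred K) : uniq s -> A x -> rem x [seq y <- s | A y] = [seq y <- rem x s | A y].
Proof.
move=> us Ax; rewrite !rem_filter ?filter_uniq // -!filter_predI.
by apply: eq_filter => y /=; rewrite andbC.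
Qed.

(** Restricting a random order to a subset gives a random order of the subset. A first element
    outside [A] is dropped, and by induction the rest already has the claimed average; those inside
    reproduce the recursion of the subset. *)
Lemma perm_avg_filter (A : pred K) s g : uniq s ->
  perm_avg s (fun l => g [seq y <- l | A y]) = perm_avg [seq y <- s | A y] g.
Proof.
move: g; have [n] := ubnP (size s); elim: n s => // n IH s sn g us.
case s0: (size s) => [|m].
  by move/size0nil: s0 => ->; rewrite !perm_avg_nil.
have [f0|f0] := posnP (size [seq y <- s | A y]).
  have hA : {in permutations s, forall l, [seq y <- l | A y] = [::]}.
    move=> l; rewrite mem_permutations => /permP pe; apply: size0nil.
    by rewrite size_filter pe -size_filter.
  rewrite (@eq_perm_avg _ _ (fun=> g [::])); last by move=> l /hA ->.
  by rewrite perm_avg_cst // (size0nil f0) perm_avg_nil.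
rewrite perm_avg_cons ?s0 // (perm_avg_cons _ (filter_uniq _ us) f0).
have pos : (m.+1)%:R != 0 :> R by rewrite pnatr_eq0.
have posf : (size [seq y <- s | A y])%:R != 0 :> R by rewrite pnatr_eq0 -lt0n.
set F := perm_avg [seq y <- s | A y] g.
have termE x : x \in s -> perm_avg (rem x s) (fun l => g [seq y <- x :: l | A y]) =
    if A x then perm_avg (rem x [seq y <- s | A y]) (fun l => g (x :: l)) else F.
  move=> xs; have sr : (size (rem x s) < n)%N by rewrite size_rem // s0 /=; move: sn; rewrite s0; lia.
  rewrite /=; case: ifP => Ax.
    by rewrite (IH _ sr (fun l => g (x :: l)) (rem_uniq _ us)) rem_filter_in.
  rewrite (IH _ sr g (rem_uniq _ us)) /F; congr perm_avg.
  rewrite rem_filter // -filter_predI; apply: eq_filter => y /=.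
  by case: eqP => [->|_]; rewrite ?Ax ?andbT.
rewrite (eq_big_seq _ termE).
rewrite (bigID A) /= -[X in X + _]big_filter.
have -> : \sum_(i <- [seq y <- s | A y]) (if A i then perm_avg (rem i [seq y <- s | A y]) (fun l => g (i :: l)) else F)
    = F * (size [seq y <- s | A y])%:R.
  rewrite /F (perm_avg_cons _ (filter_uniq _ us) f0) divfK //.
  by apply: eq_big_seq => i; rewrite mem_filter => /andP[->].
have -> : \sum_(i <- s | ~~ A i) (if A i then perm_avg (rem i [seq y <- s | A y]) (fun l => g (i :: l)) else F)
    = F * (count (predC A) s)%:R.
  rewrite (eq_bigr (fun=> F)); last by move=> i /negbTE ->.
  by rewrite big_const_seq iter_addr addr0 mulr_natr.
rewrite -mulrDr -natrD size_filter count_predC s0 mulfK //.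
by rewrite /F (perm_avg_cons _ (filter_uniq _ us) f0) size_filter.
Qed.

(** * First elements of subsets in a random order *)

Definition firstin (A : pred K) v l : bool := ohead [seq z <- l | A z] == Some v.

Lemma firstin_cons A v y l : firstin A v (y :: l) = if A y then y == v else firstin A v l.
Proof. by rewrite /firstin /=; case: ifP. Qed.

Lemma firstin_le1 (s : seq K) (P : seq K -> bool) : uniq s -> perm_avg s (fun l => (P l)%:R) <= 1.
Proof.
move=> us; rewrite -[leRHS](perm_avg_cst 1 us); apply: perm_avg_le => l _.
by case: (P l).
Qed.

Lemma sum_eq1 s v (a : R) : uniq s -> v \in s -> \sum_(y <- s) (if y == v then a else 0) = a.
Proof.
move=> us vs; rewrite (bigD1_seq v) //= eqxx big1 ?addr0 // => y /negbTE -> //.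
Qed.

Lemma sum_if_count s (A : pred K) (a : R) : \sum_(y <- s) (if A y then a else 0) = (count A s)%:R * a.
Proof.
by rewrite -big_mkcond big_const_seq iter_addr addr0 mulr_natl.
Qed.

(** Symmetry would even give equality. For the bound, a first element outside [A] changes nothing,
    and among those in [A] only [v] contributes. *)
Lemma prob_firstin s (A : pred K) v : uniq s -> v \in s -> A v ->
  perm_avg s (fun l => (firstin A v l)%:R) <= (count A s)%:R^-1.
Proof.
have [n] := ubnP (size s); elim: n s => // n IH s sn us vs Av.
have s0 : (0 < size s)%N by case: (s) vs.
have a0 : 0 < (count A s)%:R :> R by rewrite ltr0n -has_count; apply/hasP; exists v.
rewrite perm_avg_cons // ler_pdivrMr ?ltr0n //.
apply: (@le_trans _ _ (\sum_(y <- s) ((if y == v then 1 else 0) + (if predC A y then (count A s)%:R^-1 else 0)))).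
  rewrite big_seq [leRHS]big_seq; apply: ler_sum => y ys.
  have [->|yv] := eqVneq y v.
    by rewrite /= Av addr0; apply: firstin_le1; apply: rem_uniq.
  rewrite add0r; case Ay: (A y); rewrite /= Ay /=.
    rewrite (eq_perm_avg (h := fun=> 0)) ?perm_avg_cst ?rem_uniq // => l _.
    by rewrite firstin_cons Ay (negbTE yv).
  rewrite (eq_perm_avg (h := fun l => (firstin A v l)%:R)); last by move=> l _; rewrite firstin_cons Ay.
  have -> : count A s = count A (rem y s) by rewrite (count_rem _ ys) Ay.
  apply: IH => //; [|exact: rem_uniq|by rewrite mem_rem_uniq // inE eq_sym yv].
  by rewrite size_rem //; move: sn s0; clear; lia.
rewrite big_split /= sum_eq1 // sum_if_count -[in leRHS](count_predC A s) natrD mulrDr mulVf ?gt_eqF //.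
by rewrite lerD2l mulrC.
Qed.

(** The first element in the union of [A] and [B] must be [v] or [x]. If it is [v], which lies
    outside [B], the event for [B] is untouched and contributes [1 / b], with [a] and [b] the two
    counts; [x] contributes at most [1 / a]. As [a + b] is at most twice the size of the union, the
    factor [2] results. *)
Lemma prob_firstin2 s (A B : pred K) v x : uniq s -> v \in s -> x \in s -> A v -> B x -> ~~ B v ->
  perm_avg s (fun l => (firstin A v l && firstin B x l)%:R) <=
    2 / ((count A s)%:R * (count B s)%:R).
Proof.
have [n] := ubnP (size s); elim: n s => // n IH s sn us vs xs Av Bx Bv.
have s0 : (0 < size s)%N by case: (s) vs.
have a0 : 0 < (count A s)%:R :> R by rewrite ltr0n -has_count; apply/hasP; exists v.
have b0 : 0 < (count B s)%:R :> R by rewrite ltr0n -has_count; apply/hasP; exists x.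
set q := _ / _.
have xv : x != v by apply: contraNneq Bv => <-.
rewrite perm_avg_cons // ler_pdivrMr ?ltr0n //.
apply: (@le_trans _ _ (\sum_(y <- s) ((if y == v then (count B s)%:R^-1 else 0) +
    (if y == x then (count A s)%:R^-1 else 0) + (if predC (predU A B) y then q else 0)))).
  rewrite big_seq [leRHS]big_seq; apply: ler_sum => y ys.
  have ry := rem_uniq y us.
  have [->|yv] := eqVneq y v.
    rewrite eq_sym (negbTE xv) /= Av /= !addr0.
    have -> : count B s = count B (rem v s) by rewrite (count_rem _ vs) (negbTE Bv).
    apply: le_trans (prob_firstin (rem_uniq v us) _ Bx); last by rewrite mem_rem_uniq // inE xv.
    apply: perm_avg_le => l _; rewrite !firstin_cons Av eqxx (negbTE Bv) /=.
    by [].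
  have [->|yx] := eqVneq y x.
    rewrite /= Bx orbT /= add0r addr0; case Ax: (A x).
      rewrite (eq_perm_avg (h := fun=> 0)) ?perm_avg_cst ?rem_uniq // => l _.
      by rewrite firstin_cons Ax (negbTE xv).
    have -> : count A s = count A (rem x s) by rewrite (count_rem _ xs) Ax.
    apply: le_trans (prob_firstin (rem_uniq x us) _ Av); last by rewrite mem_rem_uniq // inE eq_sym xv.
    by apply: perm_avg_le => l _; rewrite !firstin_cons Ax Bx eqxx andbT.
  rewrite !add0r; case Ay: (A y); rewrite /= Ay /=.
    rewrite (eq_perm_avg (h := fun=> 0)) ?perm_avg_cst ?rem_uniq // => l _.
    by rewrite firstin_cons Ay (negbTE yv).
  case By: (B y); rewrite /=.
    rewrite (eq_perm_avg (h := fun=> 0)) ?perm_avg_cst ?rem_uniq // => l _.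
    by rewrite !firstin_cons By (negbTE yx) andbF.
  rewrite (eq_perm_avg (h := fun l => (firstin A v l && firstin B x l)%:R)); last by move=> l _; rewrite !firstin_cons Ay By.
  have {1}-> : q = 2 / ((count A (rem y s))%:R * (count B (rem y s))%:R).
    by rewrite /q (count_rem A ys) (count_rem B ys) Ay By.
  apply: IH => //; try by rewrite mem_rem_uniq // inE eq_sym ?yv ?yx.
  by rewrite size_rem //; move: sn s0; clear; lia.
rewrite !big_split /= !sum_eq1 // sum_if_count -[in leRHS](count_predC (predU A B) s) natrD mulrDr [q * _]mulrC.
rewrite [X in _ <= _ + X]mulrC lerD2r.
have : (count A s)%:R + (count B s)%:R <= 2 * (count (predU A B) s)%:R :> R.
  rewrite -natrD -[2]/(2%:R) -natrM ler_nat mul2n -addnn; apply: leq_add; apply: sub_count => y /= ->; rewrite ?orbT //.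
have -> : (count B s)%:R^-1 + (count A s)%:R^-1 = ((count A s)%:R + (count B s)%:R) / ((count A s)%:R * (count B s)%:R) :> R.
  by field; rewrite !gt_eqF.
move=> h; rewrite /q mulrA [_ * 2]mulrC ler_pM2r // invr_gt0 mulr_gt0 //.
Qed.

End PermAverage.

(** * Harmonic sums and sums over pairs *)

Section Sums.
Context {R : realType}.

Lemma ler_sum_in (I : eqType) (s : seq I) (P : pred I) (F G : I -> R) :
  (forall i, i \in s -> P i -> F i <= G i) -> \sum_(i <- s | P i) F i <= \sum_(i <- s | P i) G i.
Proof.
move=> h; elim: s h => [|i s IH] h; first by rewrite !big_nil.
have hs : \sum_(i <- s | P i) F i <= \sum_(i <- s | P i) G i.
  by apply: IH => j js; apply: h; rewrite inE js orbT.
rewrite !big_cons; case: ifP => // Pi; apply: lerD => //.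
by apply: h => //; exact: mem_head.
Qed.

Lemma sum_inj_le (I : eqType) (s : seq I) (P : pred I) (r : I -> nat) (N : nat) (f : nat -> R) :
  uniq s -> (forall j, 0 <= f j) ->
  (forall i i', i \in s -> i' \in s -> P i -> P i' -> r i = r i' -> i = i') ->
  (forall i, i \in s -> P i -> (r i < N)%N) ->
  \sum_(i <- s | P i) f (r i) <= \sum_(j < N) f j.
Proof.
move=> us f0 inj lt.
have ut : uniq (map r [seq i <- s | P i]).
  rewrite map_inj_in_uniq ?filter_uniq // => i i'.
  by rewrite !mem_filter => /andP[Pi si] /andP[Pi' si']; apply: inj.
rewrite -big_filter -(big_map r predT f) -(big_mkord predT f).
have pe : perm_eq (map r [seq i <- s | P i]) [seq j <- index_iota 0 N | j \in map r [seq i <- s | P i]].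
  apply: uniq_perm => //; first by rewrite filter_uniq // iota_uniq.
  move=> j; rewrite mem_filter andb_idr // => /mapP[i]; rewrite mem_filter => /andP[Pi si] ->.
  by rewrite mem_index_iota lt.
rewrite (perm_big _ pe) /= big_filter [leRHS](bigID (fun j => j \in map r [seq i <- s | P i])) /=.
by rewrite lerDl sumr_ge0.
Qed.

Lemma harmonic_le (n : nat) : (0 < n)%N -> \sum_(j < n) (j.+1)%:R^-1 <= 1 + ln n%:R :> R.
Proof.
elim: n => // n IH _; rewrite big_ord_recr /=.
have [->|n0] := posnP n; first by rewrite big_ord0 add0r invr1 ln1 addr0.
have np : 0 < n%:R :> R by rewrite ltr0n.
have := @ln_le_sub1 R (n%:R / n.+1%:R) ltac:(by rewrite divr_gt0 ?ltr0n).
rewrite ln_div ?posrE ?ltr0n //.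
have -> : n%:R / n.+1%:R - 1 = - (n.+1%:R^-1) :> R.
  by rewrite -natr1; field; lra.
move: (IH n0) => {}IH; move: (n.+1%:R^-1) (ln n.+1%:R) (ln n%:R) (\sum_(i < n) _) IH => q a b t; lra.
Qed.

(** Uniform in [N]: subtracting the harmonic sum shifted by [L] leaves at most its first [L]
    terms. *)
Lemma sum_diff_harmonic_le (N L : nat) : (0 < L)%N ->
  \sum_(j < N) ((j.+1)%:R^-1 - (j.+1 + L)%:R^-1) <= 1 + ln L%:R :> R.
Proof.
move=> L0; apply: le_trans (harmonic_le L0).
rewrite sumrB lerBlDr.
have -> : \sum_(i < L) i.+1%:R^-1 + \sum_(i < N) (i.+1 + L)%:R^-1 = \sum_(i < L + N) i.+1%:R^-1 :> R.
  by rewrite big_split_ord /=; congr (_ + _); apply: eq_bigr => i _; rewrite addSn addnC.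
by rewrite addnC big_split_ord /= lerDl sumr_ge0 // => i _; rewrite invr_ge0 ler0n.
Qed.

Lemma sum_inv_square_le (N : nat) : \sum_(j < N) ((j.+1)%:R ^+ 2)^-1 <= 2 :> R.
Proof.
have : (0 < N)%N -> \sum_(j < N) ((j.+1)%:R ^+ 2)^-1 <= 2 - N%:R^-1 :> R.
  elim: N => // n IH _; rewrite big_ord_recr /=.
  have [->|n0] := posnP n; first by rewrite big_ord0 add0r expr1n invr1; lra.
  have np : 0 < n%:R :> R by rewrite ltr0n.
  apply: le_trans (lerD (IH n0) (lexx _)) _.
  suff : (n.+1%:R ^+ 2)^-1 <= n%:R^-1 - n.+1%:R^-1 :> R by move: (_ ^-1) (n.+1%:R^-1) (n%:R^-1) => q a b h; lra.
  have -> : n%:R^-1 - n.+1%:R^-1 = (n%:R * n.+1%:R)^-1 :> R by rewrite -natr1; field; lra.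
  rewrite lef_pV2 ?posrE ?mulr_gt0 ?exprn_gt0 ?ltr0n // expr2.
  by rewrite ler_pM2r ?ltr0n // ler_nat.
case: N => [|N] h; first by rewrite big_ord0.
apply: le_trans (h isT) _; rewrite gerBl invr_ge0 ler0n //.
Qed.

(* If [e >= L * c] the last summand suffices, otherwise the first one does. *)
Lemma inv_prod_le (e c L : R) : 1 <= e -> 1 <= c -> 1 <= L ->
  (e * c)^-1 <= 2 * (e^-1 - (e + L)^-1) + L^-1 * (c ^+ 2)^-1.
Proof.
move=> e1 c1 L1; have e0 : 0 < e by lra.
have c0 : 0 < c by lra.
have L0 : 0 < L by lra.
have h1 : e^-1 - (e + L)^-1 = L / (e * (e + L)) by field; lra.
have p1 : 0 <= 2 * (L / (e * (e + L))).
  by rewrite mulr_ge0 // divr_ge0 ?mulr_ge0 //; lra.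
have p2 : 0 <= L^-1 * (c ^+ 2)^-1 by apply: mulr_ge0; rewrite invr_ge0 ?exprn_ge0 ?ltW.
have [h|h] := leP (L * c) e.
  have : (e * c)^-1 <= L^-1 * (c ^+ 2)^-1.
    rewrite -invfM lef_pV2 ?posrE ?mulr_gt0 ?exprn_gt0 //.
    by rewrite expr2 mulrA ler_pM2r.
  rewrite h1; lra.
have : (e * c)^-1 <= 2 * (L / (e * (e + L))).
  rewrite -subr_ge0.
  have -> : 2 * (L / (e * (e + L))) - (e * c)^-1 = (2 * L * c - (e + L)) / (e * (e + L) * c).
    by field; rewrite !gt_eqF //=; lra.
  rewrite divr_ge0 ?mulr_ge0 //; try lra.
  have : L * 1 <= L * c by rewrite ler_pM2l.
  lra.
rewrite h1; lra.
Qed.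

(* [c1] and [c2] number the partners of a fixed second, resp. first, element. *)
Lemma pair_sum_le (I : eqType) (s2 s : seq I) (P : I -> I -> bool) (c1 c2 : I -> I -> nat) (m n : nat) :
  uniq s2 -> uniq s ->
  (forall v x x', v \in s2 -> x \in s -> x' \in s -> P v x -> P v x' -> c2 v x = c2 v x' -> x = x') ->
  (forall v v' x, v \in s2 -> v' \in s2 -> x \in s -> P v x -> P v' x -> c1 v x = c1 v' x -> v = v') ->
  (forall v x, v \in s2 -> x \in s -> P v x ->
    (0 < c1 v x <= size s2)%N && (0 < c2 v x <= size s)%N) ->
  (0 < m <= n)%N -> 
    ((size s2 <= m)%N /\ (size s <= n)%N \/ (size s2 <= n)%N /\ (size s <= m)%N) ->
  \sum_(v <- s2) \sum_(x <- s | P v x) ((c1 v x)%:R * (c2 v x)%:R)^-1 <=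
    m%:R * (6 + 2 * ln (n%:R / m%:R + 1)) :> R.
Proof.
move=> u2 u inj2 inj1 bnd /andP[m0 mn] szs.
(* With [L] about [n / m], the differences [g] cost [O(1 + ln L)] per element of the smaller list,
   and the inverse squares [F], divided by [L], cost [2 / L] per element of the larger one, which is
   [4 * m] in all. *)
pose L := (n %/ m)%N.
have L0 : (0 < L)%N by rewrite divn_gt0.
have Lm : (n <= 2 * L * m)%N.
  have := divn_eq n m; have := ltn_pmod n m0; rewrite -/L; nia.
have mR : 0 < m%:R :> R by rewrite ltr0n.
have LR : 1 <= L%:R :> R by rewrite ler1n.
have lnL : ln L%:R <= ln (n%:R / m%:R + 1) :> R.
  apply: ln_le; first lra.
  have : L%:R * m%:R <= n%:R :> R by rewrite -natrM ler_nat leq_divM.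
  by rewrite -ler_pdivlMr //; lra.
have nL : n%:R * L%:R^-1 <= 2 * m%:R :> R.
  rewrite ler_pdivrMr; last lra.
  rewrite mulrAC -[2]/(2%:R) -!natrM ler_nat //.
pose g (j : nat) : R := (j.+1)%:R^-1 - (j.+1 + L)%:R^-1.
pose F (j : nat) : R := ((j.+1)%:R ^+ 2)^-1.
have g0 j : 0 <= g j.
  by rewrite subr_ge0 lef_pV2 ?posrE ?ltr0n ?addSn // ler_nat ltnS leq_addr.
have F0 j : 0 <= F j by rewrite invr_ge0 exprn_ge0 ?ler0n.
have S2 (f : nat -> R) v : (forall j, 0 <= f j) -> v \in s2 ->
    \sum_(x <- s | P v x) f (c2 v x).-1 <= \sum_(j < size s) f j.
  move=> f0 vs; apply: (@sum_inj_le _ s (P v) (fun x => (c2 v x).-1)) => //.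
    move=> x x' xs xs' Px Px' e; apply: (inj2 v) => //.
    have /andP[_ /andP[h _]] := bnd v x vs xs Px.
    have /andP[_ /andP[h' _]] := bnd v x' vs xs' Px'.
    by rewrite -(prednK h) -(prednK h') e.
  move=> x xs Px; have /andP[_ /andP[h h']] := bnd v x vs xs Px.
  by rewrite prednK.
have S1 (f : nat -> R) x : (forall j, 0 <= f j) -> x \in s ->
    \sum_(v <- s2 | P v x) f (c1 v x).-1 <= \sum_(j < size s2) f j.
  move=> f0 xs; apply: (@sum_inj_le _ s2 (P^~ x) (fun v => (c1 v x).-1)) => //.
    move=> v v' vs vs' Px Px' e; apply: (inj1 v v' x) => //.
    have /andP[/andP[h _] _] := bnd v x vs xs Px.
    have /andP[/andP[h' _] _] := bnd v' x vs' xs Px'.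
    by rewrite -(prednK h) -(prednK h') e.
  move=> v vs Px; have /andP[/andP[h h'] _] := bnd v x vs xs Px.
  by rewrite prednK.
have S2' (f : nat -> R) (b : R) : (forall j, 0 <= f j) -> \sum_(j < size s) f j <= b ->
    \sum_(v <- s2) \sum_(x <- s | P v x) f (c2 v x).-1 <= (size s2)%:R * b.
  move=> f0 fb; rewrite big_seq; apply: (@le_trans _ _ (\sum_(v <- s2 | v \in s2) b)).
    by apply: ler_sum => v vs; apply: le_trans fb; apply: S2.
  by rewrite -big_seq big_const_seq count_predT iter_addr addr0 mulr_natl.
have S1' (f : nat -> R) (b : R) : (forall j, 0 <= f j) -> \sum_(j < size s2) f j <= b ->
    \sum_(v <- s2) \sum_(x <- s | P v x) f (c1 v x).-1 <= (size s)%:R * b.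
  move=> f0 fb; rewrite (exchange_big_dep predT) //= big_seq.
  apply: (@le_trans _ _ (\sum_(x <- s | x \in s) b)).
    by apply: ler_sum => x xs; apply: le_trans fb; apply: S1.
  by rewrite -big_seq big_const_seq count_predT iter_addr addr0 mulr_natl.
have kern v x : v \in s2 -> x \in s -> P v x ->
   ((c1 v x)%:R * (c2 v x)%:R)^-1 <= 2 * g (c2 v x).-1 + L%:R^-1 * F (c1 v x).-1 /\
   ((c1 v x)%:R * (c2 v x)%:R)^-1 <= 2 * g (c1 v x).-1 + L%:R^-1 * F (c2 v x).-1 :> R.
  move=> vs xs Px; have /andP[/andP[h _] /andP[h' _]] := bnd v x vs xs Px.
  rewrite /g /F !prednK // !natrD; split.
    by rewrite mulrC; apply: inv_prod_le; rewrite ?ler1n.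
  by apply: inv_prod_le; rewrite ?ler1n.
have G (N : nat) : \sum_(j < N) 2 * g j <= 2 * (1 + ln (n%:R / m%:R + 1)).
  rewrite -mulr_sumr ler_pM2l //; apply: le_trans (sum_diff_harmonic_le N L0) _.
  by rewrite lerD2l.
have FF (N : nat) : \sum_(j < N) L%:R^-1 * F j <= L%:R^-1 * 2.
  by rewrite -mulr_sumr ler_pM2l ?invr_gt0 ?ltr0n // sum_inv_square_le.
have g0' j : 0 <= 2 * g j by rewrite mulr_ge0.
have F0' j : 0 <= L%:R^-1 * F j by rewrite mulr_ge0 ?invr_ge0.
have l0 : 0 <= 1 + ln (n%:R / m%:R + 1) :> R.
  have := @ln_ge0 R (L%:R) LR; lra.
have fin (a b : nat) : (a <= m)%N -> (b <= n)%N ->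
    a%:R * (2 * (1 + ln (n%:R / m%:R + 1))) + b%:R * (L%:R^-1 * 2) <= m%:R * (6 + 2 * ln (n%:R / m%:R + 1)) :> R.
  move=> am bn.
  have h1 : a%:R * (2 * (1 + ln (n%:R / m%:R + 1))) <= m%:R * (2 * (1 + ln (n%:R / m%:R + 1))) :> R.
    by apply: ler_wpM2r; rewrite ?ler_nat // mulr_ge0.
  have h2 : b%:R * L%:R^-1 <= n%:R * L%:R^-1 :> R.
    by apply: ler_wpM2r; rewrite ?ler_nat // invr_ge0.
  lra.
have [[h2 h]|[h2 h]] : ((size s2 <= m)%N /\ (size s <= n)%N) \/ ((size s2 <= n)%N /\ (size s <= m)%N).
- exact: szs.
- apply: le_trans (fin _ _ h2 h).
  apply: (@le_trans _ _ (\sum_(v <- s2) \sum_(x <- s | P v x) (2 * g (c2 v x).-1) +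
      \sum_(v <- s2) \sum_(x <- s | P v x) (L%:R^-1 * F (c1 v x).-1))).
    rewrite -big_split; apply: ler_sum_in => v vs _ /=.
    rewrite -big_split; apply: ler_sum_in => x xs Px /=.
    by have [] := kern v x vs xs Px.
  apply: lerD; first exact: (S2' (fun j => 2 * g j)).
  exact: (S1' (fun j => L%:R^-1 * F j)).
- rewrite -[X in _ <= X]addr0; apply: le_trans (_ : _ <= (size s)%:R * (2 * (1 + ln (n%:R / m%:R + 1))) + (size s2)%:R * (L%:R^-1 * 2)) _; last first.
    by rewrite addr0; exact: fin.
  apply: (@le_trans _ _ (\sum_(v <- s2) \sum_(x <- s | P v x) (2 * g (c1 v x).-1) +
      \sum_(v <- s2) \sum_(x <- s | P v x) (L%:R^-1 * F (c2 v x).-1))).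
    rewrite -big_split; apply: ler_sum_in => v vs _ /=.
    rewrite -big_split; apply: ler_sum_in => x xs Px /=.
    by have [] := kern v x vs xs Px.
  apply: lerD; first exact: (S1' (fun j => 2 * g j)).
  exact: (S2' (fun j => L%:R^-1 * F j)).
Qed.

End Sums.

(** * Search paths and heights under a random order *)

Section RandomOrder.
Context {R : realType} {d : Order.disp_t} {K : orderType d}.
Implicit Types (s U l : seq K) (v x z y : K) (p : K -> R).

Lemma prio_trans p : transitive (fun x y => p y < p x).
Proof. by move=> x y z yx zx; exact: lt_trans zx yx. Qed.

(* Here [l] lists the keys by decreasing priority. *)
Definition list_prio l x : R := - (index x l)%:R.

Lemma list_prioE U l p : perm_eq l U -> sorted (fun x y => p y < p x) l ->
  {in U &, forall z x, (p z <= p x) = (list_prio l z <= list_prio l x)}.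
Proof.
move=> pe srt z x; rewrite -!(perm_mem pe) => zl xl.
have tr := @prio_trans p.
rewrite lerN2 ler_nat; case: (ltngtP (index x l) (index z l)) => h.
- by rewrite (ltW (sorted_ltn_index tr srt _ _ xl zl h)).
- by apply/negbTE; rewrite -ltNge; exact (sorted_ltn_index tr srt _ _ zl xl h).
- have -> : x = z by rewrite -(nth_index x xl) h nth_index.
  exact: lexx.
Qed.

Section SameOrder.
Variables (U : seq K) (p q : K -> R).
Hypothesis pq : {in U &, forall z x, (p z <= p x) = (q z <= q x)}.

Lemma eq_rec s v x : {subset s <= U} -> x \in U -> rec p s v x = rec q s v x.
Proof. by move=> sU xU; apply: eq_in_all => z /sU zU; rewrite pq. Qed.

Lemma eq_npairs s2 s : {subset s2 <= U} -> {subset s <= U} -> npairs p s2 s = npairs q s2 s.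
Proof.
move=> s2U sU; apply: eq_big_seq => v /s2U vU; apply: eq_in_count => x /sU xU.
rewrite /ev (eq_rec _ sU xU); congr (_ && _).
by apply: eq_in_all => z /s2U zU; rewrite pq.
Qed.

End SameOrder.

Lemma firstin_index (A : pred K) v l : v \in l -> A v ->
  {in l, forall z, A z -> (index v l <= index z l)%N} -> firstin A v l.
Proof.
move=> + Av; elim: l => // y l IH; rewrite inE eq_sym => vl h; rewrite firstin_cons.
have [->|yv] := eqVneq y v; first by rewrite Av.
rewrite (negbTE yv) /= in vl.
have nAy : A y = false.
  by apply/negP => Ay; have := h y (mem_head _ _) Ay; rewrite /= (negbTE yv) eqxx.
rewrite nAy; apply: IH => // z zl Az; have := h z; rewrite inE zl orbT /= (negbTE yv).
case: eqVneq => [yz|_]; first by rewrite -yz nAy in Az.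
by move=> /(_ isT Az).
Qed.

(** In the interval between [v] and [x], the event requires [v] to come first among the keys of
    [s2], and [x] first among the keys of [s] other than [v]. Excluding [v] is what [prob_firstin2]
    asks for. *)
Lemma perm_avg_ev U s2 s v x : uniq U -> uniq s2 -> uniq s ->
  {subset s2 <= U} -> {subset s <= U} -> v \in s2 -> x \in s -> x != v ->
  perm_avg U (fun l => (ev (list_prio l) s2 s v x)%:R) <=
    2 * ((count (btw x v) s2)%:R * (count (fun z => (z != v) && btw x v z) s)%:R)^-1 :> R.
Proof.
move=> uU us2 us s2U sU vs2 xs xv.
pose A z := (z \in s2) && btw x v z; pose B z := (z \in s) && ((z != v) && btw x v z).
have bxv : btw x v v by rewrite /btw lexx !andbT; exact: le_total.
have bxx : btw x v x by rewrite /btw lexx /= !andbT; exact: le_total.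
have Av : A v by rewrite /A vs2 bxv.
have Bx : B x by rewrite /B xs xv.
have Bv : ~~ B v by rewrite /B eqxx andbF.
apply: le_trans (_ : perm_avg U (fun l => (firstin A v l && firstin B x l)%:R) <= _); last first.
  apply: le_trans (prob_firstin2 uU (s2U _ vs2) (sU _ xs) Av Bx Bv) _.
  have cA : (count (btw x v) s2 <= count A U)%N.
    by apply: count_sub => // z zs bz; rewrite s2U //= /A zs bz.
  have cB : (count (fun z => (z != v) && btw x v z) s <= count B U)%N.
    by apply: count_sub => // z zs bz; rewrite sU //= /B zs bz.
  have cA0 : (0 < count (btw x v) s2)%N by rewrite -has_count; apply/hasP; exists v.
  have cB0 : (0 < count (fun z => (z != v) && btw x v z) s)%N.
    by rewrite -has_count; apply/hasP; exists x; rewrite ?xv.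
  rewrite ler_pM2l // lef_pV2 ?posrE ?mulr_gt0 ?ltr0n //; try exact: leq_trans cA; try exact: leq_trans cB.
  by apply: ler_pM; rewrite ?ler0n ?ler_nat.
apply: perm_avg_le => l; rewrite mem_permutations => pe; rewrite ler_nat.
case e: (ev _ _ _ _ _) => //; move: e; rewrite /ev => /andP[/allP e1 /allP e2].
rewrite !firstin_index //.
- by rewrite (perm_mem pe) sU.
- move=> z zl /and3P[zs zv bz]; have := e2 z zs; rewrite zv bz /=.
  by rewrite /list_prio lerN2 ler_nat.
- by rewrite (perm_mem pe) s2U.
- move=> z zl /andP[zs bz]; have := e1 z zs; rewrite bz /=.
  by rewrite /list_prio lerN2 ler_nat.
Qed.

Lemma count_ltn (A : eqType) (s : seq A) (P Q : pred A) (y : A) :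
  y \in s -> (forall z : A, P z -> Q z) -> Q y -> ~~ P y ->
  (count P s < count Q s)%N.
Proof.
move=> ys PQ Qy Py.
rewrite -[count Q s]size_filter -(count_predC P) !count_filter.
have -> : count (predI P Q) s = count P s.
  by apply: eq_count => z /=; case Pz: (P z) => //=; rewrite PQ.
rewrite -[ltnLHS]addn0 ltn_add2l -has_count; apply/hasP; exists y => //=.
by rewrite Py Qy.
Qed.

Let c1 (d' : Order.disp_t) (K' : orderType d') (s2 : seq K') (v x : K') := count (btw x v) s2.
Let c2 (d' : Order.disp_t) (K' : orderType d') (s : seq K') (v x : K') :=
  count (fun z : K' => (z != v) && btw x v z) s.

Lemma between_counts (d' : Order.disp_t) (K' : orderType d') (s2 s : seq K') (v x : K') :
  v \in s2 -> x \in s -> x != v -> (0 < c1 s2 v x <= size s2)%N && (0 < c2 s v x <= size s)%N.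
Proof.
move=> vs xs xv; rewrite !count_size !andbT -!has_count; apply/andP; split; apply/hasP.
  by exists v => //; rewrite /btw lexx !andbT le_total.
by exists x => //; rewrite xv /btw lexx /= !andbT le_total.
Qed.

(** For fixed [v], [c2] grows strictly with [x]; for fixed [x], [c1] decreases strictly as [v]
    approaches [x]. So both counts number the partners. The key type is arbitrary in order to allow
    the dual order. *)
Lemma sum_larger_le (d' : Order.disp_t) (K' : orderType d') (s2 s : seq K') (m n : nat) : uniq s2 -> uniq s ->
  (0 < m <= n)%N ->
  ((size s2 <= m)%N /\ (size s <= n)%N \/ (size s2 <= n)%N /\ (size s <= m)%N) ->
  \sum_(v <- s2) \sum_(x <- s | (v < x)%O) ((c1 s2 v x)%:R * (c2 s v x)%:R)^-1 <=
    m%:R * (6 + 2 * ln (n%:R / m%:R + 1)) :> R.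
Proof.
move=> us2 us m0 szs; apply: (@pair_sum_le _ _ s2 s (fun v x : K' => (v < x)%O)) => //.
- move=> v x x' vs xs xs' vx vx'.
  have lt a b : a \in s -> b \in s -> (v < a)%O -> (a < b)%O -> (c2 s v a < c2 s v b)%N.
    move=> sa sb va ab; apply: (@count_ltn _ _ _ _ b) => //.
    + move=> z /andP[-> /orP[]/andP[h1 h2]] /=; last by rewrite /btw h1 (ltW (le_lt_trans h2 ab)) orbT.
      by move: (lt_le_trans va (le_trans h1 h2)); rewrite ltxx.
    + by rewrite (gt_eqF (lt_trans va ab)) /btw lexx (ltW (lt_trans va ab)) orbT.
    + rewrite negb_and /btw negb_or; apply/orP; right; apply/andP; split; rewrite negb_and -!ltNge.
        by rewrite (lt_trans va ab) orbT.
      by rewrite ab orbT.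
  case: (ltgtP x x') => // h e; [have := lt _ _ xs xs' vx h|have := lt _ _ xs' xs vx' h]; rewrite e ltnn //.
- move=> v v' x vs vs' xs vx vx'.
  have lt a b : a \in s2 -> b \in s2 -> (b < x)%O -> (a < b)%O -> (c1 s2 b x < c1 s2 a x)%N.
    move=> sa sb bx ab; apply: (@count_ltn _ _ _ _ a) => //.
    + move=> z /orP[]/andP[h1 h2]; last by rewrite /btw h2 (ltW (lt_le_trans ab h1)) orbT.
      by move: (lt_le_trans bx (le_trans h1 h2)); rewrite ltxx.
    + by rewrite /btw lexx (ltW (lt_trans ab bx)) orbT.
    + rewrite /btw negb_or; apply/andP; split; rewrite negb_and -!ltNge.
        by rewrite (lt_trans ab bx).
      by rewrite ab.
  case: (ltgtP v v') => // h e; [have := lt _ _ vs vs' vx' h|have := lt _ _ vs' vs vx h]; rewrite e ltnn //.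
- by move=> v x vs xs vx; apply: between_counts => //; rewrite gt_eqF.
Qed.

(** The pairs with [x = v] contribute at most [m], and each side of [v] at most twice the bound of
    [sum_larger_le]; hence [25 = 1 + 2 * 2 * 6]. *)
Lemma perm_avg_npairs U s2 s m n : uniq U -> uniq s2 -> uniq s ->
  {subset s2 <= U} -> {subset s <= U} -> (0 < m <= n)%N ->
  ((size s2 <= m)%N /\ (size s <= n)%N \/ (size s2 <= n)%N /\ (size s <= m)%N) ->
  perm_avg U (fun l => (npairs (list_prio l) s2 s)%:R) <=
    m%:R * (25 + 8 * ln (n%:R / m%:R + 1)) :> R.
Proof.
move=> uU us2 us s2U sU m0 szs.
have npE l : (npairs (list_prio l) s2 s)%:R = \sum_(v <- s2) \sum_(x <- s) (ev (list_prio l) s2 s v x)%:R :> R.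
  rewrite natr_sum; apply: eq_bigr => v _; rewrite -sum1_count natr_sum big_mkcond.
  by apply: eq_bigr => x _; case: (ev _ _ _ _ _).
rewrite (eq_perm_avg (h := fun l => \sum_(v <- s2) \sum_(x <- s) (ev (list_prio l) s2 s v x)%:R)) //.
rewrite perm_avg_sum.
apply: le_trans (_ : \sum_(v <- s2) \sum_(x <- s) ((if x == v then 1 else 0) +
   (2 * (if (v < x)%O then ((c1 s2 v x)%:R * (c2 s v x)%:R)^-1 else 0) +
    2 * (if (x < v)%O then ((c1 s2 v x)%:R * (c2 s v x)%:R)^-1 else 0))) <= _).
  apply: ler_sum_in => v vs _; rewrite perm_avg_sum; apply: ler_sum_in => x xs _.
  case: (ltgtP v x) => vx.
  - by rewrite add0r mulr0 addr0; apply: perm_avg_ev => //; rewrite gt_eqF.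
  - by rewrite add0r mulr0 add0r; apply: perm_avg_ev => //; rewrite lt_eqF.
  - by rewrite mulr0 !addr0; apply: (firstin_le1 (fun l => ev (list_prio l) s2 s v x)).
have split3 (F G H : K -> K -> R) : \sum_(v <- s2) \sum_(x <- s) (F v x + (2 * G v x + 2 * H v x)) =
    \sum_(v <- s2) \sum_(x <- s) F v x + (2 * \sum_(v <- s2) \sum_(x <- s) G v x +
      2 * \sum_(v <- s2) \sum_(x <- s) H v x).
  rewrite !mulr_sumr -!big_split /=; apply: eq_bigr => v _.
  by rewrite !mulr_sumr -!big_split.
rewrite split3.
have szE (r : seq K) : (size r)%:R = \sum_(i <- r) 1 :> R.
  by rewrite big_const_seq count_predT iter_addr addr0.
have diag : \sum_(v <- s2) \sum_(x <- s) (if x == v then 1 else 0) <= m%:R :> R.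
  have h1 : \sum_(v <- s2) \sum_(x <- s) (if x == v then 1 else 0) <= (size s2)%:R :> R.
    rewrite szE; apply: ler_sum_in => v _ _.
    rewrite (sum_if_count s (pred1 v)) mulr1 count_uniq_mem //.
    by case: (_ \in _).
  have h2 : \sum_(v <- s2) \sum_(x <- s) (if x == v then 1 else 0) <= (size s)%:R :> R.
    rewrite exchange_big szE; apply: ler_sum_in => x _ _ /=.
    rewrite (eq_bigr (fun v => if v == x then 1 else 0)); last by move=> v _; rewrite eq_sym.
    rewrite (sum_if_count s2 (pred1 x)) mulr1 count_uniq_mem //.
    by case: (_ \in _).
  by case: szs => -[a b]; [apply: le_trans h1 _|apply: le_trans h2 _]; rewrite ler_nat.
have sm2 (P : K -> K -> bool) : \sum_(v <- s2) \sum_(x <- s) (if P v x then ((c1 s2 v x)%:R * (c2 s v x)%:R)^-1 else 0) =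
    \sum_(v <- s2) \sum_(x <- s | P v x) ((c1 s2 v x)%:R * (c2 s v x)%:R)^-1 :> R.
  by apply: eq_bigr => v _; rewrite -big_mkcond.
rewrite !sm2.
(* The pairs with [x < v] are those with [x] above [v] in the dual order. *)
have right := sum_larger_le us2 us m0 szs; have left := @sum_larger_le _ K^d s2 s m n us2 us m0 szs.
have dualE v x : @c1 _ K^d s2 v x = c1 s2 v x /\ @c2 _ K^d s v x = c2 s v x.
  have bE z : @btw _ K^d x v z = btw x v z by rewrite /btw orbC andbC [X in _ || X]andbC.
  by split; apply: eq_count => z; rewrite bE.
have {}left : \sum_(v <- s2) \sum_(x <- s | (x < v)%O) ((c1 s2 v x)%:R * (c2 s v x)%:R)^-1 <=
    m%:R * (6 + 2 * ln (n%:R / m%:R + 1)) :> R.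
  apply: le_trans left; apply: ler_sum_in => v _ _; apply: ler_sum_in => x _ _.
  by have [-> ->] := dualE v x.
lra.
Qed.

(* The height of the treap whose priorities decrease along [l]; [n] is fuel. *)
Fixpoint insertion_height_rec (n : nat) l : nat :=
  if n is n'.+1 then
    if l is y :: l' then
      (maxn (insertion_height_rec n' [seq z <- l' | (z < y)%O])
            (insertion_height_rec n' [seq z <- l' | (y < z)%O])).+1
    else 0%N
  else 0%N.

Definition insertion_height l := insertion_height_rec (size l) l.

Lemma insertion_height_stable n m l : (size l <= n)%N -> (size l <= m)%N ->
  insertion_height_rec n l = insertion_height_rec m l.
Proof.
elim: n m l => [|n IH] [|m] [|y l] //=; rewrite !ltnS => ln lm.
have sf (P : pred K) : (size [seq z <- l | P z] <= size l)%N by rewrite size_filter count_size.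
congr (maxn _ _).+1; apply: IH; by apply: leq_trans (sf _) _.
Qed.

Lemma insertion_height_cons y l : insertion_height (y :: l) =
  (maxn (insertion_height [seq z <- l | (z < y)%O]) (insertion_height [seq z <- l | (y < z)%O])).+1.
Proof.
have sf (P : pred K) : (size [seq z <- l | P z] <= size l)%N by rewrite size_filter count_size.
by rewrite /insertion_height /=; congr (maxn _ _).+1; apply: insertion_height_stable.
Qed.

Let before (b : bool) x y : bool := if b then (x < y)%O else (y < x)%O.

(** One side of [v] at a time: [rec] disregards [v] itself, so the keys counted on both sides need
    not lie on one path of the treap. If the first key [y] is on the chosen side, the other keys lie
    strictly between [y] and [v]; if not, they all lie on that side of [y]. Either way they are in
    one subtree of [y]. *)
Let before_recs_le b p l v : uniq l -> sorted (fun x y => p y < p x) l ->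
  (count (fun x => before b x v && rec p l v x) l <= insertion_height l)%N.
Proof.
have tr := @prio_trans p.
have [n] := ubnP (size l); elim: n l => // n IH [|y l] // sn /andP[yl ul] srt.
have srt' : sorted (fun x y => p y < p x) l by exact: path_sorted srt.
have pl z : z \in l -> p z < p y by move: srt; rewrite /= path_sortedE // => /andP[/allP h _]; exact: h.
have ih_le (P : pred K) : (insertion_height [seq z <- l | P z] < insertion_height (y :: l))%N ->
    (forall x, x \in l -> before b x v -> rec p (y :: l) v x -> P x) ->
    (count (fun x => before b x v && rec p (y :: l) v x) l < insertion_height (y :: l))%N.
  move=> lt h; apply: leq_ltn_trans lt; apply: leq_trans (IH _ _ (filter_uniq _ ul) (sorted_filter tr _ srt')).
    apply: count_sub => // x xl /andP[xv rx]; rewrite mem_filter h // xl xv /=.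
    by apply/allP => z; rewrite mem_filter => /andP[_ zl]; apply: (allP rx); rewrite inE zl orbT.
  by apply: (@leq_ltn_trans (size l)); [rewrite size_filter count_size|move: sn; rewrite ltnS].
have ltL c : (insertion_height [seq z <- l | before c z y] < insertion_height (y :: l))%N.
  by rewrite insertion_height_cons ltnS; case: c; rewrite ?leq_maxl ?leq_maxr.
rewrite [X in (X <= _)%N]/=; case yv: (before b y v) => /=.
- apply: (@leq_trans (1 + (insertion_height (y :: l)).-1)); last by rewrite insertion_height_cons.
  apply: leq_add; first by case: (_ && _).
  rewrite -ltnS prednK; last by rewrite insertion_height_cons.
  apply: ih_le (ltL (~~ b)) _ => x xl xv /andP[ry _].
  have {}pl := pl x xl; move: ry xv yv; rewrite /before.
  case: b {IH ltL} => /= ry xv yv; rewrite ltNge; apply/negP => xy; move: ry.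
  + by rewrite (lt_eqF yv) /btw xy (ltW yv) /= leNgt pl.
  + by rewrite (gt_eqF yv) /btw xy (ltW yv) /= orbT leNgt pl.
- apply/ltnW/(ih_le _ (ltL b)) => x xl xv _.
  move: xv yv; rewrite /before; case: b {IH ih_le ltL} => xv /negbT; rewrite -leNgt => vy.
    exact: lt_le_trans vy.
  exact: le_lt_trans vy xv.
Qed.

Lemma recs_le_height U s p l v : uniq U -> uniq s -> {subset s <= U} -> perm_eq l U ->
  sorted (fun x y => p y < p x) l ->
  (recs p s v <= 2 * insertion_height [seq y <- l | y \in s] + 1)%N.
Proof.
move=> uU us sU pe srt.
have tr := @prio_trans p.
have ul : uniq l by rewrite (perm_uniq pe).
have pes : perm_eq s [seq y <- l | y \in s].
  apply: uniq_perm; rewrite ?filter_uniq // => y; rewrite mem_filter (perm_mem pe) andb_idr //.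
  exact: sU.
set t := [seq _ <- _ | _] in pes *.
have ut : uniq t by rewrite filter_uniq.
have srt_t : sorted (fun x y => p y < p x) t by exact: sorted_filter.
have -> : recs p s v = recs p t v.
  rewrite /recs (permP pes); apply: eq_count => x; rewrite /rec.
  exact: perm_all.
have h1 := before_recs_le true v ut srt_t; have h2 := before_recs_le false v ut srt_t.
have : (recs p t v <= count (fun x => (x < v)%O && rec p t v x) t +
   count (fun x => (v < x)%O && rec p t v x) t + count_mem v t)%N.
  rewrite /recs; elim: (t) {1 3 5}(t) => //= x t' IH t0.
  have := IH t0; case: (ltgtP x v) => _; case: (rec _ _ _ _) => /=; clear; lia.
have : (count_mem v t <= 1)%N by rewrite count_uniq_mem //; case: (v \in t).
by move: h1 h2; rewrite /before /=; clear; lia.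
Qed.

(** The binomial coefficient ['C(j + 3, 3)]. By [phi_sum], [n * phi n] is four times the sum of
    [phi j] over [j < n], the recurrence for the exponential moment. *)
Let phi (j : nat) : R := (j.+1)%:R * (j.+2)%:R * (j.+3)%:R / 6.

Let phi_sum n : \sum_(j < n) phi j = n%:R * (n.+1)%:R * (n.+2)%:R * (n.+3)%:R / 24.
Proof.
elim: n => [|n IH]; first by rewrite big_ord0 !mul0r.
rewrite big_ord_recr /= IH /phi -!natr1; by field.
Qed.

(** The maximum of the two exponentials is bounded by their sum. As the root varies, the size of
    either subtree takes distinct values below [size s], so each side contributes at most twice the
    sum of [phi]. *)
Lemma perm_avg_exp_height s : uniq s ->
  perm_avg s (fun l => 2 ^+ insertion_height l) <= phi (size s).
Proof.
have [n] := ubnP (size s); elim: n s => // n IH s sn us.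
have [/size0nil ->|s0] := posnP (size s).
  by rewrite perm_avg_nil /phi /= expr0; lra.
rewrite perm_avg_cons // ler_pdivrMr ?ltr0n //.
have phi0 j : 0 <= phi j by rewrite /phi; rewrite !mulr_ge0 ?invr_ge0 ?ler0n.
have up (P : K -> pred K) : (forall y, ~~ P y y) ->
    (forall y y', y \in s -> y' \in s -> count (P y) s = count (P y') s -> y = y') ->
    \sum_(y <- s) perm_avg (rem y s) (fun l => 2 ^+ insertion_height [seq z <- l | P y z]) <=
    \sum_(j < size s) phi j.
  move=> irr inj; apply: (@le_trans _ _ (\sum_(y <- s) phi (count (P y) s))).
    apply: ler_sum_in => y ys _.
    rewrite (perm_avg_filter (P y) (fun l => 2 ^+ insertion_height l) (rem_uniq y us)).
    have sz : size [seq z <- rem y s | P y z] = count (P y) s.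
      by rewrite size_filter (count_rem _ ys) (negbTE (irr y)).
    rewrite -sz; apply: IH; last by rewrite filter_uniq // rem_uniq.
    apply: leq_ltn_trans (_ : (size (rem y s) < n)%N); first by rewrite size_filter count_size.
    by rewrite size_rem // -ltnS prednK.
  apply: (@sum_inj_le _ _ s predT (fun y => count (P y) s)) => //.
    by move=> y y' ys ys' _ _; apply: inj.
  move=> y ys _; rewrite ltn_neqAle count_size andbT; apply/negP => /eqP.
  by move/eqP; rewrite -all_count => /allP /(_ y ys); rewrite (negbTE (irr y)).
have h1 := up (fun y z => (z < y)%O) _ _; have h2 := up (fun y z => (y < z)%O) _ _.
apply: (@le_trans _ _ (\sum_(y <- s)
   (2 * perm_avg (rem y s) (fun l => 2 ^+ insertion_height [seq z <- l | (z < y)%O]) +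
    2 * perm_avg (rem y s) (fun l => 2 ^+ insertion_height [seq z <- l | (y < z)%O])))).
  apply: ler_sum_in => y ys _; rewrite -!perm_avgZ -perm_avgD; apply: perm_avg_le => l _.
  rewrite insertion_height_cons exprS -mulrDr ler_pM2l //.
  case: (leqP (insertion_height [seq z <- l | (z < y)%O]) (insertion_height [seq z <- l | (y < z)%O])) => _.
    by rewrite lerDr exprn_ge0.
  by rewrite lerDl exprn_ge0.
rewrite big_split /= -!mulr_sumr.
have lt_inj y y' : y \in s -> y' \in s -> (y < y')%O -> (count (fun z => z < y)%O s < count (fun z => z < y')%O s)%N.
  move=> ys ys' yy; apply: (@count_ltn _ _ _ _ y) => //; last by rewrite ltxx.
  by move=> z zy; exact: lt_trans zy yy.
have gt_inj y y' : y \in s -> y' \in s -> (y < y')%O -> (count (fun z => y' < z)%O s < count (fun z => y < z)%O s)%N.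
  move=> ys ys' yy; apply: (@count_ltn _ _ _ _ y') => //; last by rewrite ltxx.
  by move=> z zy; exact: lt_trans yy zy.
have {}h1 := h1 (fun y => ltac:(by rewrite ltxx)) ltac:(move=> y y' ys ys' e;
  case: (ltgtP y y') => // h; [have := lt_inj _ _ ys ys' h|have := lt_inj _ _ ys' ys h]; by rewrite e ltnn).
have {}h2 := h2 (fun y => ltac:(by rewrite ltxx)) ltac:(move=> y y' ys ys' e;
  case: (ltgtP y y') => // h; [have := gt_inj _ _ ys ys' h|have := gt_inj _ _ ys' ys h]; by rewrite e ltnn).
rewrite phi_sum in h1 h2.
have -> : phi (size s) * (size s)%:R =
    2 * ((size s)%:R * (size s).+1%:R * (size s).+2%:R * (size s).+3%:R / 24) +
    2 * ((size s)%:R * (size s).+1%:R * (size s).+2%:R * (size s).+3%:R / 24).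
  by rewrite /phi; field.
by apply: lerD; rewrite ler_pM2l.
Qed.

(** Pointwise, the square is at most [72 * L ^+ 2] plus [16 * L ^+ 2 / u ^+ 3] times the
    exponential, whose mean is at most [u ^+ 3]; the sum is [88]. *)
Lemma perm_avg_height_sqr s : uniq s ->
  perm_avg s (fun l => (insertion_height l)%:R ^+ 2) <= 88 * (1 + ln (1 + (size s)%:R)) ^+ 2 :> R.
Proof.
move=> us; set u : R := 1 + (size s)%:R; set L := 1 + ln u.
have u1 : 1 <= u by rewrite /u lerDl ler0n.
have L1 : 1 <= L by rewrite /L lerDl ln_ge0.
have L2 : 1 <= L ^+ 2 by rewrite exprn_ege1.
have u3 : 0 < u ^+ 3 by rewrite exprn_gt0 //; lra.
apply: (@le_trans _ _ (perm_avg s (fun l => 72 * L ^+ 2 + 16 * L ^+ 2 / u ^+ 3 * 2 ^+ insertion_height l))).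
  apply: perm_avg_le => l _; set t := insertion_height l.
  (* The excess of the height, in natural units, over the value [3 * ln u] suggested by the
     exponential moment; if positive, its square is at most [2 * expR y]. *)
  pose y := t%:R * ln 2 - 3 * ln u.
  have l2 := @ln2_ge_half R.
  have eyE : 2 ^+ t / u ^+ 3 = expR y.
    rewrite /y expRB; congr (_ / _).
      by rewrite mulrC expRM_natr lnK ?posrE.
    by rewrite expRM_natl lnK // posrE; lra.
  rewrite mulrAC -[16 * _ * _ / _]mulrA eyE.
  have ey0 := expR_gt0 y.
  have t0 : 0 <= t%:R :> R by [].
  have t2 : t%:R <= 2 * (t%:R * ln 2) :> R by have := ler_wpM2l t0 l2; lra.
  have yL : t%:R * ln 2 <= 3 * L + y :> R by rewrite /y /L; lra.
  have [y0|y0] := leP 0 y.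
    have := @expR_ge1Dxn R y 1 y0; rewrite -[2`!]/2%N => ey.
    have tb : t%:R <= 2 * (3 * L + y) :> R by lra.
    have : t%:R ^+ 2 <= (2 * (3 * L + y)) ^+ 2 by rewrite lerXn2r ?nnegrE //; lra.
    move=> /le_trans; apply.
    have sq : 0 <= (3 * L - y) ^+ 2 by rewrite sqr_ge0.
    have : y ^+ 2 <= 2 * expR y by lra.
    move=> h; have := ler_wpM2r (ltW ey0) L2.
    move: sq; rewrite !expr2 in h *; lra.
  have tb : t%:R <= 6 * L :> R by lra.
  have : t%:R ^+ 2 <= (6 * L) ^+ 2 by rewrite lerXn2r ?nnegrE //; lra.
  have : 0 <= L ^+ 2 * expR y by rewrite mulr_ge0 ?ltW //; lra.
  rewrite !expr2; lra.
rewrite perm_avgD perm_avg_cst // perm_avgZ.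
have := perm_avg_exp_height us.
have : phi (size s) <= u ^+ 3.
  rewrite /phi /u -!natr1 ler_pdivrMr // exprS expr2.
  have x0 : 0 <= (size s)%:R :> R by [].
  have x2 := mulr_ge0 x0 x0; have x3 := mulr_ge0 x0 x2.
  lra.
move=> /[swap] /le_trans /[apply] h.
have c0 : 0 <= 16 * L ^+ 2 / u ^+ 3 by rewrite divr_ge0 ?(ltW u3) // mulr_ge0 //; lra.
have h2 := ler_wpM2l c0 h; rewrite divfK ?gt_eqF // in h2.
by apply: le_trans (lerD (lexx _) h2) _; lra.
Qed.

End RandomOrder.

(** * Random priorities *)

Lemma le0_archimedean (R : realType) (a b : R) : (forall n : nat, a <= b / n.+1%:R) -> a <= 0.
Proof.
move=> h; rewrite leNgt; apply/negP => a0.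
have b0 : 0 < b by have := h 0%N; rewrite divr1; exact: lt_le_trans.
have := h (Num.truncn (b / a)); apply/negP; rewrite -ltNge.
rewrite ltr_pdivrMr ?ltr0n // mulrC -ltr_pdivrMr //.
by have /andP[] := @truncn_itv R (b / a) ltac:(by rewrite divr_ge0 // ltW).
Qed.

Section RandomPriorities.
Local Open Scope classical_set_scope.
Context {R : realType} {dW : measure_display} {W : measurableType dW} (P : probability W R).
Context {K : eqType} (prio : K -> {RV P >-> R}).
Hypothesis iid : iid_uniform prio.

Lemma probabilityU_le (A B : set W) : measurable A -> measurable B ->
  (P (A `|` B) <= P A + P B)%E.
Proof. exact: measureU2. Qed.

Lemma probability_bigU_le (I : Type) (s : seq I) (A : I -> set W) :
  (forall i, measurable (A i)) ->
  (P (\big[setU/set0]_(i <- s) A i) <= \sum_(i <- s) P (A i))%E.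
Proof.
move=> mA; elim: s => [|i s IH]; first by rewrite !big_nil measure0.
rewrite !big_cons; apply: le_trans (measureU2 _ _ _) _ => //; last by rewrite leeD2l.
exact: bigsetU_measurable.
Qed.

Definition cell (N i : nat) : set R := `[i%:R / N%:R, i.+1%:R / N%:R[.

Lemma measurable_cell_itv N i : measurable (cell N i).
Proof. by rewrite /cell; exact: measurable_itv. Qed.

Lemma measurable_cell N i k : measurable (prio k @^-1` cell N i).
Proof. by apply: measurable_funPTI; exact: measurable_cell_itv. Qed.

Lemma prob_cell N i k : (i < N)%N -> P (prio k @^-1` cell N i) = (N%:R^-1)%:E.
Proof.
move=> iN; have N0 : 0 < N%:R :> R by rewrite ltr0n; apply: leq_ltn_trans iN.
have [_ h] := iid; have mC := measurable_cell_itv N i.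
have -> : P (prio k @^-1` cell N i) = uniform_prob (@ltr01 R) (cell N i) by rewrite -(h k).
rewrite /uniform_prob (eq_integral (cst 1%:E)); last first.
  move=> x; rewrite inE /cell /= in_itv /= => /andP[x0 x1]; rewrite /uniform_pdf ifT ?subr0 ?invr1 //.
  apply/andP; split; first by apply: le_trans x0; rewrite divr_ge0.
  by apply: le_trans (ltW x1) _; rewrite ler_pdivrMr // mul1r ler_nat.
apply: etrans (integral_cst lebesgue_measure mC 1%:E) _.
rewrite mul1e; apply: etrans (lebesgue_measure_itv `[i%:R / N%:R, i.+1%:R / N%:R[%R) _.
rewrite /= lte_fin.
rewrite ltr_pM2r ?invr_gt0 // ltr_nat leqnn.
by rewrite -EFinB -mulrBl -natrB // subSnn mul1r.
Qed.

(** Cells are half-open, so that truncation finds the cell of a value; the endpoint [1] then belongs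
    to this null event. *)
Definition outside k : set W := prio k @^-1` (~` cell 1 0).

Lemma measurable_outside k : measurable (outside k).
Proof. by rewrite /outside preimage_setC; apply: measurableC; exact: measurable_cell. Qed.

Lemma prob_outside k : P (outside k) = 0%E.
Proof.
rewrite /outside preimage_setC probability_setC; last exact: measurable_cell.
by rewrite prob_cell // invr1 subee.
Qed.

Lemma cell_cover (N : nat) (r : R) : (0 < N)%N -> cell 1 0 r ->
  cell N (Num.truncn (r * N%:R)) r /\ (Num.truncn (r * N%:R) < N)%N.
Proof.
move=> N0; rewrite /cell /= in_itv /= !mul0r divr1 => /andP[r0 r1].
have NR : 0 < N%:R :> R by rewrite ltr0n.
have /andP[t1 t2] := @truncn_itv R (r * N%:R) ltac:(by rewrite mulr_ge0).
rewrite in_itv /= ler_pdivrMr // ltr_pdivlMr // t1 t2; split=> //.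
rewrite -(ltr_nat R); apply: le_lt_trans t1 _.
by rewrite gtr_pMl.
Qed.

Lemma prob_cells (N : nat) (s : seq K) (c : K -> nat) : uniq s -> (forall k, k \in s -> c k < N)%N ->
  P (\bigcap_(k in [set` s]) (prio k @^-1` cell N (c k))) = ((N%:R^-1) ^+ size s)%:E.
Proof.
move=> us cN; have [indep _] := iid.
rewrite indep //; last by move=> k; exact: measurable_cell_itv.
rewrite big_seq (eq_bigr (fun=> (N%:R^-1)%:E)); last by move=> k ks; rewrite prob_cell ?cN.
rewrite -big_seq prodEFin; congr _%:E.
by rewrite big_const_seq count_predT iter_mulr_1.
Qed.

Lemma measurable_cells (N : nat) (s : seq K) (c : K -> nat) :
  measurable (\bigcap_(k in [set` s]) (prio k @^-1` cell N (c k))).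
Proof.
apply: fin_bigcap_measurable; first exact: finite_seq.
by move=> k _; exact: measurable_cell.
Qed.

Lemma measurable_lt k k' : measurable [set w | prio k w < prio k' w].
Proof.
have := @measurable_fun_ltr _ W R setT (prio k) (prio k')
  (measurable_funP _) (measurable_funP _).
move=> /(_ measurableT [set true] _); rewrite setTI; apply.
by [].
Qed.

Lemma bigsetU_in (I : eqType) (T : Type) (s : seq I) (A : I -> set T) i x :
  i \in s -> A i x -> (\big[setU/set0]_(j <- s) A j) x.
Proof.
elim: s => // j s IH; rewrite inE big_cons => /orP[/eqP<-|/IH h]; first by left.
by right; exact: h.
Qed.

Lemma measurable_eq_prio k k' : measurable [set w | prio k w = prio k' w].
Proof.
have -> : [set w | prio k w = prio k' w] =
      ~` ([set w | prio k w < prio k' w] `|` [set w | prio k' w < prio k w]).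
    apply/seteqP; split => w /=; first by move=> ->; case; rewrite ltxx.
    by move=> /not_orP[/negP h1 /negP h2]; apply/eqP; rewrite eq_le !leNgt h1 h2.
by apply: measurableC; apply: measurableU; exact: measurable_lt.
Qed.

(** Up to a null event, a tie puts both priorities in the same one of [n + 1] cells; this has
    probability [1 / (n + 1)], for every [n]. *)
Lemma prob_tie k k' : k != k' -> P [set w | prio k w = prio k' w] = 0%E.
Proof.
move=> kk'; have mT := measurable_eq_prio k k'.
apply/eqP; rewrite eq_le measure_ge0 andbT.
have fP : P [set w | prio k w = prio k' w] \is a fin_num.
  by apply: fin_num_measure.
rewrite -(fineK fP) lee_fin; apply: (@le0_archimedean _ _ 1) => n.
rewrite div1r -lee_fin fineK //.
pose Q i := \bigcap_(j in [set` [:: k; k']]) (prio j @^-1` cell n.+1 i).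
have sub : [set w | prio k w = prio k' w] `<=`
    outside k `|` \big[setU/set0]_(i <- iota 0 n.+1) Q i.
  move=> w /= e; have [ok|ok] := pselect (cell 1 0 (prio k w)); last by left.
  have [c1 c2] := cell_cover (ltn0Sn n) ok; right.
  have c3 : Num.truncn (prio k w * n.+1%:R) \in iota 0 n.+1 by rewrite mem_iota add0n c2.
  apply: (bigsetU_in c3).
  move=> j /=; rewrite !inE => /orP[/eqP->|/eqP->] //=; by rewrite -e.
have mQ i : measurable (Q i) by exact: measurable_cells.
have mU : measurable (\big[setU/set0]_(i <- iota 0 n.+1) Q i) by exact: bigsetU_measurable.
have mO := measurable_outside k.
apply: (@le_trans _ _ (P (outside k `|` \big[setU/set0]_(i <- iota 0 n.+1) Q i))).
  by apply: le_measure; rewrite ?inE //; exact: measurableU.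
apply: le_trans (probabilityU_le mO mU) _; rewrite prob_outside add0e.
apply: le_trans (probability_bigU_le _ mQ) _.
rewrite big_seq (eq_bigr (fun=> ((n.+1%:R^-1) ^+ 2)%:E)); last first.
  move=> i; rewrite mem_iota add0n => iN.
  by rewrite (@prob_cells _ [:: k; k'] (fun=> i)) //= !inE kk'.
rewrite -big_seq sumEFin lee_fin big_const_seq count_predT size_iota iter_addr addr0.
by rewrite -[_ ^+ _ *+ _]mulr_natl expr2 mulrA divff ?mul1r // pnatr_eq0.
Qed.

Definition increasing_along (s : seq K) : set W := [set w | sorted (fun x y => prio x w < prio y w) s].

Lemma measurable_increasing s : measurable (increasing_along s).
Proof.
rewrite /increasing_along; case: s => [|x s] /=; first by rewrite set_true.
elim: s x => [|y s IH] x /=; first by rewrite set_true.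
have -> : [set w | (prio x w < prio y w) && path (fun a b => prio a w < prio b w) y s] =
   [set w | prio x w < prio y w] `&` [set w | path (fun a b => prio a w < prio b w) y s].
  by apply/seteqP; split => w /= => [/andP[]|[-> ->]].
by apply: measurableI; [exact: measurable_lt|exact: IH].
Qed.

Lemma ffact_le_exp (n m : nat) : (n ^_ m <= n ^ m)%N.
Proof.
elim: m => [|m IH]; first by rewrite ffactn0 expn0.
by rewrite ffactnSr expnSr leq_mul // leq_subr.
Qed.

(* Discretising the priorities into [n + 1] cells, at most ['C(u + n, u)] of the
   [(n + 1) ^ u] cell patterns are compatible with a given order of [u] keys. *)
Lemma prob_increasing_cells (n : nat) s : uniq s ->
  (P (increasing_along s) <= ('C(size s + n, size s)%:R * (n.+1%:R^-1) ^+ size s)%:E)%E.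
Proof.
move=> us; pose u := size s.
pose T := enum [pred t : u.-tuple 'I_n.+1 | sorted leq [seq val i | i <- t]].
have sT : size T = 'C(u + n, u).
  by rewrite -cardE -card_sorted_tuples cardsE.
pose c (t : u.-tuple 'I_n.+1) k : nat := nth 0%N [seq val i | i <- t] (index k s).
pose Q t := \bigcap_(k in [set` s]) (prio k @^-1` cell n.+1 (c t k)).
have mQ t : measurable (Q t) by exact: measurable_cells.
have mO : measurable (\big[setU/set0]_(k <- s) outside k).
  by apply: bigsetU_measurable => k _; exact: measurable_outside.
have mU : measurable (\big[setU/set0]_(t <- T) Q t) by exact: bigsetU_measurable.
have sub : increasing_along s `<=` \big[setU/set0]_(k <- s) outside k `|` \big[setU/set0]_(t <- T) Q t.
  move=> w srt; have [out|inn] := pselect (exists2 k, k \in s & ~ cell 1 0 (prio k w)).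
    by left; case: out => k ks ok; exact: bigsetU_in ks ok.
  right.
  have {}inn k : k \in s -> cell 1 0 (prio k w).
    by move=> ks; apply: contrapT => nk; apply: inn; exists k.
  pose f k := Num.truncn (prio k w * n.+1%:R).
  have fP k : k \in s -> cell n.+1 (f k) (prio k w) /\ (f k < n.+1)%N.
    by move=> ks; apply: cell_cover => //; exact: inn.
  pose t : u.-tuple 'I_n.+1 := map_tuple (fun k => inord (f k)) (in_tuple s).
  have tE : [seq val i | i <- t] = [seq f k | k <- s].
    by rewrite /t /= -map_comp; apply/eq_in_map => k ks /=; rewrite inordK //; case: (fP k ks).
  have tT : t \in T.
    rewrite mem_enum inE tE sorted_map; apply: sub_sorted srt => x y /= xy.
    by apply: le_truncn; rewrite ler_wpM2r // ltW.
  apply: (bigsetU_in tT).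
  move=> k ks; have ks' : k \in s by exact: ks.
  have [fk _] := fP k ks'; rewrite /= /c tE (nth_map k) ?index_mem // nth_index //.
apply: (@le_trans _ _ (P (\big[setU/set0]_(k <- s) outside k `|` \big[setU/set0]_(t <- T) Q t))).
  apply: le_measure; rewrite ?inE //; last exact: measurableU.
  exact: measurable_increasing.
apply: le_trans (probabilityU_le mO mU) _.
have PO : (P (\big[setU/set0]_(k <- s) outside k) <= 0)%E.
  apply: le_trans (probability_bigU_le _ measurable_outside) _.
  by rewrite big1 // => k _; exact: prob_outside.
apply: le_trans (leeD PO (probability_bigU_le T mQ)) _; rewrite add0e.
rewrite big_seq (eq_bigr (fun=> ((n.+1%:R^-1) ^+ u)%:E)); last first.
  move=> t _; rewrite prob_cells // => k ks.
  by rewrite /c (nth_map ord0) ?ltn_ord // size_tuple index_mem.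
rewrite -big_seq sumEFin lee_fin big_const_seq count_predT iter_addr addr0 sT.
by rewrite -[_ ^+ _ *+ _]mulr_natl.
Qed.

(** Refining the cells: the bound times [u!] is at most [(1 + u / (n + 1)) ^ u], whose logarithm is
    at most [u ^ 2 / (n + 1)] for every [n]. A product above one would have a positive logarithm. *)
Lemma prob_increasing s : uniq s -> (P (increasing_along s) <= ((size s)`!%:R^-1)%:E)%E.
Proof.
move=> us; set u := size s.
have mI := measurable_increasing s.
have fP : P (increasing_along s) \is a fin_num by exact: fin_num_measure.
rewrite -(fineK fP) lee_fin.
set x := fine _; have f0 : 0 < u`!%:R :> R by rewrite ltr0n fact_gt0.
rewrite -[leRHS]mul1r ler_pdivlMr //.
rewrite leNgt; apply/negP => x1.
have : ln (x * u`!%:R) <= 0.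
  apply: (@le0_archimedean _ _ (u%:R * u%:R)) => n.
  have nR : 0 < n.+1%:R :> R by rewrite ltr0n.
  have : x <= 'C(u + n, u)%:R * (n.+1%:R^-1) ^+ u.
    by rewrite -lee_fin fineK //; exact: prob_increasing_cells.
  move=> /(ler_wpM2r (ltW f0)) => h; have {}h : x * u`!%:R <= ((u + n) ^_ u)%:R * (n.+1%:R^-1) ^+ u.
    by apply: le_trans h _; rewrite -bin_ffact natrM mulrAC.
  rewrite -[leRHS]expRK; apply: ln_le; first exact: lt_trans x1.
  apply: le_trans h _.
  apply: (@le_trans _ _ ((u + n)%:R ^+ u * (n.+1%:R^-1) ^+ u)).
    by rewrite ler_wpM2r ?exprn_ge0 ?invr_ge0 // -natrX ler_nat ffact_le_exp.
  have -> : u%:R * u%:R / n.+1%:R = (u%:R / n.+1%:R) * u%:R :> R by rewrite mulrAC.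
  rewrite expRM_natr -exprMn lerXn2r ?nnegrE ?mulr_ge0 ?invr_ge0 ?expR_ge0 //.
  apply: le_trans (expR_ge1Dx _).
  rewrite ler_pdivrMr // mulrDl mul1r divfK ?gt_eqF // -natrD ler_nat addSn addnC leqnSn //.
by apply/negP; rewrite -ltNge ln_gt0.
Qed.

Lemma increasing_rev s w : sorted (fun x y => prio y w < prio x w) s -> increasing_along (rev s) w.
Proof. by rewrite /increasing_along /= rev_sorted. Qed.

Lemma exists_order U w : uniq U ->
  {in U &, forall k k', k != k' -> prio k w != prio k' w} ->
  exists2 l, perm_eq l U & sorted (fun x y => prio y w < prio x w) l.
Proof.
move=> uU nt; pose t := sort (fun x y => prio x w <= prio y w) U.
have pt : perm_eq t U by rewrite perm_sort.
exists (rev t); first by rewrite perm_rev.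
rewrite rev_sorted -(@sorted_map _ _ (fun x => prio x w) (fun a b => a < b)).
rewrite (lt_sorted_uniq_le [seq prio x w | x <- t]); apply/andP; split.
  rewrite map_inj_in_uniq ?sort_uniq // => x y xt yt xy.
  apply/eqP; apply: contraT => xy'; move: xt yt; rewrite !(perm_mem pt) => xU yU.
  by have := nt x y xU yU xy'; rewrite xy eqxx.
by rewrite sorted_map; apply: sort_sorted => x y; exact: le_total.
Qed.

(** Measurability of [f] is not at hand, so its integral is unfolded as a supremum over simple
    functions below it. Off the ties, each is at most [H], which is measurable and adds [g l] on the
    event that the priorities decrease along [l]. *)
Lemma expectation_le_perm_avg (U : seq K) (f : W -> R) (g : seq K -> R) :
  uniq U -> (forall w, 0 <= f w) -> (forall l, 0 <= g l) ->
  (forall w l, perm_eq l U -> sorted (fun x y => prio y w < prio x w) l -> f w <= g l) ->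
  ('E_P[f] <= (perm_avg U g)%:E)%E.
Proof.
move=> uU f0 g0 fg.
pose ind l w : \bar R := (\1_(increasing_along (rev l)) w)%:E.
pose F l w : \bar R := ((g l)%:E * ind l w)%E.
pose H w := (\sum_(l <- permutations U) F l w)%E.
have F0 l w : (0 <= F l w)%E by rewrite /F -EFinM lee_fin mulr_ge0.
have mI l : measurable_fun setT (ind l).
  by apply/measurable_EFinP; exact: measurable_indic (measurable_increasing _).
have mF l : measurable_fun setT (F l) by apply: emeasurable_funM.
have H0 w : (0 <= H w)%E by apply: sume_ge0.
have mH : measurable_fun setT H by exact: emeasurable_sum.
have intH : (\int[P]_w H w <= (perm_avg U g)%:E)%E.
  rewrite ge0_integral_sum // /perm_avg mulr_suml -sumEFin.
  rewrite big_seq [leRHS]big_seq; apply: lee_sum => l; rewrite mem_permutations => lU.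
  rewrite ge0_integralZl_EFin //; last by move=> w _; rewrite lee_fin.
  rewrite /ind integral_indic //; last exact: measurable_increasing.
  rewrite setIT EFinM lee_wpmul2l ?lee_fin //.
  rewrite -(perm_size lU) -(size_rev l); apply: prob_increasing.
  by rewrite rev_uniq (perm_uniq lU).
apply: le_trans intH; rewrite expectation.unlock ge0_integralTE; last by move=> w; rewrite lee_fin.
apply: ge_ereal_sup => _ [phi /= phif <-]; rewrite -integralT_nnsfun.
apply: ae_ge0_le_integral => //.
- by move=> w _; rewrite lee_fin.
- by apply/measurable_EFinP; exact: measurable_funPT.
pose ties := [seq kk <- allpairs pair U U | kk.1 != kk.2].
pose A (kk : K * K) := [set w | prio kk.1 w = prio kk.2 w].
have mA kk : measurable (A kk) by exact: measurable_eq_prio.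
exists (\big[setU/set0]_(kk <- ties) A kk); split.
- by apply: bigsetU_measurable => kk _.
- apply/eqP; rewrite eq_le measure_ge0 andbT.
  apply: le_trans (probability_bigU_le _ mA) _.
  rewrite big_seq big1 // => -[k k']; rewrite mem_filter /= => /andP[kk' _].
  exact: prob_tie.
move=> w /= nle; apply: contrapT => noties; apply: nle => _.
have [|l lU srt] := @exists_order U w uU.
  move=> k k' kU k'U kk'; apply/eqP => e; apply: noties.
  apply: (@bigsetU_in _ _ _ _ (k, k')); last exact: e.
  by rewrite mem_filter kk' allpairs_f.
apply: le_trans (phif w) _; apply: (@le_trans _ _ (g l)%:E); first by rewrite lee_fin (fg w).
have lP : l \in permutations U by rewrite mem_permutations.
rewrite /H (perm_big _ (perm_to_rem lP)) big_cons /=.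
rewrite -[leLHS]adde0; apply: leeD; last by apply: sume_ge0.
rewrite /F /ind indicE mem_set ?mule1 //.
exact: increasing_rev.
Qed.

End RandomPriorities.

Section RandomTreaps.
Context {R : realType} {d : Order.disp_t} {K : orderType d}.

(** From [(2 * h + 1) ^+ 2 <= 8 * h ^+ 2 + 2] and [706 = 8 * 88 + 2]. *)
Lemma perm_avg_recs_sqr (U s : seq K) N : uniq U -> uniq s -> {subset s <= U} -> (size s <= N)%N ->
  perm_avg U (fun l => (2 * insertion_height [seq y <- l | y \in s] + 1)%:R ^+ 2) <=
    706 * (1 + ln (1 + N%:R)) ^+ 2 :> R.
Proof.
move=> uU us sU sN; set L : R := 1 + ln (1 + N%:R).
have L1 : 1 <= L by rewrite /L lerDl ln_ge0 // lerDl.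
have L2 : 1 <= L ^+ 2 by rewrite exprn_ege1.
have sE : size [seq y <- U | y \in s] = size s.
  apply/perm_size/uniq_perm; rewrite ?filter_uniq // => x; rewrite mem_filter andb_idr //.
  exact: sU.
pose g (l : seq K) : R := (insertion_height l)%:R ^+ 2.
apply: (@le_trans _ _ (perm_avg U (fun l => 8 * g [seq y <- l | y \in s] + 2))).
  apply: perm_avg_le => l _; rewrite /g; set h := insertion_height _.
  rewrite natrD natrM; have : 0 <= (2 * h%:R - 1 : R) ^+ 2 by exact: sqr_ge0.
  by rewrite !expr2; lra.
rewrite perm_avgD perm_avgZ perm_avg_cst // (perm_avg_filter _ g) //.
have := @perm_avg_height_sqr R _ _ _ (filter_uniq (fun y => y \in s) uU); rewrite sE.
have : (1 + ln (1 + (size s)%:R)) ^+ 2 <= L ^+ 2.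
  have s0 : 0 < 1 + (size s)%:R :> R by rewrite ltr_pwDl.
  rewrite lerXn2r ?nnegrE; [|by rewrite addr_ge0 // ln_ge0 // lerDl|by lra|].
    by [].
  by rewrite lerD2l ln_le // lerD2l ler_nat.
by rewrite -/g; lra.
Qed.

Section Fixed.
Context {dW : measure_display} {W : measurableType dW} (P : probability W R).
Context (prio : K -> {RV P >-> R}) (s1 s2 : seq K) (T1 T2 : W -> tree unit K) (m n : nat) (o : set_op).
Hypothesis iid : iid_uniform prio.
Hypotheses (rT1 : random_treap prio s1 T1) (rT2 : random_treap prio s2 T2).
Hypothesis szs : sizes m n (size s1) (size s2).

Local Notation lp := (@list_prio R _ K).
(** Keys common to both treaps share a priority, so one random order of all keys governs both;
    [perm_avg_filter] passes to a sublist. *)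
Let U := undup (s1 ++ s2).
Let s3 := third o s1 s2.
Let r w := run_op o (treap_join (fun k => prio k w)) (T1 w) (T2 w).

Let sub1 : {subset s1 <= U}.
Proof. by move=> x xs; rewrite mem_undup mem_cat xs. Qed.

Let sub2 : {subset s2 <= U}.
Proof. by move=> x xs; rewrite mem_undup mem_cat xs orbT. Qed.

Let sub31 : {subset s3 <= s1}.
Proof. by move=> x; rewrite /s3; case: o => //=; rewrite mem_filter => /andP[]. Qed.

Let size31 : (size s3 <= size s1)%N.
Proof. by rewrite /s3; case: o => //=; rewrite size_filter count_size. Qed.

Lemma random_treap_uniq s T : random_treap prio s T -> uniq s.
Proof.
move=> [_ h]; have [w _] : exists w : W, True.
  apply: contrapT => nw; have := probability_setT P.
  have -> : [set: W]%classic = set0 by apply/seteqP; split => // w _; case: nw; exists w.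
  by rewrite measure0 => /eqP; rewrite eqe eq_sym oner_eq0.
have [/andP[b _] <-] := h w; move: b; rewrite /bst; exact: (sorted_uniq lt_trans (ltxx (T := K))).
Qed.

Let us1 := random_treap_uniq rT1.
Let us2 := random_treap_uniq rT2.
Let us3 : uniq s3.
Proof. by rewrite /s3; case: o => //=; rewrite filter_uniq. Qed.
Let uU : uniq U := undup_uniq _.

Let run_cost w l : perm_eq l U -> sorted (fun x y => prio y w < prio x w) l ->
  (cwork (r w) <= 21 * npairs (lp l) s2 s1 + 8 * npairs (lp l) s2 s3 + 2)%N /\
  (cspan (r w) <= (2 * insertion_height [seq y <- l | y \in s2] + 1) *
    (21 * (2 * insertion_height [seq y <- l | y \in s1] + 1) +
     8 * (2 * insertion_height [seq y <- l | y \in s3] + 1)) + 2)%N.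
Proof.
move=> lU srt; pose p k := prio k w.
have pE := list_prioE lU srt.
have pinj : {in mem U &, injective p}.
  move=> x y xU yU e; have := pE x y xU yU; have := pE y x yU xU.
  rewrite -/(p x) -/(p y) e lexx !lerN2 !ler_nat => /esym h1 /esym h2.
  have {}h1 : index x l == index y l by rewrite eqn_leq h1 h2.
  have xl : x \in l by rewrite (perm_mem lU). have yl : y \in l by rewrite (perm_mem lU).
  move/eqP: h1 => ei;  by rewrite -(nth_index x xl) ei nth_index.
have [[_ h1] [_ h2]] := (rT1, rT2); have [t1 i1] := h1 w; have [t2 i2] := h2 w.
have g1 : good p (mem U) (T1 w) by apply: treap_good => //; rewrite i1.
have g2 : good p (mem U) (T2 w) by apply: treap_good => //; rewrite i2.
have := treap_op_cost pinj o g1 g2; rewrite i1 i2 -/s3 => -[hw hs].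
have sub3 : {subset s3 <= U} by move=> x /sub31/sub1.
split; first by rewrite -!(eq_npairs pE).
have rl s v : uniq s -> {subset s <= U} -> (recs p s v <= 2 * insertion_height [seq y <- l | y \in s] + 1)%N.
  by move=> us sU; exact: recs_le_height lU srt.
apply: leq_trans (hs _ _ (fun v _ => rl s1 v us1 sub1) (fun v _ => rl s3 v us3 sub3)) _.
rewrite leq_add2r leq_mul2r; apply/orP; right; apply: height_le_recs g2 _ => v _.
by rewrite i2; exact: rl.
Qed.

(** With [l] the logarithm in the bound, [29 * m * (25 + 8 * l) + 2] is at most
    [(1450 + 232 + 4) * (m * l)], because [l >= 1 / 2]. *)
Lemma treap_expected_work : (0 < m)%N ->
  ('E_P[fun w => (cwork (r w))%:R] <= (1700 * work_bound R m n)%:E)%E.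
Proof.
move=> m0; have [mn hmn] := szs.
pose g l : R := 21 * (npairs (lp l) s2 s1)%:R +
  (8 * (npairs (lp l) s2 s3)%:R + 2).
have sub3 : {subset s3 <= U} by move=> x /sub31/sub1.
apply: (@le_trans _ _ (perm_avg U g)%:E).
  apply: (expectation_le_perm_avg iid) => // [l|w l lU srt].
    by rewrite /g !addr_ge0 // mulr_ge0.
  have [h _] := run_cost lU srt; rewrite /g -!natrM -!natrD ler_nat addnA; exact: h.
rewrite lee_fin /g !perm_avgD !perm_avgZ perm_avg_cst // /work_bound.
have h1 := @perm_avg_npairs R _ _ U s2 s1 m n uU us2 us1 sub2 sub1.
have h3 := @perm_avg_npairs R _ _ U s2 s3 m n uU us2 us3 sub2 sub3.
have l0 := @ln_ratio_ge R m n; move: h1 h3 l0; rewrite m0 mn => /(_ isT) h1 /(_ isT) h3 /(_ isT).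
set l := ln _ => l0.
have {}h1 : perm_avg U (fun l => (npairs (lp l) s2 s1)%:R) <= m%:R * (25 + 8 * l).
  by apply: h1; case: hmn => -[-> ->]; [right|left].
have {}h3 : perm_avg U (fun l => (npairs (lp l) s2 s3)%:R) <= m%:R * (25 + 8 * l).
  apply: h3; have := size31; case: hmn => -[-> ->] s31; [right|left]; split=> //.
have m1 : 1 <= m%:R :> R by rewrite ler1n.
have : m%:R * (1 / 2) <= m%:R * l by rewrite ler_wpM2l.
move: h1 h3; rewrite mulrDr (mulrCA m%:R); lra.
Qed.

(** The three squares contribute [29 * 706] times [l1 * l2], and each of [l1] and [l2] is at most
    four times a logarithm of a size; [29 * 706 * 16 + 8] is below [600 * 600]. *)
Lemma treap_expected_span : (1 < m)%N ->
  ('E_P[fun w => (cspan (r w))%:R] <= (600 * 600 * span_bound R m n)%:E)%E.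
Proof.
move=> m1; have [mn hmn] := szs.
have [n1 n2] : ((1 < size s1) /\ (1 < size s2))%N.
  by case: hmn => -[-> ->]; split=> //; exact: leq_trans mn.
pose l1 : R := 1 + ln (1 + (size s1)%:R); pose l2 : R := 1 + ln (1 + (size s2)%:R).
have l10 : 0 < l1 by rewrite ltr_pwDl // ln_ge0 // lerDl.
have l20 : 0 < l2 by rewrite ltr_pwDl // ln_ge0 // lerDl.
(* This weight balances the squares: [th * l2 ^+ 2] and [l1 ^+ 2 / th] both equal [l1 * l2]. *)
pose th := l1 / l2; have th0 : 0 < th by rewrite divr_gt0.
pose M (s l : seq K) : R := (2 * insertion_height [seq y <- l | y \in s] + 1)%:R.
pose g l : R := 29 / 2 * th * M s2 l ^+ 2 + (21 / 2 / th * M s1 l ^+ 2 + (4 / th * M s3 l ^+ 2 + 2)).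
have sub3 : {subset s3 <= U} by move=> x /sub31/sub1.
(* AM-GM: [x y <= (th x^2 + y^2 / th) / 2] *)
have amgm x y : x * y <= th / 2 * x ^+ 2 + th^-1 / 2 * y ^+ 2.
  have : 0 <= th^-1 * (th * x - y) ^+ 2 by rewrite mulr_ge0 ?invr_ge0 ?sqr_ge0 // ltW.
  have -> : th^-1 * (th * x - y) ^+ 2 = th * x ^+ 2 - 2 * (x * y) + th^-1 * y ^+ 2.
    by field; rewrite gt_eqF.
  by lra.
apply: (@le_trans _ _ (perm_avg U g)%:E).
  apply: (expectation_le_perm_avg iid) => // [l|w l lU srt].
    by rewrite /g !addr_ge0 // mulr_ge0 ?sqr_ge0 // ?mulr_ge0 ?invr_ge0 // ltW.
  have [_ h] := run_cost lU srt.
  have {}h : (cspan (r w))%:R <= M s2 l * (21 * M s1 l + 8 * M s3 l) + 2.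
    by rewrite /M -!natrM -natrD -natrM -natrD ler_nat.
  have := amgm (M s2 l) (M s1 l); have := amgm (M s2 l) (M s3 l).
  move: h; rewrite /g mulrDr !(mulrCA (M s2 l)); lra.
rewrite lee_fin /g !perm_avgD !perm_avgZ perm_avg_cst // /span_bound.
have -> : ln n%:R * ln m%:R = ln (size s1)%:R * ln (size s2)%:R :> R.
  by case: hmn => -[-> ->] //; rewrite mulrC.
have [a1 a2] := @ln1Dn_le R _ n1; have [b1 b2] := @ln1Dn_le R _ n2.
have e2 : th * l2 ^+ 2 = l1 * l2 by rewrite /th; field; rewrite gt_eqF.
have e1 : th^-1 * l1 ^+ 2 = l1 * l2 by rewrite /th; field; rewrite !gt_eqF.
have c2 : th * perm_avg U (fun l => M s2 l ^+ 2) <= 706 * (l1 * l2).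
  by rewrite -e2 [leRHS]mulrCA ler_wpM2l ?(ltW th0) //; exact: perm_avg_recs_sqr.
have ti : 0 <= th^-1 by rewrite invr_ge0 ltW.
have c1 : th^-1 * perm_avg U (fun l => M s1 l ^+ 2) <= 706 * (l1 * l2).
  by rewrite -e1 [leRHS]mulrCA ler_wpM2l //; exact: perm_avg_recs_sqr.
have c3 : th^-1 * perm_avg U (fun l => M s3 l ^+ 2) <= 706 * (l1 * l2).
  by rewrite -e1 [leRHS]mulrCA ler_wpM2l //; exact: perm_avg_recs_sqr.
have ll : l1 * l2 <= (4 * ln (size s1)%:R) * (4 * ln (size s2)%:R).
  by rewrite ler_pM ?(ltW l10) ?(ltW l20) // /l1 /l2; lra.
have : 1 / 2 * (1 / 2) <= ln (size s1)%:R * ln (size s2)%:R :> R by rewrite ler_pM //; lra.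
move: c1 c2 c3 ll; lra.
Qed.

End Fixed.
End RandomTreaps.

Theorem theorem4 (R : realType) :
  (* AVL trees *)
  (exists C : R, forall (o : set_op) (d : Order.disp_t) (K : orderType d)
     (T1 T2 : tree unit K) (m n : nat),
     avl T1 -> avl T2 -> sizes m n (tree_size T1) (tree_size T2) ->
     let r := run_op o avl_join T1 T2 in
     ((0 < m)%N -> (cwork r)%:R <= C * work_bound R m n) /\
     ((1 < m)%N -> (cspan r)%:R <= C * span_bound R m n))
  /\
  (* red-black trees *)
  (exists C : R, forall (o : set_op) (d : Order.disp_t) (K : orderType d)
     (T1 T2 : tree color K) (m n : nat),
     rb T1 -> rb T2 -> sizes m n (tree_size T1) (tree_size T2) ->
     let r := run_op o rb_join T1 T2 in
     ((0 < m)%N -> (cwork r)%:R <= C * work_bound R m n) /\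
     ((1 < m)%N -> (cspan r)%:R <= C * span_bound R m n))
  /\
  (* weight-balanced trees *)
  (forall alpha : R, 2 / 11 < alpha -> alpha <= 1 - 1 / Num.sqrt 2 ->
   exists C : R, forall (o : set_op) (d : Order.disp_t) (K : orderType d)
     (T1 T2 : tree unit K) (m n : nat),
     wb alpha T1 -> wb alpha T2 -> sizes m n (tree_size T1) (tree_size T2) ->
     let r := run_op o (wb_join alpha) T1 T2 in
     ((0 < m)%N -> (cwork r)%:R <= C * work_bound R m n) /\
     ((1 < m)%N -> (cspan r)%:R <= C * span_bound R m n))
  /\
  (* treaps *)
  (exists C : R, forall (o : set_op) (d : Order.disp_t) (K : orderType d)
     (dW : measure_display) (W : measurableType dW) (P : probability W R)
     (prio : K -> {RV P >-> R}) (s1 s2 : seq K) (T1 T2 : W -> tree unit K)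
     (m n : nat),
     iid_uniform prio ->
     random_treap prio s1 T1 -> random_treap prio s2 T2 ->
     sizes m n (size s1) (size s2) ->
     let r := fun w => run_op o (treap_join (fun k => prio k w)) (T1 w) (T2 w) in
     ((0 < m)%N ->
        ('E_P[fun w => (cwork (r w))%:R] <= (C * work_bound R m n)%:E)%E) /\
     ((1 < m)%N ->
        ('E_P[fun w => (cspan (r w))%:R] <= (C * span_bound R m n)%:E)%E)).
Proof.
have deterministic (c : R) : 1 <= c -> exists C : R,
    forall (o : set_op) (d : Order.disp_t) (K : orderType d) (B : Type)
      rank (bal ok : pred (tree B K)) join T1 T2 m n,
    joinable c rank bal join -> (forall T, ok T -> bal T) ->
    bst T1 && ok T1 -> bst T2 && ok T2 -> sizes m n (tree_size T1) (tree_size T2) ->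
    let r := run_op o join T1 T2 in
    ((0 < m)%N -> (cwork r)%:R <= C * work_bound R m n) /\
    ((1 < m)%N -> (cspan r)%:R <= C * span_bound R m n).
  move=> c1; have [C h] := joinable_set_ops c1; exists C.
  move=> o d K B rank bal ok join T1 T2 m n J okb /andP[_ /okb b1] /andP[_ /okb b2] szs.
  exact: h J b1 b2 szs.
split; last split; last split.
- have [C h] := deterministic 12 ltac:(by rewrite ler1n); exists C.
  by move=> o d K T1 T2 m n t1 t2; apply: h t1 t2; [exact: avl_joinable|].
- have [C h] := deterministic 20 ltac:(by rewrite ler1n); exists C.
  by move=> o d K T1 T2 m n t1 t2; apply: h t1 t2; [exact: rb_joinable|exact: rb_balanced_ok].
- move=> alpha al0 al1; have [al2 al3] := wb_alpha_range al1.
  have al4 : 0 < alpha by lra.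
  have J K := @wb_joinable R K alpha al4 al2 al3.
  (* The gap constant depends on [alpha] alone; [nat] is an arbitrary key type from which to read
     off that it is at least [1]. *)
  have [C h] := deterministic _ (jn_c (J nat)); exists C.
  by move=> o d K T1 T2 m n t1 t2; apply: h (J K) _ t1 t2.
- exists (600 * 600) => o d K dW W P prio s1 s2 T1 T2 m n iid r1 r2 szs r; split=> m0.
    apply: le_trans (treap_expected_work o iid r1 r2 szs m0) _.
    rewrite lee_fin ler_wpM2r //; last lra.
    have := @ln_ratio_ge R m n; rewrite m0 => /(_ szs.1) h.
    by rewrite /work_bound mulr_ge0 //; lra.
  exact: treap_expected_span o iid r1 r2 szs m0.
Qed.
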